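(* Let $\omega(x)=1+x^2$ on $\mathbb{R}$, let $1/2<\beta\leq3/2$, let $\mu_\beta$ be the probability measure on $\mathbb{R}$ with density proportional to $\omega^{-\beta}$, and let $Lf=\omega f''-2(\beta-1)xf'$, with associated semigroup $(\mathbf{P}_t)_{t\geq0}$. Then $\lambda_1(-L)=(\beta-1/2)^2$ and for all $f\in\mathcal{C}_c^\infty(\mathbb{R})$, $$\Big(\beta-\frac12\Big)^2\mathrm{Var}_{\mu_\beta}(f)-\int_{\mathbb{R}}\omega f'^2\,d\mu_\beta=-2\int_0^{+\infty}\!\int_{\mathbb{R}}\Big\{\Big(\omega(\mathbf{P}_tf)''+\Big(\frac32-\beta\Big)x(\mathbf{P}_tf)'\Big)^2+\Big(\frac32-\beta\Big)\Big(\beta-\frac12\Big)\big((\mathbf{P}_tf)'\big)^2\Big\}\,d\mu_\beta\,dt.$$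
   Context: The operator $L$, defined on $\mathcal{C}_c^\infty(\mathbb{R})$, is symmetric and essentially self-adjoint in $L^2(\mu_\beta)$; its self-adjoint extension, still denoted $L$, has domain $\mathcal{D}(L)\subset L^2(\mu_\beta)$, and $\mathbf{P}_t=e^{tL}$ is the $L^2(\mu_\beta)$-semigroup it generates. The spectral gap is $$\lambda_1(-L)=\inf\left\{\frac{\int_{\mathbb{R}}-f\,Lf\,d\mu_\beta}{\mathrm{Var}_{\mu_\beta}(f)}\ :\ f\in\mathcal{D}(L),\ \mathrm{Var}_{\mu_\beta}(f)\neq0\right\}.$$ *)

(* Defs.v *)
From HB Require Import structures.
From mathcomp Require Import all_boot all_order all_algebra.
From mathcomp Require Import all_classical all_reals all_analysis.
From mathcomp Require Import measurable_realfun.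

Set Implicit Arguments.
Unset Strict Implicit.
Unset Printing Implicit Defensive.

Import Order.TTheory GRing.Theory Num.Theory.
Import numFieldNormedType.Exports.

Local Open Scope classical_set_scope.
Local Open Scope ring_scope.

Definition omega {R : realType} (x : R) : R := 1 + x ^+ 2.

Section weight_measure.
Context {R : realType}.
Variable beta : R.

Definition weight_measure (A : set R) : \bar R :=
  (\int[lebesgue_measure]_(x in A) (omega x `^ (- beta))%:E)%E.

Let weight_measure0 : weight_measure set0 = 0%E.
Proof. by rewrite /weight_measure integral_set0. Qed.

Let weight_measure_ge0 A : (0 <= weight_measure A)%E.
Proof. by apply: integral_ge0 => x _; rewrite lee_fin powR_ge0. Qed.

Let measurable_weight :
  measurable_fun [set: R] (fun x : R => omega x `^ (- beta)).
Proof.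
apply: (@measurableT_comp _ _ _ _ _ _ (@powR R ^~ (- beta)) _ omega) => //.
by apply: measurable_funD => //; exact: measurable_funX.
Qed.

Let weight_measure_sigma_additive : semi_sigma_additive weight_measure.
Proof.
move=> /= A mA tA mUA.
rewrite /weight_measure ge0_integral_bigcup//=; last first.
- by move=> x _; rewrite lee_fin powR_ge0.
- apply/measurable_EFinP; exact: measurable_funTS.
apply: is_cvg_ereal_nneg_natsum_cond => n _ _.
by apply: integral_ge0 => x _; rewrite lee_fin powR_ge0.
Qed.

HB.instance Definition _ := isMeasure.Build _ _ _ weight_measure
  weight_measure0 weight_measure_ge0 weight_measure_sigma_additive.

End weight_measure.

(* The Dirac mass is the value that mnormalize returns when the total mass is  *)
(* infinite, i.e. for beta <= 1/2 only.                                        *)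
Definition mu_ {R : realType} (beta : R) : probability R R :=
  mnormalize (weight_measure beta) (dirac (0 : R)).

(* Elements of L^2 are represented by functions; L2norm, L2cvg, the graph Lbar *)
(* and lambda1 are invariant under almost everywhere equality.                 *)
Definition L2 {R : realType} (beta : R) : {pred R -> R} := Lfun (mu_ beta) 2%:E.

Definition L2norm {R : realType} (beta : R) (f : R -> R) : \bar R :=
  'N[mu_ beta]_(2%:E)[EFin \o f]%E.

Definition L2cvg {R : realType} (beta : R) {T : Type} (F : set_system T)
    (u : T -> R -> R) (f : R -> R) : Prop :=
  L2norm beta (u t \- f) @[t --> F] --> 0%E.

Definition smooth {R : realType} (f : R -> R) : Prop :=
  forall n x, derivable f^`(n)%classic x 1.

Definition Ccinfty {R : realType} : set (R -> R) :=
  [set f | smooth f /\ compact (closure [set x | f x != 0])].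

Definition L {R : realType} (beta : R) (f : R -> R) (x : R) : R :=
  omega x * f^`(2)%classic x - 2 * (beta - 1) * x * f^`()%classic x.

(* The graph of the self-adjoint extension of L: Lbar beta f g means that f    *)
(* belongs to its domain D(L) and is mapped to g. Since L is essentially       *)
(* self-adjoint on Ccinfty, this extension is the closure of L in L^2.         *)
Definition Lbar {R : realType} (beta : R) (f g : R -> R) : Prop :=
  [/\ f \in L2 beta, g \in L2 beta &
    exists phi : nat -> R -> R,
      [/\ forall n, Ccinfty (phi n),
          L2cvg beta \oo phi f &
          L2cvg beta \oo (fun n => L beta (phi n)) g]].

Definition lambda1 {R : realType} (beta : R) : \bar R :=
  ereal_inf [set q | exists f g : R -> R,
    [/\ Lbar beta f g, 'V_(mu_ beta)[f] != 0%E &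
        q = ((\int[mu_ beta]_x (- f x * g x)) / fine 'V_(mu_ beta)[f])%:E]].

(* (P_t)_{t >= 0} is the strongly continuous semigroup of bounded linear       *)
(* operators on L^2 whose generator is the self-adjoint operator Lbar, i.e.    *)
(* P_t = exp(t L).                                                             *)
Record generated_semigroup {R : realType} (beta : R)
    (P : R -> (R -> R) -> (R -> R)) : Prop := GeneratedSemigroup {
  semigroup_L2 : forall (t : R) f, 0 <= t -> f \in L2 beta -> P t f \in L2 beta;
  semigroup_ae : forall (t : R) f g, 0 <= t -> f \in L2 beta -> g \in L2 beta ->
    f = g %[ae mu_ beta] -> P t f = P t g %[ae mu_ beta];
  semigroup_linear : forall (t a : R) f g,
    0 <= t -> f \in L2 beta -> g \in L2 beta ->
    P t (a \*: f \+ g) = a \*: P t f \+ P t g %[ae mu_ beta];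
  semigroup_bounded : forall t : R, 0 <= t -> exists C : R,
    forall f, f \in L2 beta -> (L2norm beta (P t f) <= C%:E * L2norm beta f)%E;
  semigroup0 : forall f, f \in L2 beta -> P 0 f = f %[ae mu_ beta];
  semigroupD : forall (s t : R) f, 0 <= s -> 0 <= t -> f \in L2 beta ->
    P (s + t) f = P s (P t f) %[ae mu_ beta];
  semigroup_continuous : forall f, f \in L2 beta -> L2cvg beta 0^'+ (P ^~ f) f;
  semigroup_generator : forall f g, f \in L2 beta -> g \in L2 beta ->
    (Lbar beta f g <->
     L2cvg beta 0^'+ (fun t x => t^-1 * (P t f x - f x)) g)
}.

Definition C2 {R : realType} (f : R -> R) : Prop :=
  [/\ forall x, derivable f x 1, forall x, derivable f^`()%classic x 1 &
      continuous f^`(2)%classic].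

(* The twice continuously differentiable function in the class of f (unique,   *)
(* as mu_ beta charges every nonempty open set); it is the function which is   *)
(* differentiated in (P_t f)' and (P_t f)''.                                   *)
Definition C2_version {R : realType} (beta : R) (f : R -> R) : R -> R :=
  xget f [set u | C2 u /\ u = f %[ae mu_ beta]].

(* Main.v *)
(** Write [a = beta - 1/2], [0 < a <= 1]. On [L^2(mu)], [Lbar] is symmetric and
    satisfies the Poincare inequality with constant [a^2] (a Hardy inequality on
    each half-line); the functions [omega^g], [g < a/2], cut off at infinity by a
    flat function, show that this constant is optimal.

    Along the semigroup, [V(t) = Var (P_t f)] and [e(t) = - <P_t f, L P_t f>]
    satisfy [V' = - 2 e] and [e' = - 2 |L P_t f|^2]. Hence [V + 2 t e] decreases,
    so [Phi = a^2 V - e] tends to [0], and [- Phi(0)] is the integral over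
    [t >= 0] of [Phi' = 2 (|L u|^2 + a^2 <u, L u>)], where [u = P_t f].
    Integrating by parts against [x u'], the bracket is, for compactly supported
    [u], the integral of [(omega u'' + (1 - a) x u')^2 + (1 - a) a u'^2]. Since
    [omega^(1 - beta) u'] is a primitive of [omega^(-beta) L u], convergence in the
    graph norm controls [u'], so that elements of the domain of [L^2] have [C^2]
    versions and the identity passes to them. *)

Require Import Defs.
From HB Require Import structures.
From mathcomp Require Import all_boot all_order all_algebra.
From mathcomp Require Import all_classical all_reals all_analysis.
From mathcomp Require Import measurable_realfun.
From mathcomp Require Import ring lra.

Set Implicit Arguments.
Unset Strict Implicit.
Unset Printing Implicit Defensive.

Import Order.TTheory GRing.Theory Num.Theory.
Import numFieldNormedType.Exports.

Local Open Scope classical_set_scope.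
Local Open Scope ring_scope.

(** * Semi-inner products and semigroups *)

Section semi_inner_product.
Context {R : realType} {V : lmodType R}.

(** An element of [LfunType] is a function, not a class, so [L2ip] is only semidefinite: two
    representatives of a class are at distance zero without being equal. Hence the abstract part is
    written for semi-inner products, and the semigroup laws read [nrm (_ - _) = 0].

    The laws of the semigroup bound each operator separately and give strong continuity at 0, and
    the generator is a right derivative at 0. The uniform boundedness principle, which rests on the
    completeness of L^2, supplies a bound that is uniform on bounded time intervals; it turns these
    data into two-sided derivatives of orbits at positive times.

    For a test function f, both L f and L (L f) are again test functions, so u and L u stay in the
    domain along the orbit: this is what lets e be differentiated and u'' be taken pointwise.

    The condition a <= 1 enters through two signs: the weight (1 - a) a of u'^2, which makes the
    integrand in time nonnegative, and the potential (1 - a) (2 + a) / omega left over in the proof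
    of the Hardy inequality. *)

Record semi_inner_product (ip : V -> V -> R) : Prop := SemiInnerProduct {
  ipC : forall u v, ip u v = ip v u ;
  ip_linearl : forall a u v w, ip (a *: u + v) w = a * ip u w + ip v w ;
  ip_ge0 : forall u, 0 <= ip u u }.

Variable ip : V -> V -> R.
Hypothesis Hip : semi_inner_product ip.
Let C := ipC Hip.
Let linl := ip_linearl Hip.
Let ge0 := ip_ge0 Hip.

Lemma ipDl u v w : ip (u + v) w = ip u w + ip v w.
Proof. by have := linl 1 u v w; rewrite scale1r mul1r. Qed.

Lemma ip0l w : ip 0 w = 0.
Proof. by have := ipDl 0 0 w; rewrite addr0 => /eqP; rewrite addrC -subr_eq subrr => /eqP. Qed.

Lemma ipZl a u w : ip (a *: u) w = a * ip u w.
Proof. by have := linl a u 0 w; rewrite addr0 ip0l addr0. Qed.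

Lemma ipNl u w : ip (- u) w = - ip u w.
Proof. by rewrite -scaleN1r ipZl mulN1r. Qed.

Lemma ipBl u v w : ip (u - v) w = ip u w - ip v w.
Proof. by rewrite ipDl ipNl. Qed.

Lemma ipDr u v w : ip w (u + v) = ip w u + ip w v.
Proof. by rewrite C ipDl !(C w). Qed.

Lemma ipZr a u w : ip w (a *: u) = a * ip w u.
Proof. by rewrite C ipZl (C w). Qed.

Lemma ipBr u v w : ip w (u - v) = ip w u - ip w v.
Proof. by rewrite C ipBl !(C w). Qed.

Definition ip_norm u := Num.sqrt (ip u u).

Local Notation nrm := ip_norm.

Lemma nrm_ge0 u : 0 <= nrm u. Proof. exact: sqrtr_ge0. Qed.

Lemma sqr_nrm u : nrm u ^+ 2 = ip u u. Proof. exact/sqr_sqrtr/ge0. Qed.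

Lemma ip_cauchy_schwarz u v : ip u v ^+ 2 <= ip u u * ip v v.
Proof.
have H t : 0 <= t ^+ 2 * ip u u + 2 * t * ip u v + ip v v.
  suff -> : t ^+ 2 * ip u u + 2 * t * ip u v + ip v v = ip (t *: u + v) (t *: u + v).
    exact: ge0.
  by rewrite ipDl !ipDr !ipZl !ipZr (C v u); ring.
have [u0|u0] := eqVneq (ip u u) 0; last first.
  have pu : 0 < ip u u by rewrite lt_neqAle eq_sym u0 ge0.
  have := H (- (ip u v / ip u u)).
  rewrite -(ler_pM2l pu) mulr0.
  have -> : ip u u * ((- (ip u v / ip u u)) ^+ 2 * ip u u + 2 * - (ip u v / ip u u) * ip u v
      + ip v v) = ip u u * ip v v - ip u v ^+ 2 by field.
  by rewrite subr_ge0.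
rewrite u0 mul0r.
have [->|B0] := eqVneq (ip u v) 0; first by rewrite expr0n.
(* When [ip u u = 0] the quadratic [H] is affine in [t]; at this point it takes the value -1. *)
have := H (- ((ip v v + 1) / (2 * ip u v))).
rewrite u0 mulr0 add0r.
have -> : 2 * - ((ip v v + 1) / (2 * ip u v)) * ip u v + ip v v = -1 by field.
by rewrite lerNr oppr0 ler10.
Qed.

Lemma ler_ip u v : `|ip u v| <= nrm u * nrm v.
Proof.
rewrite -sqrtr_sqr /nrm -sqrtrM ?ge0// ler_wsqrtr//; exact: ip_cauchy_schwarz.
Qed.

Lemma ler_nrmD u v : nrm (u + v) <= nrm u + nrm v.
Proof.
rewrite -ler_sqr ?nnegrE ?addr_ge0 ?nrm_ge0// sqrrD !sqr_nrm ipDl !ipDr (C v u).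
have := le_trans (ler_norm _) (ler_ip u v).
by move: (ip u u) (ip v v) (ip u v) (nrm u) (nrm v) => *; lra.
Qed.

Lemma nrmZ a u : nrm (a *: u) = `|a| * nrm u.
Proof.
by rewrite /nrm ipZl ipZr mulrA -expr2 sqrtrM ?sqr_ge0// sqrtr_sqr.
Qed.

Lemma nrm0 : nrm 0 = 0. Proof. by rewrite /nrm ip0l sqrtr0. Qed.

Lemma nrmN u : nrm (- u) = nrm u.
Proof. by rewrite -scaleN1r nrmZ normrN1 mul1r. Qed.

Lemma nrm_distC u v : nrm (u - v) = nrm (v - u).
Proof. by rewrite -nrmN opprB. Qed.

Lemma ler_nrm_distD w u v : nrm (u - v) <= nrm (u - w) + nrm (w - v).
Proof. by have := ler_nrmD (u - w) (w - v); rewrite addrA subrK. Qed.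

Lemma ler_nrm_dist u v : nrm u <= nrm v + nrm (u - v).
Proof. by have := ler_nrmD v (u - v); rewrite addrCA subrr addr0. Qed.

Lemma cvg_ip {T : Type} (F : set_system T) {FF : Filter F} (u v : T -> V) u0 v0 :
  nrm (u t - u0) @[t --> F] --> 0 -> nrm (v t - v0) @[t --> F] --> 0 ->
  ip (u t) (v t) @[t --> F] --> ip u0 v0.
Proof.
move=> hu hv; apply/cvgrPdistC_lt => e e0.
pose M := nrm u0 + nrm v0 + 1.
have M0 : 0 < M by rewrite ltr_wpDl ?addr_ge0 ?nrm_ge0.
have d0 : 0 < Num.min 1 (e / M / 2) by rewrite lt_min ltr01 !divr_gt0.
move/cvgrPdistC_lt : hu => /(_ _ d0) hu.
move/cvgrPdistC_lt : hv => /(_ _ d0) hv.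
near=> t.
have /andP[u1 u2] : (nrm (u t - u0) < 1) && (nrm (u t - u0) < e / M / 2).
  by rewrite -lt_min -[ltLHS]ger0_norm ?nrm_ge0// -[X in `|X|]subr0; near: t.
have /andP[v1 v2] : (nrm (v t - v0) < 1) && (nrm (v t - v0) < e / M / 2).
  by rewrite -lt_min -[ltLHS]ger0_norm ?nrm_ge0// -[X in `|X|]subr0; near: t.
have -> : ip (u t) (v t) - ip u0 v0 = ip (u t - u0) (v t) + ip u0 (v t - v0).
  by rewrite ipBl ipBr; ring.
apply: le_lt_trans (ler_normD _ _) _.
apply: (@le_lt_trans _ _ (nrm (u t - u0) * nrm (v t) + nrm u0 * nrm (v t - v0))).
  by apply: lerD; exact: ler_ip.
have hvt : nrm (v t) <= nrm v0 + 1.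
  by apply: le_trans (ler_nrm_dist _ v0) _; rewrite lerD2l ltW.
have hM : M * (e / M / 2) = e / 2 by field; rewrite gt_eqF.
apply: (@le_lt_trans _ _ (nrm (u t - u0) * (nrm v0 + 1) + nrm u0 * nrm (v t - v0))).
  by rewrite lerD2r ler_wpM2l ?nrm_ge0.
apply: (@le_lt_trans _ _ ((e / M / 2) * (nrm v0 + 1) + nrm u0 * (e / M / 2))).
  by apply: lerD; [rewrite ler_wpM2r ?addr_ge0 ?nrm_ge0// ltW|rewrite ler_wpM2l ?nrm_ge0// ltW].
have -> : e / M / 2 * (nrm v0 + 1) + nrm u0 * (e / M / 2) = M * (e / M / 2).
  by rewrite /M; ring.
by rewrite hM; lra.
Unshelve. all: by end_near. Qed.

End semi_inner_product.

(** * The uniform boundedness principle *)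

Section uniform_boundedness.
Context {R : realType} {V : lmodType R}.
Variable ip : V -> V -> R.
Hypothesis Hip : semi_inner_product ip.
Local Notation nrm := (ip_norm ip).

Definition seminorm (p : V -> R) : Prop :=
  (forall u v, p (u + v) <= p u + p v) /\ (forall a u, p (a *: u) = `|a| * p u).

Lemma seminorm_ge0 p u : seminorm p -> 0 <= p u.
Proof.
move=> [pD pZ]; have := pD u (-1 *: u).
rewrite scaleN1r subrr -[X in p X](scale0r u) pZ normr0 mul0r -scaleN1r pZ normrN1.
by rewrite mul1r; lra.
Qed.

Lemma seminorm_opnorm p C : seminorm p -> (forall u, p u <= C * nrm u) ->
  exists N : R, [/\ 0 <= N, forall u, p u <= N * nrm u &
    forall c, 0 <= c < N -> exists u, c * nrm u < p u].
Proof.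
move=> sp pC; pose E := [set c : R | 0 <= c /\ forall u, p u <= c * nrm u].
have E0 : E !=set0.
  exists `|C|; split => // u; apply: le_trans (pC u) _.
  by rewrite ler_wpM2r ?nrm_ge0// ler_norm.
have lbE : lbound E 0 by move=> c [].
have hasE : has_lbound E by exists 0.
exists (inf E); split.
- exact: lb_le_inf.
- move=> u; have [u0|u0] := eqVneq (nrm u) 0.
    by have := pC u; rewrite u0 !mulr0.
  have pu : 0 < nrm u by rewrite lt_neqAle eq_sym u0 nrm_ge0.
  rewrite -ler_pdivrMr//; apply: lb_le_inf => // c [_ /(_ u)].
  by rewrite ler_pdivrMr.
- move=> c /andP[c0 cN]; apply: contrapT => nex.
  suff /(ge_inf hasE) : E c by rewrite leNgt cN.
  split => // u; rewrite leNgt; apply/negP => cu; apply: nex; by exists u.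
Qed.

(* Sokal's proof of the Banach-Steinhaus theorem: the signs in the sum [x] of
   small almost maximizing vectors are chosen so that no cancellation occurs. *)
Lemma uniform_boundedness (p : nat -> V -> R) :
  (forall u : nat -> V, (forall n, nrm (u n.+1 - u n) <= 3^-1 ^+ n) ->
     exists l, nrm (u n - l) @[n --> \oo] --> 0) ->
  (forall n, seminorm (p n)) ->
  (forall n, exists C, forall u, p n u <= C * nrm u) ->
  (forall u, exists M, forall n, p n u <= M) ->
  exists M, forall n u, p n u <= M * nrm u.
Proof.
move=> complete sp pC pM.
have /choice[N HN] n : exists N : R, [/\ 0 <= N, forall u, p n u <= N * nrm u &
    forall c, 0 <= c < N -> exists u, c * nrm u < p n u].
  by have [C hC] := pC n; exact: seminorm_opnorm (sp n) hC.
apply: contrapT => noM.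
(* At the limit [l] one gets [p l >= (2 / 3 - 1 / 2) * N * 3 ^- k = N * 3 ^- k / 6]. The factor
   [6 * k.+1 * 3 ^ k] turns this into [p l > k.+1]. *)
have /choice[m Hm] k : exists n, 6 * k.+1%:R * 3 ^+ k < N n.
  apply: contrapT => nex; apply: noM; exists (6 * k.+1%:R * 3 ^+ k) => n u.
  have [_ pN _] := HN n; apply: le_trans (pN u) _.
  rewrite ler_wpM2r ?nrm_ge0// leNgt; apply/negP => h; apply: nex; by exists n.
pose r k : R := 3^-1 ^+ k.
have r0 k : 0 < r k by rewrite exprn_gt0// invr_gt0.
have rS k : r k.+1 = r k / 3 by rewrite /r exprSr.
have r3 k : 3 ^+ k * r k = 1 by rewrite /r exprVn mulfV// expf_neq0.
have N0 k : 0 < N (m k) by apply: le_lt_trans (Hm k); rewrite !mulr_ge0// exprn_ge0.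
have /choice[w Hw] k : exists u, nrm u = r k /\ 2 / 3 * N (m k) * r k < p (m k) u.
  have [_ pN /(_ (2 / 3 * N (m k)))] := HN (m k).
  case=> [|u hu].
    have := N0 k; move: (N (m k)) => x x0; apply/andP; split; lra.
  have u0 : 0 < nrm u.
    rewrite lt_neqAle nrm_ge0 andbT eq_sym; apply/eqP => u0.
    by have := pN u; move: hu; rewrite u0 !mulr0 => /lt_le_trans /[apply]; rewrite ltxx.
  exists ((r k / nrm u) *: u); have [_ pZ] := sp (m k).
  rewrite (nrmZ Hip) pZ ger0_norm ?divr_ge0 ?(ltW (r0 k)) ?nrm_ge0//; split.
    by rewrite divfK// gt_eqF.
  have -> : 2 / 3 * N (m k) * r k = r k / nrm u * (2 / 3 * N (m k) * nrm u).
    by field; rewrite gt_eqF.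
  by rewrite ltr_pM2l ?divr_gt0.
pose x := fix x k := if k is k'.+1 then
   (if p (m k') (w k') <= p (m k') (x k' + w k') then x k' + w k' else x k' - w k')
   else 0.
have hx k : p (m k) (w k) <= p (m k) (x k.+1).
  rewrite /=; case: ifPn => //; rewrite -ltNge => hlt.
  have [pD pZ] := sp (m k).
  (* Since [2 w = (x + w) - (x - w)], one of the two vectors has seminorm at least [p w]. *)
  have := pD (x k + w k) (-1 *: (x k - w k)).
  rewrite pZ normrN1 mul1r scaleN1r opprB addrC addrA subrK -mulr2n -scaler_nat pZ.
  rewrite ger0_norm//; lra.
have dx k : nrm (x k.+1 - x k) = r k.
  have [<- _] := Hw k; rewrite /=; case: ifPn => _; first by rewrite addrC addKr.
  by rewrite addrC addKr nrmN.
have [l hl] : exists l, nrm (x n - l) @[n --> \oo] --> 0.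
  by apply: complete => n; rewrite dx.
(* The lengths [r j] for [j >= k] sum to [3 / 2 * r k], so what is added after [x k.+1] has norm at
   most [r k / 2]. *)
have tail0 k j : nrm (x (j + k)%N - x k) <= 3 / 2 * (r k - r (j + k)%N).
  elim: j => [|j IH]; first by rewrite add0n subrr nrm0// subrr mulr0.
  apply: le_trans (ler_nrm_distD Hip (x (j + k)%N) _ _) _.
  rewrite addSn dx rS; move: IH; move: (r (j + k)%N) (r k) (nrm _) => *; lra.
have tail k : nrm (x k - l) <= 3 / 2 * r k.
  have h : nrm (x (j + k)%N - l) + 3 / 2 * r k @[j --> \oo] --> (0 + 3 / 2 * r k : R).
    by apply: cvgD; [rewrite (cvg_shiftn k (fun n => nrm (x n - l)))|exact: cvg_cst].
  rewrite add0r in h.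
  apply: cvgr_to_ge h _; apply: nearW => j.
  apply: le_trans (ler_nrm_distD Hip (x (j + k)%N) _ _) _.
  rewrite addrC lerD2l (nrm_distC Hip); apply: le_trans (tail0 _ _) _.
  by have := r0 (j + k)%N; move: (r (j + k)%N) (r k) => *; lra.
have [M HM] := pM l.
have M0 : 0 <= M by apply: le_trans (seminorm_ge0 l (sp 0)) (HM 0).
pose k := Num.bound M.
have [pD _] := sp (m k); have [_ pN _] := HN (m k).
have h1 := pD l (x k.+1 - l); rewrite addrCA subrr addr0 in h1.
have h2 : p (m k) (x k.+1 - l) <= N (m k) * (r k / 2).
  apply: le_trans (pN _) _; rewrite ler_wpM2l ?(ltW (N0 k))//.
  by apply: le_trans (tail _) _; rewrite rS; have := r0 k; move: (r k) => *; lra.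
have [_ h3] := Hw k; have h4 := hx k; have h5 := HM (m k).
have h6 : 6 * k.+1%:R < N (m k) * r k.
  have -> : 6 * k.+1%:R = 6 * k.+1%:R * 3 ^+ k * r k by rewrite -[RHS]mulrA r3 mulr1.
  by rewrite ltr_pM2r.
have h7 : M < k.+1%:R by apply: lt_trans (archi_boundP M0) _; rewrite ltr_nat.
move: h1 h2 h3 h4 h5 h6 h7.
rewrite mulrA -(mulrA (2 / 3)); move: (N (m k) * r k) => y.
lra.
Qed.

End uniform_boundedness.

(** * Strongly continuous semigroups *)

Section C0_semigroup.
Context {R : realType} {V : lmodType R}.
Variable ip : V -> V -> R.
Hypothesis Hip : semi_inner_product ip.
Local Notation nrm := (ip_norm ip).

(** The algebraic laws hold up to vectors of norm zero, the abstract form of almost everywhere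
    equality; the constant in [C0_bounded] may depend on [t]. *)
Record C0_semigroup (Q : R -> V -> V) : Prop := C0Semigroup {
  C0_linear : forall t a u v, 0 <= t ->
    nrm (Q t (a *: u + v) - (a *: Q t u + Q t v)) = 0 ;
  C0_bounded : forall t, 0 <= t -> exists C, forall u, nrm (Q t u) <= C * nrm u ;
  C0_id : forall u, nrm (Q 0 u - u) = 0 ;
  C0_add : forall s t u, 0 <= s -> 0 <= t ->
    nrm (Q (s + t) u - Q s (Q t u)) = 0 ;
  C0_continuous : forall u, nrm (Q t u - u) @[t --> 0^'+] --> 0 }.

Definition generates (Q : R -> V -> V) (u v : V) : Prop :=
  nrm (t^-1 *: (Q t u - u) - v) @[t --> 0^'+] --> 0.

Lemma nrm_eq u v : nrm (u - v) = 0 -> nrm u = nrm v.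
Proof.
move=> uv; apply/eqP; rewrite eq_le; apply/andP; split.
  by have := ler_nrm_dist Hip u v; rewrite uv addr0.
by have := ler_nrm_dist Hip v u; rewrite (nrm_distC Hip) uv addr0.
Qed.

(** Increments [h] of either sign are reduced to [|h|], since continuity and generation are given as
    right limits at 0. *)
Lemma cvg_normr_right : (fun h : R => `|h|) @ 0^' --> (0 : R)^'+.
Proof.
move=> P [e /= e0 He]; exists e => //= h he h0; apply: He; last by rewrite normr_gt0.
by move: he; rewrite /ball_ /= !sub0r !normrN normr_id.
Qed.

Variable Q : R -> V -> V.
Hypothesis HQ : C0_semigroup Q.

Lemma C0_nrmB t u v : 0 <= t -> nrm (Q t u - Q t v) = nrm (Q t (u - v)).
Proof.
move=> t0; apply/esym/nrm_eq; have := C0_linear HQ (-1) v u t0.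
by rewrite !scaleN1r [- v + u]addrC [- Q t v + _]addrC.
Qed.

Lemma C0_nrmZ t a u : 0 <= t -> nrm (Q t (a *: u) - a *: Q t u) = 0.
Proof.
move=> t0; have h0 : nrm (Q t 0) = 0.
  have [C hC] := C0_bounded HQ t0.
  apply/eqP; rewrite eq_le nrm_ge0 andbT.
  by apply: le_trans (hC 0) _; rewrite (nrm0 Hip) mulr0.
have := C0_linear HQ a u 0 t0; rewrite addr0 opprD addrA => /nrm_eq.
by rewrite h0.
Qed.

Lemma seminorm_C0 t : 0 <= t -> seminorm (fun u => nrm (Q t u)).
Proof.
move=> t0; split=> [u v|a u].
  have := C0_linear HQ 1 u v t0; rewrite !scale1r => /nrm_eq ->.
  exact: ler_nrmD.
by rewrite -(nrmZ Hip); apply: nrm_eq; exact: C0_nrmZ.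
Qed.

Hypothesis complete : forall u : nat -> V,
  (forall n, nrm (u n.+1 - u n) <= 3^-1 ^+ n) ->
  exists l, nrm (u n - l) @[n --> \oo] --> 0.

(** Otherwise there are times [t n <= 1 / n.+1] at which the operator norm exceeds [n]. Strong
    continuity at 0 bounds every orbit along these times, contradicting the uniform boundedness
    principle. *)
Lemma C0_bounded_near0 : exists d M, 0 < d /\
  forall t u, 0 <= t <= d -> nrm (Q t u) <= M * nrm u.
Proof.
apply: contrapT => nex.
have /choice[t Ht] n : exists t, 0 <= t <= n.+1%:R^-1 /\
    exists u, n%:R * nrm u < nrm (Q t u).
  apply: contrapT => nt; apply: nex; exists n.+1%:R^-1, n%:R.
  split=> [|t u tn]; first by rewrite invr_gt0.
  rewrite leNgt; apply/negP => h; apply: nt; exists t; split => //; by exists u.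
have t0 n : 0 <= t n by have [/andP[]] := Ht n.
have [||||M HM] := @uniform_boundedness _ _ _ Hip (fun n u => nrm (Q (t n) u)).
- exact: complete.
- by move=> n; exact: seminorm_C0.
- by move=> n; exact: C0_bounded.
- move=> u.
  have /cvgrPdist_lt/(_ _ ltr01) := C0_continuous HQ u.
  move=> [e /= e0 He].
  have He' s : 0 <= s < e -> nrm (Q s u) <= nrm u + 1.
    move=> /andP[s0 se]; have [s00|s00] := eqVneq s 0.
      by rewrite s00 (nrm_eq (C0_id HQ u)) lerDl.
    have := He s; rewrite /= !sub0r !normrN => /(_ _ _)/ltW.
    rewrite (ger0_norm s0) ger0_norm ?nrm_ge0// => h.
    apply: le_trans (ler_nrm_dist Hip _ u) _; rewrite lerD2l h//.
    by rewrite lt_neqAle eq_sym s00.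
  (* From [n0] on, [t n < e]; the finitely many earlier times are absorbed by the sum. *)
  pose n0 := Num.bound e^-1.
  exists (\sum_(i < n0) nrm (Q (t i) u) + (nrm u + 1)) => n.
  have [nn|nn] := ltnP n n0.
    rewrite (bigD1 (Ordinal nn))//= -addrA lerDl addr_ge0 ?addr_ge0 ?nrm_ge0//.
    by apply: sumr_ge0 => i _; exact: nrm_ge0.
  apply: ler_wpDl; first by apply: sumr_ge0 => i _; exact: nrm_ge0.
  apply: He'; rewrite t0/=; have [/andP[_ h] _] := Ht n.
  apply: le_lt_trans h _; rewrite -[ltRHS]invrK ltf_pV2 ?posrE ?invr_gt0//.
  apply: lt_le_trans (archi_boundP _) _; first by rewrite invr_ge0 ltW.
  by rewrite ler_nat -/n0 ltnW.
- pose n := Num.bound `|M|.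
  have [_ [u]] := Ht n; apply/negP; rewrite -leNgt; apply: le_trans (HM n u) _.
  rewrite ler_wpM2r ?nrm_ge0//; apply: le_trans (ler_norm _) _.
  by apply/ltW/archi_boundP.
Qed.

(** Time is cut into steps of length [d], each of which costs a factor [M1]; taking [M1 >= 1] makes
    the bound for several steps cover the shorter times too. *)
Lemma C0_locally_bounded T : exists M, 0 <= M /\
  forall t u, 0 <= t <= T -> nrm (Q t u) <= M * nrm u.
Proof.
have [d [M [d0 HM]]] := C0_bounded_near0.
pose M1 := Num.max 1 M.
have M11 : 1 <= M1 by rewrite le_max lexx.
have HM1 t u : 0 <= t <= d -> nrm (Q t u) <= M1 * nrm u.
  move=> td; apply: le_trans (HM _ _ td) _.
  by rewrite ler_wpM2r ?nrm_ge0// le_max lexx orbT.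
have key k : exists M', 1 <= M' /\
    forall t u, 0 <= t <= k.+1%:R * d -> nrm (Q t u) <= M' * nrm u.
  elim: k => [|k [M' [M'1 IH]]].
    by exists M1; split => // t u; rewrite mul1r; exact: HM1.
  exists (M1 * M'); split; first by rewrite mulr_ege1.
  move=> t u /andP[t0 tk]; have [td|td] := leP t d.
    apply: le_trans (HM1 _ u _) _; first by rewrite t0.
    rewrite ler_wpM2r ?nrm_ge0// ler_peMr// (le_trans ler01)//.
  have -> : t = d + (t - d) by rewrite addrC subrK.
  have td0 : 0 <= t - d by rewrite subr_ge0 ltW.
  rewrite (nrm_eq (C0_add HQ u (ltW d0) td0)).
  apply: le_trans (HM1 _ _ _) _; first by rewrite lexx ltW.
  rewrite -mulrA ler_wpM2l// ?(le_trans ler01)//; apply: IH.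
  rewrite td0/= lerBlDr; apply: le_trans tk _.
  by rewrite -[in leLHS]natr1 mulrDl mul1r.
have [M' [M'1 H]] := key (Num.bound (`|T| / d)).
exists M'; split => [|t u /andP[t0 tT]]; first exact: le_trans M'1.
apply: H; rewrite t0/=; apply: le_trans tT _; apply: le_trans (ler_norm _) _.
rewrite -ler_pdivrMr//; apply: ltW; apply: lt_le_trans (archi_boundP _) _.
  by rewrite divr_ge0// ltW.
by rewrite ler_nat.
Qed.

(** For [t <= s], [Q s u - Q t u] is [Q t (Q (s - t) u - u)] up to norm zero. Right continuity at 0
    thus gives two-sided continuity at positive times. *)
Lemma C0_dist T : exists M, 0 <= M /\ forall u s t, 0 <= s <= T -> 0 <= t <= T ->
  nrm (Q s u - Q t u) <= M * nrm (Q `|s - t| u - u).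
Proof.
have [M [M0 HM]] := C0_locally_bounded T; exists M; split => // u s t.
wlog st : s t / t <= s.
  move=> h hs ht; have [/h|/ltW/h] := leP t s; first exact.
  by rewrite distrC (nrm_distC Hip); exact.
move=> /andP[s0 sT] /andP[t0 tT].
have st0 : 0 <= s - t by rewrite subr_ge0.
rewrite ger0_norm//; apply: le_trans (HM t _ _); last by rewrite t0.
rewrite -C0_nrmB//;
apply: (@le_trans _ _ (nrm (Q s u - Q t (Q (s - t) u)) + nrm (Q t (Q (s - t) u) - Q t u))).
  exact: ler_nrm_distD.
by have := C0_add HQ u t0 st0; rewrite subrKC => ->; rewrite add0r.
Qed.

Lemma cvg_C0_shift u t : 0 < t -> nrm (Q (h + t) u - Q t u) @[h --> (0 : R)^'] --> 0.
Proof.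
move=> t0; have [M [M0 HM]] := C0_dist (t + 1).
have h1 : M * nrm (Q `|h| u - u) @[h --> (0 : R)^'] --> (M * 0 : R).
  apply: cvgMl_tmp.
  exact: (cvg_comp _ _ cvg_normr_right (C0_continuous HQ u)).
rewrite mulr0 in h1.
apply: (squeeze_cvgr _ (cvg_cst 0) h1).
near=> h; rewrite nrm_ge0/=.
have /HM : 0 <= h + t <= t + 1.
  have : `|h| < Num.min t 1 by near: h; apply: dnbhs0_lt; rewrite lt_min t0 ltr01.
  by rewrite lt_min !ltr_norml => /andP[/andP[? ?] /andP[? ?]]; apply/andP; split; lra.
move=> /(_ u t); rewrite addrK; apply; apply/andP; split; lra.
Unshelve. all: by end_near. Qed.

Lemma cvg_C0 u t : 0 < t -> nrm (Q s u - Q t u) @[s --> t] --> 0.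
Proof.
move=> t0; have h := cvg_C0_shift u t0.
have : {for t, continuous (fun s => nrm (Q s u - Q t u))}.
  by apply/continuous_withinNshiftx; rewrite (_ : nrm (Q t u - Q t u) = 0) ?subrr ?(nrm0 Hip).
by rewrite /prop_for /continuous_at subrr (nrm0 Hip).
Qed.

Lemma cvg_C0_right0 u : nrm (Q s u - Q 0 u) @[s --> 0^'+] --> 0.
Proof.
have h : nrm (Q s u - u) + nrm (u - Q 0 u) @[s --> 0^'+] --> (0 + nrm (u - Q 0 u) : R).
  by apply: cvgD; [exact: C0_continuous|exact: cvg_cst].
rewrite (nrm_distC Hip) (C0_id HQ) addr0 in h.
apply: (squeeze_cvgr _ (cvg_cst 0) h).
near=> s; rewrite nrm_ge0/=.
by have := ler_nrm_distD Hip u (Q s u) (Q 0 u); rewrite (nrm_distC Hip u) (C0_id HQ).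
Unshelve. all: by end_near. Qed.

(** [Q t] is bounded and commutes, up to norm zero, with the difference quotients at 0, so it may be
    applied to the limit that defines the generator. *)
Lemma generates_orbit u v t : 0 <= t -> generates Q u v -> generates Q (Q t u) (Q t v).
Proof.
move=> t0 uv; have [C hC] := C0_bounded HQ t0.
have h1 : C * nrm (h^-1 *: (Q h u - u) - v) @[h --> 0^'+] --> (C * 0 : R).
  exact: cvgMl_tmp.
rewrite mulr0 in h1.
apply: (squeeze_cvgr _ (cvg_cst 0) h1).
near=> h; rewrite nrm_ge0/=.
have h0 : 0 < h by near: h; exact: nbhs_right_gt.
apply: le_trans (hC _); rewrite -C0_nrmB//.
rewrite le_eqVlt; apply/orP; left; apply/eqP; apply: nrm_eq.
rewrite opprB addrA subrK.
apply/eqP; rewrite eq_le nrm_ge0 andbT.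
have E1 : nrm (Q h (Q t u) - Q (h + t) u) = 0.
  by rewrite (nrm_distC Hip); exact: (C0_add HQ _ (ltW h0) t0).
have E2 : nrm (Q (h + t) u - Q t (Q h u)) = 0.
  by rewrite [h + t]addrC; exact: (C0_add HQ _ t0 (ltW h0)).
have E3 := C0_nrmZ h^-1 (Q h u - u) t0.
have E4 := C0_linear HQ (-1) u (Q h u) t0.
rewrite !scaleN1r [- u + _]addrC [- Q t u + _]addrC in E4.
apply: le_trans (ler_nrm_distD Hip (h^-1 *: Q t (Q h u - u)) _ _) _.
rewrite (nrm_distC Hip (_ *: Q t _)) E3 addr0 -scalerBr (nrmZ Hip).
suff -> : nrm (Q h (Q t u) - Q t u - Q t (Q h u - u)) = 0 by rewrite mulr0.
apply/eqP; rewrite eq_le nrm_ge0 andbT.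
apply: le_trans (ler_nrm_distD Hip (Q t (Q h u) - Q t u) _ _) _.
rewrite (nrm_distC Hip (Q t (Q h u) - Q t u)) E4 addr0 opprB addrA subrK.
apply: le_trans (ler_nrm_distD Hip (Q (h + t) u) _ _) _.
by rewrite E1 E2 addr0.
Unshelve. all: by end_near. Qed.

(** Let [m = (h - |h|) / 2 + t], the smaller of [t] and [t + h]. For either sign of [h] the quotient
    is [Q m] applied to [|h|^-1 (Q |h| u - u)]. The local bound on [Q m] controls the distance of
    the latter to [v], and [Q m v] tends to [Q t v]. *)
Lemma cvg_C0_quotient u v t : 0 < t -> generates Q u v ->
  nrm (h^-1 *: (Q (h + t) u - Q t u) - Q t v) @[h --> (0 : R)^'] --> 0.
Proof.
move=> t0 uv; have [M [M0 HM]] := C0_locally_bounded (t + 1).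
have h1 : M * nrm (`|h|^-1 *: (Q `|h| u - u) - v) + nrm (Q ((h - `|h|) / 2 + t) v - Q t v)
    @[h --> (0 : R)^'] --> (M * 0 + 0 : R).
  apply: cvgD.
    apply: cvgMl_tmp.
    exact: (cvg_comp _ _ cvg_normr_right uv).
  apply: (@cvg_comp _ _ _ (fun h => (h - `|h|) / 2 + t) (fun s => nrm (Q s v - Q t v)) _ (nbhs t));
    last exact: cvg_C0.
  have h0 : (h - `|h : R|) / 2 + t @[h --> (0 : R)^'] --> ((0 - `|0 : R|) / 2 + t : R).
    apply: cvgD; last exact: cvg_cst.
    apply: cvgMr_tmp.
    by apply: cvgB; [exact: cvg_within|apply: cvg_norm; exact: cvg_within].
  by rewrite normr0 subr0 mul0r add0r in h0.
rewrite mulr0 addr0 in h1.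
apply: (squeeze_cvgr _ (cvg_cst 0) h1).
near=> h; rewrite nrm_ge0/=.
have h0 : h != 0 by near: h; exact: nbhs_dnbhs_neq.
have : `|h| < Num.min t 1 by near: h; apply: dnbhs0_lt; rewrite lt_min t0 ltr01.
rewrite lt_min !ltr_norml => /andP[/andP[ht1 ht2] /andP[ht3 ht4]].
set m := (h - `|h|) / 2 + t.
have m0 : 0 <= m <= t + 1.
  by rewrite /m; case: (ger0P h) => ?; apply/andP; split; lra.
have m0' : 0 <= m by case/andP: m0.
apply: le_trans (ler_nrm_distD Hip (Q m v) _ _) _; rewrite lerD2r.
apply: le_trans (HM m _ m0); rewrite -C0_nrmB//.
rewrite le_eqVlt; apply/orP; left; apply/eqP; apply: nrm_eq.
rewrite opprB addrA subrK.
have E1 : nrm (h^-1 *: (Q (h + t) u - Q t u) - `|h|^-1 *: (Q m (Q `|h| u) - Q m u)) = 0.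
  case: (ltgtP h 0) h0 => // hs _.
    have -> : m = h + t by rewrite /m ltr0_norm//; field.
    rewrite ltr0_norm// invrN scaleNr opprK -scalerDr (nrmZ Hip).
    have -> : Q (h + t) u - Q t u + (Q (h + t) (Q (- h) u) - Q (h + t) u) = - (Q t u - Q (h + t) (Q (- h) u)).
      by rewrite opprB addrC addrA subrK.
    rewrite (nrmN Hip); have ht : 0 <= h + t by lra.
    have hn : 0 <= - h by lra.
    by have := C0_add HQ u ht hn; rewrite addrAC subrr add0r => ->; rewrite mulr0.
  rewrite /m gtr0_norm// subrr mul0r add0r -scalerBr (nrmZ Hip) opprB addrA subrK.
  by have := C0_add HQ u (ltW t0) (ltW hs); rewrite [t + h]addrC => ->; rewrite mulr0.
apply/eqP; rewrite eq_le nrm_ge0 andbT.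
apply: le_trans (ler_nrm_distD Hip (`|h|^-1 *: (Q m (Q `|h| u) - Q m u)) _ _) _.
rewrite E1 add0r.
apply: le_trans (ler_nrm_distD Hip (`|h|^-1 *: Q m (Q `|h| u - u)) _ _) _.
rewrite (nrm_distC Hip (`|h|^-1 *: Q m _)) C0_nrmZ// addr0 -scalerBr (nrmZ Hip).
have := C0_linear HQ (-1) u (Q `|h| u) m0'.
by rewrite !scaleN1r [- u + _]addrC [- Q m u + _]addrC (nrm_distC Hip) => ->; rewrite mulr0.
Unshelve. all: by end_near. Qed.

Lemma is_derive_ip_C0 u v u' v' (t : R) : 0 < t -> generates Q u v -> generates Q u' v' ->
  is_derive t (1 : R) (fun s : R => ip (Q s u) (Q s u')) (ip (Q t v) (Q t u') + ip (Q t u) (Q t v')).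
Proof.
move=> t0 uv uv'.
have h : h^-1 *: (ip (Q (h *: 1 + t) u) (Q (h *: 1 + t) u') - ip (Q t u) (Q t u'))
   @[h --> (0 : R)^'] --> ip (Q t v) (Q t u') + ip (Q t u) (Q t v').
  rewrite (_ : (fun h => _) = fun h => ip (h^-1 *: (Q (h + t) u - Q t u)) (Q (h + t) u')
     + ip (Q t u) (h^-1 *: (Q (h + t) u' - Q t u'))); last first.
    apply/funext => h; rewrite /GRing.scale/= mulr1 !(ipZl Hip) !(ipZr Hip) !(ipBl Hip) !(ipBr Hip).
    by ring.
  apply: cvgD; apply: (cvg_ip Hip).
  - exact: cvg_C0_quotient.
  - exact: cvg_C0_shift.
  - by rewrite subrr (nrm0 Hip); exact: cvg_cst.
  - exact: cvg_C0_quotient.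
by apply: DeriveDef; [apply/cvg_ex; eexists; exact: h|exact: cvg_lim h].
Qed.

Lemma is_derive_ipl_C0 w u v (t : R) : 0 < t -> generates Q u v ->
  is_derive t (1 : R) (fun s : R => ip w (Q s u)) (ip w (Q t v)).
Proof.
move=> t0 uv.
have h : h^-1 *: (ip w (Q (h *: 1 + t) u) - ip w (Q t u)) @[h --> (0 : R)^'] --> ip w (Q t v).
  rewrite (_ : (fun h => _) = fun h => ip w (h^-1 *: (Q (h + t) u - Q t u))); last first.
    by apply/funext => h; rewrite /GRing.scale/= mulr1 (ipZr Hip) (ipBr Hip).
  apply: (cvg_ip Hip); last exact: cvg_C0_quotient.
  by rewrite subrr (nrm0 Hip); exact: cvg_cst.
by apply: DeriveDef; [apply/cvg_ex; eexists; exact: h|exact: cvg_lim h].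
Qed.

End C0_semigroup.

(** * The space L^2 of a probability measure *)

Section L2_probability.
Context d (T : measurableType d) (R : realType) (P : probability T R).
Local Notation V := (LfunType P (lee1n 2)).
Local Notation L2P := (Lfun P 2%:E).

Definition L2ip (f g : V) : R := \int[P]_x (f x * g x).

Local Notation ip := L2ip.
Local Notation nrm := (ip_norm L2ip).

Lemma measurable_Lfun2 f : f \in L2P -> measurable_fun setT f.
Proof. by rewrite inE => /andP[/[!inE]]. Qed.

Lemma integrable_L2M (f g : T -> R) : f \in L2P -> g \in L2P ->
  P.-integrable setT (EFin \o (fun x => f x * g x)).
Proof. by move=> hf hg; apply/Lfun1_integrable; exact: Lfun2_mul_Lfun1. Qed.

Lemma LnormrE (f : T -> R) : measurable_fun setT f ->
  'N[P]_(2%:E)[EFin \o f]%E = ((\int[P]_x (f x ^+ 2)%:E) `^ 2^-1)%E.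
Proof.
move=> mf; rewrite unlock; congr (_ `^ _)%E.
by apply: eq_integral => x _ /=; rewrite powR_mulrn// real_normK// num_real.
Qed.

Lemma Lfun2P (f : T -> R) : measurable_fun setT f ->
  (\int[P]_x (f x ^+ 2)%:E < +oo)%E -> f \in L2P.
Proof.
move=> mf ioo; apply/andP; split; first by rewrite inE.
by rewrite inE/= /finite_norm LnormrE// poweR_lty.
Qed.

Lemma le_Lfun2 (f g : T -> R) : measurable_fun setT f -> g \in L2P ->
  (forall x, `|f x| <= `|g x|) -> f \in L2P.
Proof.
move=> mf hg fg; apply: Lfun2P => //.
have mg := measurable_Lfun2 hg.
apply: (@le_lt_trans _ _ (\int[P]_x (g x ^+ 2)%:E)%E).
  apply: ge0_le_integral => //.
  - by move=> x _; rewrite lee_fin sqr_ge0.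
  - by apply/measurable_EFinP; exact: measurable_funX.
  - by apply/measurable_EFinP; exact: measurable_funX.
  - by move=> x _; rewrite lee_fin -(real_normK (num_real (f x))) -(real_normK (num_real (g x))) lerXn2r// nnegrE.
have /integrableP[_] := Lfun2_integrable_sqr hg.
apply: le_lt_trans; apply: ge0_le_integral => //.
- by move=> x _; rewrite lee_fin sqr_ge0.
- by apply/measurable_EFinP; exact: measurable_funX.
- by apply: measurableT_comp => //; apply/measurable_EFinP; exact: measurable_funX.
- by move=> x _; rewrite /= lee_fin ler_norm.
Qed.

Lemma L2_semi_inner_product : semi_inner_product ip.
Proof.
split=> [f g|a f g h|f].
- by apply: eq_Rintegral => x _; rewrite mulrC.
- rewrite /L2ip -RintegralZl//; last exact: integrable_L2M (LfunP f) (LfunP h).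
  rewrite -RintegralD//.
  + by apply: eq_Rintegral => x _ /=; rewrite mulrDl mulrA.
  + by have /= := integrable_L2M (LfunP (a *: f)) (LfunP h); under eq_fun do rewrite -mulrA.
  + exact: integrable_L2M (LfunP g) (LfunP h).
- by apply: Rintegral_ge0 => x _; rewrite -expr2 sqr_ge0.
Qed.
Let Hip := L2_semi_inner_product.

Lemma integral_L2sqr (f : V) : (\int[P]_x (f x ^+ 2)%:E)%E = (nrm f ^+ 2)%:E.
Proof.
rewrite (sqr_nrm Hip) /L2ip /Rintegral fineK//.
exact/integrable_fin_num/(integrable_L2M (LfunP f) (LfunP f)).
Qed.

Lemma Lnorm_nrm (f : V) : 'N[P]_(2%:E)[EFin \o f]%E = (nrm f)%:E.
Proof.
rewrite LnormrE; last exact/measurable_Lfun2/LfunP.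
by rewrite integral_L2sqr poweR_EFin powR12_sqrt ?sqr_ge0// sqrtr_sqr ger0_norm ?nrm_ge0.
Qed.

Lemma Lfun2_cst c : (cst c : T -> R) \in L2P.
Proof.
apply: Lfun2P => //=.
by rewrite integral_cst//= probability_setT mule1 ltry.
Qed.

Definition L2one : V := Lfun_Sub (lee1n 2) (Lfun2_cst 1).

Lemma ip1E (f : V) : ip L2one f = \int[P]_x f x.
Proof. by apply: eq_Rintegral => x _ /=; rewrite mul1r. Qed.

Lemma integrable_Lfun2 (f : T -> R) : f \in L2P -> P.-integrable setT (EFin \o f).
Proof.
move=> hf; have := integrable_L2M (Lfun2_cst 1) hf.
by under eq_fun do rewrite /= mul1r.
Qed.

Lemma nrm1 : nrm L2one = 1.
Proof.
rewrite /ip_norm ip1E -[Rintegral _ _ _]/(\int[P]_x 1) Rintegral_cst//.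
by rewrite [X in fine X]probability_setT mulr1 sqrtr1.
Qed.

Lemma variance_L2 (f : V) : 'V_P[f] = (ip f f - ip L2one f ^+ 2)%:E.
Proof.
rewrite varianceE; last exact: LfunP.
rewrite ip1E EFinB; congr (_ - _)%E.
  rewrite unlock /L2ip /Rintegral fineK//.
  exact/integrable_fin_num/(integrable_L2M (LfunP f) (LfunP f)).
rewrite unlock /Rintegral EFin_expe fineK//.
exact/integrable_fin_num/integrable_Lfun2/LfunP.
Qed.

Lemma nrm0_ae (f g : V) : nrm (f - g) = 0 -> (f : T -> R) = g %[ae P].
Proof.
move=> h; have := @fine_Lnormr_eq0 _ _ _ P _ (lee1n 2) (f - g).
rewrite Lnorm_nrm h => /(_ erefl); apply: filterS => x /= fg /fg /eqP.
by rewrite subr_eq0 => /eqP.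
Qed.

Lemma ae_nrm0 (f g : V) : (f : T -> R) = g %[ae P] -> nrm (f - g) = 0.
Proof.
move=> fg; apply/eqP; rewrite -sqrf_eq0 -eqe -integral_L2sqr; apply/eqP.
rewrite (@ae_eq_integral _ _ _ _ _ (cst 0%E))//=.
- by rewrite integral0.
- apply/measurable_EFinP/measurable_funX; exact: (measurable_Lfun2 (LfunP (f - g))).
- by apply: filterS fg => x /= fg /fg h; rewrite -[LHS]/((f x - g x) ^+ 2)%:E h subrr expr0n.
Qed.

(** Fatou's lemma for the squares. Applied to differences, it is the tool by which a pointwise limit
    is recognized as an L^2 limit. *)
Lemma L2_fatou (v : nat -> V) (f : T -> R) (C : R) :
  measurable_fun setT f ->
  {ae P, forall x, v n x @[n --> \oo] --> f x} ->
  (forall n, nrm (v n) <= C) ->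
  exists g : V, g = f :> (T -> R) /\ nrm g <= C.
Proof.
move=> mf vf vC.
have C0 : 0 <= C by apply: le_trans (vC 0); exact: nrm_ge0.
have key : (\int[P]_x (f x ^+ 2)%:E <= (C ^+ 2)%:E)%E.
  have mv n : measurable_fun setT (fun x => (v n x ^+ 2)%:E).
    by apply/measurable_EFinP/measurable_funX; exact/measurable_Lfun2/LfunP.
  have := @fatou _ _ _ P setT measurableT (fun n x => (v n x ^+ 2)%:E) mv.
  have h0 n x : setT x -> (0 <= (v n x ^+ 2)%:E)%E by rewrite lee_fin sqr_ge0.
  move=> /(_ h0) hfatou.
  rewrite (_ : (\int[P]_x (f x ^+ 2)%:E)%E =
    (\int[P]_x limn_einf (fun n => (v n x ^+ 2)%:E))%E); last first.
    apply: ae_eq_integral => //.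
    - exact/measurable_EFinP/measurable_funX.
    - rewrite (_ : (fun x => _) = (fun x => - limn_esup (fun n => - (v n x ^+ 2)%:E))%E); last first.
        by apply/funext => x; rewrite -limn_einfN; congr limn_einf; apply/funext => n /=; rewrite opprK.
      apply: measurableT_comp => //; apply: measurable_fun_limn_esup => n.
      exact: measurableT_comp.
    - apply: filterS vf => x vx _.
      have h : (v n x ^+ 2)%:E @[n --> \oo] --> (f x ^+ 2)%:E.
        by apply: cvg_EFin; [exact: nearW|rewrite expr2; under eq_fun do rewrite expr2; exact: cvgM].
      by rewrite is_cvg_limn_einfE; [apply/esym/cvg_lim|apply/cvg_ex; eexists; exact: h].
  apply: le_trans hfatou _.
  apply: (@le_trans _ _ (limn_einf (fun n : nat => (C ^+ 2)%:E))); last first.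
    rewrite is_cvg_limn_einfE; first by rewrite lim_cst.
    exact: is_cvg_cst.
  rewrite !limn_einf_lim; apply: lee_lim; [exact: is_cvg_einfs|exact: is_cvg_einfs|].
  apply: nearW => n; apply: le_ereal_inf_tmp => _ [m /= nm <-].
  apply: ereal_inf_le; exists (\int[P]_x (v m x ^+ 2)%:E)%E; first by exists m.
  by rewrite integral_L2sqr lee_fin lerXn2r// nnegrE nrm_ge0.
have fL2 : f \in L2P by apply: Lfun2P => //; apply: le_lt_trans key _; exact: ltry.
exists (Lfun_Sub (lee1n 2) fL2); split => //.
rewrite -ler_sqr ?nnegrE ?nrm_ge0// -lee_fin -integral_L2sqr; exact: key.
Qed.

End L2_probability.

(** * Completeness of L^2 *)

Section L2_complete.
Context d (T : measurableType d) (R : realType) (P : probability T R).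
Local Notation V := (LfunType P (lee1n 2)).
Local Notation L2P := (Lfun P 2%:E).
Local Notation ip := (@L2ip _ _ _ P).
Local Notation nrm := (ip_norm (@L2ip _ _ _ P)).
Let Hip := @L2_semi_inner_product _ _ _ P.

Lemma integral_abs_le_nrm (f : V) : (\int[P]_x `|f x|%:E <= (nrm f)%:E)%E.
Proof.
have mf : measurable_fun setT (fun x => `|f x|).
  by apply: measurableT_comp => //; exact: (measurable_Lfun2 (LfunP f)).
have absf : (fun x => `|f x|) \in L2P.
  by apply: (le_Lfun2 mf (LfunP f)) => x; rewrite normr_id.
pose g : V := Lfun_Sub (lee1n 2) absf.
have -> : nrm f = nrm g.
  by rewrite /ip_norm; congr Num.sqrt; apply: eq_Rintegral => x _ /=; rewrite -normrM ger0_norm// -expr2 sqr_ge0.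
have -> : (\int[P]_x `|f x|%:E)%E = (ip (L2one P) g)%:E.
  rewrite ip1E /Rintegral fineK//; exact/integrable_fin_num/integrable_Lfun2.
rewrite lee_fin; apply: le_trans (ler_norm _) _.
by have := ler_ip Hip (L2one P) g; rewrite nrm1 mul1r.
Qed.

Lemma nneseries_geometric_lty : (\sum_(0 <= n <oo) (3^-1 ^+ n : R)%:E < +oo)%E.
Proof.
have h : series (geometric (1 : R) 3^-1) @ \oo --> 1 / (1 - 3^-1 : R).
  by apply: cvg_geometric_series; rewrite ger0_norm ?invr_ge0// invf_lt1// ltr1n.
rewrite (_ : (fun n => _) = EFin \o series (geometric (1 : R) 3^-1)).
  by rewrite EFin_lim ?ltry//; apply/cvg_ex; eexists; exact: h.
apply/funext => n; rewrite /series/= -sumEFin; apply: eq_bigr => i _.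
by rewrite mul1r.
Qed.

(** The Riesz-Fischer argument. On a probability space the L^1 norm is below the L^2 norm, so the
    increments are summable in L^1 and the telescoping series converges almost everywhere; Fatou's
    lemma turns the geometric tails into a rate in L^2. *)
Lemma L2_complete (u : nat -> V) : (forall n, nrm (u n.+1 - u n) <= 3^-1 ^+ n) ->
  exists l, nrm (u n - l) @[n --> \oo] --> 0.
Proof.
move=> hu.
have mu n : measurable_fun setT (u n) by exact: (measurable_Lfun2 (LfunP (u n))).
pose a n x := `|u n.+1 x - u n x|.
have ma n : measurable_fun setT (EFin \o a n).
  by apply/measurable_EFinP; apply: measurableT_comp => //; exact: measurable_funB.
have a0 n x : setT x -> (0 <= (a n x)%:E)%E by rewrite lee_fin normr_ge0.
have ioo : (\int[P]_x (\sum_(0 <= n <oo) (a n x)%:E) < +oo)%E.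
  rewrite (@integral_nneseries _ _ _ _ _ _ (fun n x => (a n x)%:E))//.
  apply: le_lt_trans nneseries_geometric_lty; apply: lee_nneseries => [n _ _|n _].
    by apply: integral_ge0 => x _; exact: a0.
  by apply: le_trans (integral_abs_le_nrm (u n.+1 - u n)) _; rewrite lee_fin.
have cvu : {ae P, forall x, cvgn (u ^~ x)}.
  have hi : P.-integrable setT (fun x => \sum_(0 <= n <oo) (a n x)%:E)%E.
    apply/integrableP; split.
      by apply: ge0_emeasurable_sum => [n x _ _|n _]; [rewrite lee_fin normr_ge0|exact: ma].
    rewrite (eq_integral (fun x => \sum_(0 <= n <oo) (a n x)%:E)%E)// => x _.
    by rewrite gee0_abs// nneseries_ge0// => n _ _; exact: a0.
  have := integrable_ae measurableT hi; apply: filterS => x /(_ I) hx.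
  have : cvgn (series (fun n => a n x)).
    apply: nnseries_is_cvg => [i|]; first exact: normr_ge0.
    by rewrite -ge0_fin_numE// nneseries_ge0// => *; exact: a0.
  move=> /(@normed_cvg _ _ (telescope (u ^~ x))).
  rewrite telescopeK => /cvg_ex[/= l hl]; apply/cvg_ex; exists (l + u 0 x).
  rewrite (_ : u ^~ x = fun n => u n x - u 0 x + u 0 x); last first.
    by apply/funext => n; rewrite subrK.
  by apply: cvgD hl (cvg_cst _).
(* An upper limit is measurable and defined everywhere; it is the limit wherever the sequence
   converges. *)
pose l x := fine (limn_esup (fun n => (u n x)%:E)).
have ml : measurable_fun setT l.
  apply: measurableT_comp => //; apply: measurable_fun_limn_esup => n.
  exact/measurable_EFinP.
have hl : {ae P, forall x, u n x @[n --> \oo] --> l x}.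
  apply: filterS cvu => x cx; rewrite /l.
  have h : (u n x)%:E @[n --> \oo] --> (limn (u ^~ x))%:E by apply: cvg_EFin; [exact: nearW|].
  rewrite is_cvg_limn_esupE; last by apply/cvg_ex; eexists; exact: h.
  by rewrite (cvg_lim _ h).
have tail k j : nrm (u (j + k)%N - u k) <= 3 / 2 * (3^-1 ^+ k - 3^-1 ^+ (j + k)).
  elim: j => [|j IH]; first by rewrite add0n !subrr nrm0// mulr0.
  apply: le_trans (ler_nrm_distD Hip (u (j + k)%N) _ _) _.
  have := hu (j + k)%N; rewrite addSn exprS; move: IH.
  by move: (3^-1 ^+ _) (3^-1 ^+ _) (nrm _) (nrm _) => *; lra.
have key k : exists g : V, g = (fun x => l x - u k x) :> (T -> R) /\ nrm g <= 3 / 2 * 3^-1 ^+ k.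
  apply: (@L2_fatou _ _ _ P (fun j => u (j + k)%N - u k)).
  - exact: measurable_funB.
  - apply: filterS hl => x hx; apply: (@cvgB _ _ _ _ _ (fun n => u (n + k)%N x)).
      by rewrite (cvg_shiftn k (u ^~ x)).
    exact: cvg_cst.
  - move=> j; apply: le_trans (tail _ _) _; rewrite ler_wpM2l//.
    by rewrite lerBlDr lerDl exprn_ge0// invr_ge0.
(* Only the differences [l - u k] are known to be square integrable; the limit is recovered as an
   element of [V] by adding [u 0] back. *)
have [g0 [g0E _]] := key 0%N.
exists (g0 + u 0).
have hb : 3 / 2 * 3^-1 ^+ k @[k --> \oo] --> (3 / 2 * 0 : R).
  by apply: cvgMl_tmp; apply: cvg_expr; rewrite ger0_norm ?invr_ge0// invf_lt1// ltr1n.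
rewrite mulr0 in hb.
apply: (squeeze_cvgr _ (cvg_cst 0) hb); apply: nearW => k; rewrite nrm_ge0/=.
have [g [gE]] := key k; apply: le_trans; rewrite le_eqVlt; apply/orP; left; apply/eqP.
rewrite -(nrmN Hip); congr nrm; apply/LfuneqP => x.
have e : g x = l x - u k x by rewrite [LHS](congr1 (fun h : T -> R => h x) gE).
have e0 : g0 x = l x - u 0 x by rewrite [LHS](congr1 (fun h : T -> R => h x) g0E).
rewrite -[LHS]/(u k x - (g0 x + u 0 x)) -[RHS]/(- g x) e e0; ring.
Qed.

End L2_complete.

(** * Smooth functions *)

Section real_derivation_rules.
Context {R : realType}.
Implicit Types (f g : R -> R) (x a b c : R).

Lemma isdE f x a b : is_derive x 1 f a -> a = b -> is_derive x 1 f b.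
Proof. by move=> h <-. Qed.

Lemma isd_derive1 f x a : is_derive x 1 f a -> f^`()%classic x = a.
Proof. by move=> h; rewrite derive1E; exact: derive_val. Qed.

Lemma isd_of f x : derivable f x 1 -> is_derive x 1 f (f^`()%classic x).
Proof. by move=> h; rewrite derive1E; exact/derivableP. Qed.

Lemma isd_cont f x a : is_derive x 1 f a -> {for x, continuous f}.
Proof. by move=> [h _]; apply/differentiable_continuous/derivable1_diffP. Qed.

Lemma isdD f g x a b : is_derive x 1 f a -> is_derive x 1 g b ->
  is_derive x 1 (fun y => f y + g y) (a + b).
Proof. exact: is_deriveD. Qed.

Lemma isdN f x a : is_derive x 1 f a -> is_derive x 1 (fun y => - f y) (- a).
Proof. exact: is_deriveN. Qed.

Lemma isdB f g x a b : is_derive x 1 f a -> is_derive x 1 g b ->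
  is_derive x 1 (fun y => f y - g y) (a - b).
Proof. exact: is_deriveB. Qed.

Lemma isdM f g x a b : is_derive x 1 f a -> is_derive x 1 g b ->
  is_derive x 1 (fun y => f y * g y) (a * g x + f x * b).
Proof.
move=> hf hg; apply: isdE (is_deriveM hf hg) _.
by rewrite /GRing.scale/= addrC (mulrC (g x)).
Qed.

Lemma isd_cst c x : is_derive x 1 (fun=> c) 0.
Proof. exact: is_derive_cst. Qed.

Lemma isd_id x : is_derive x 1 (fun y => y) 1.
Proof. exact: is_derive_id. Qed.

Lemma isdZ f x a c : is_derive x 1 f a -> is_derive x 1 (fun y => c * f y) (c * a).
Proof. by move=> h; apply: isdE (isdM (isd_cst c x) h) _; rewrite mul0r add0r. Qed.

Lemma isd_sqr f x a : is_derive x 1 f a -> is_derive x 1 (fun y => f y ^+ 2) (2 * f x * a).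
Proof. by move=> h; apply: isdE (isdM h h) _; ring. Qed.

Lemma isd_comp f g x a b : is_derive (g x) 1 f a -> is_derive x 1 g b ->
  is_derive x 1 (fun y => f (g y)) (a * b).
Proof. exact: is_derive1_comp. Qed.

Lemma omega_gt0 x : 0 < omega x.
Proof. by rewrite ltr_wpDr ?sqr_ge0. Qed.

Lemma omega_ge1 x : 1 <= omega x.
Proof. by rewrite lerDl sqr_ge0. Qed.

Lemma isd_omega x : is_derive x 1 (@omega R) (2 * x).
Proof.
by apply: isdE (isdD (isd_cst 1 x) (isd_sqr (isd_id x))) _; rewrite add0r mulr1.
Qed.

Lemma isd_powR_omega c x :
  is_derive x 1 (fun y => omega y `^ c) (2 * c * x * omega x `^ (c - 1)).
Proof.
have h := is_derive1_powR c (omega_gt0 x).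
by apply: isdE (isd_comp h (isd_omega x)) _; ring.
Qed.

Lemma powR_omegaS c x : omega x `^ c = omega x * omega x `^ (c - 1).
Proof.
rewrite -{2}(powRr1 (ltW (omega_gt0 x))) -powRD; first by rewrite addrC subrK.
by rewrite (gt_eqF (omega_gt0 x)) implybT.
Qed.

Lemma powR_omega_gt0 c x : 0 < omega x `^ c.
Proof. by rewrite powR_gt0// omega_gt0. Qed.

Lemma powR_omegaD c c' x : omega x `^ (c + c') = omega x `^ c * omega x `^ c'.
Proof. by rewrite powRD// (gt_eqF (omega_gt0 x)) implybT. Qed.

End real_derivation_rules.

(** * Smooth and compactly supported functions *)

Section smooth_functions.
Context {R : realType}.
Implicit Types (f g : R -> R) (x c : R).

(** A coinduction principle: smoothness is proved by exhibiting a class closed under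
    differentiation, with no formula for iterated derivatives. *)
Lemma smooth_stable (S : set (R -> R)) :
  (forall f, S f -> (forall x, derivable f x 1) /\ S f^`()%classic) ->
  S `<=` smooth.
Proof.
move=> hS f Sf n; suff : S f^`(n)%classic by move=> /hS [].
by elim: n => [//|n IH]; rewrite derive1nS; exact: (hS _ IH).2.
Qed.

Lemma smooth_derivable f x : smooth f -> derivable f x 1.
Proof. by move=> h; have := h 0%N x; rewrite derive1n0. Qed.

Lemma smooth_derive1 f : smooth f -> smooth f^`()%classic.
Proof. by move=> h n x; rewrite -derive1Sn; exact: h. Qed.

Lemma smooth_isd f x : smooth f -> is_derive x 1 f (f^`()%classic x).
Proof. by move=> h; apply: isd_of; exact: smooth_derivable. Qed.

Lemma smooth_isd2 f x : smooth f -> is_derive x 1 f^`()%classic (f^`(2)%classic x).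
Proof.
by move=> h; rewrite derive1nS derive1n1; exact/smooth_isd/smooth_derive1.
Qed.

Lemma smooth_continuous f : smooth f -> continuous f.
Proof. by move=> h x; exact: isd_cont (smooth_isd x h). Qed.

(** The Leibniz and chain rules express a derivative by sums, products and compositions of members
    of this closure, which is therefore closed under differentiation. *)
Inductive smooth_alg : (R -> R) -> Prop :=
| smooth_alg_base f : smooth f -> smooth_alg f
| smooth_alg_add f g : smooth_alg f -> smooth_alg g -> smooth_alg (fun x => f x + g x)
| smooth_alg_mul f g : smooth_alg f -> smooth_alg g -> smooth_alg (fun x => f x * g x)
| smooth_alg_comp f g : smooth_alg f -> smooth_alg g -> smooth_alg (fun x => f (g x)).

Lemma smooth_alg_smooth f : smooth_alg f -> smooth f.
Proof.
apply: (@smooth_stable smooth_alg) => {}f; elim=> {f}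
  [f sf|f g sf [df sf'] sg [dg sg']|f g sf [df sf'] sg [dg sg']|f g sf [df sf'] sg [dg sg']].
- by split=> [x|]; [exact: smooth_derivable|exact/smooth_alg_base/smooth_derive1].
- have h x := isdD (isd_of (df x)) (isd_of (dg x)).
  split=> [x|]; first exact: (@ex_derive _ _ _ _ _ _ _ (h x)).
  by rewrite (funext (fun x => isd_derive1 (h x))); exact: smooth_alg_add.
- have h x := isdM (isd_of (df x)) (isd_of (dg x)).
  split=> [x|]; first exact: (@ex_derive _ _ _ _ _ _ _ (h x)).
  rewrite (funext (fun x => isd_derive1 (h x))).
  by apply: smooth_alg_add; exact: smooth_alg_mul.
- have h x := isd_comp (isd_of (df (g x))) (isd_of (dg x)).
  split=> [x|]; first exact: (@ex_derive _ _ _ _ _ _ _ (h x)).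
  rewrite (funext (fun x => isd_derive1 (h x))).
  by apply: smooth_alg_mul => //; exact: smooth_alg_comp.
Qed.

Lemma smoothD f g : smooth f -> smooth g -> smooth (fun x => f x + g x).
Proof.
by move=> sf sg; apply: smooth_alg_smooth; apply: smooth_alg_add; exact: smooth_alg_base.
Qed.

Lemma smoothM f g : smooth f -> smooth g -> smooth (fun x => f x * g x).
Proof.
by move=> sf sg; apply: smooth_alg_smooth; apply: smooth_alg_mul; exact: smooth_alg_base.
Qed.

Lemma smooth_comp f g : smooth f -> smooth g -> smooth (fun x => f (g x)).
Proof.
by move=> sf sg; apply: smooth_alg_smooth; apply: smooth_alg_comp; exact: smooth_alg_base.
Qed.

Lemma smooth_cst c : smooth (fun _ : R => c).
Proof.
apply: (@smooth_stable [set f | exists c, f = fun=> c]); last by exists c.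
move=> _ [{}c ->]; split=> [x|]; first exact: derivable_cst.
by exists 0; apply/funext => x; exact: (isd_derive1 (isd_cst c x)).
Qed.

Lemma smooth_id : smooth (fun x : R => x).
Proof.
case=> [|n] x; first exact: derivable_id.
rewrite derive1Sn (_ : _^`()%classic = fun=> (1 : R)); first exact: smooth_cst.
by apply/funext => y; exact: (isd_derive1 (isd_id y)).
Qed.

Lemma smoothZ c f : smooth f -> smooth (fun x => c * f x).
Proof. exact/smoothM/smooth_cst. Qed.

Lemma smoothB f g : smooth f -> smooth g -> smooth (fun x => f x - g x).
Proof.
move=> sf sg; rewrite (_ : (fun x => _) = fun x => f x + -1 * g x).
  by apply: smoothD; [exact: sf|exact: smoothZ].
by apply/funext => x; rewrite mulN1r.
Qed.

Lemma smooth_omega : smooth (@omega R).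
Proof.
rewrite (_ : omega = fun x : R => 1 + x * x).
  by apply: smoothD; [exact: smooth_cst|apply: smoothM; exact: smooth_id].
by apply/funext => x; rewrite /omega expr2.
Qed.

(** The class of the functions [p * omega ^ d] with [p] smooth is closed under differentiation: the
    new factor is [p' omega + 2 d x p], with exponent [d - 1]. *)
Lemma smooth_powR_omega c : smooth (fun x : R => omega x `^ c).
Proof.
apply: (@smooth_stable [set f | exists p d, smooth p /\ f = fun x => p x * omega x `^ d]).
  move=> _ [p [d [sp ->]]].
  have h x := isdM (smooth_isd x sp) (isd_powR_omega d x).
  split=> [x|]; first exact: (@ex_derive _ _ _ _ _ _ _ (h x)).
  exists (fun x => p^`()%classic x * omega x + 2 * d * (x * p x)), (d - 1); split.
    apply: smoothD; first by apply: smoothM; [exact: smooth_derive1|exact: smooth_omega].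
    by apply: smoothZ; apply: smoothM; [exact: smooth_id|exact: sp].
  apply/funext => x; rewrite (isd_derive1 (h x)) [omega x `^ d]powR_omegaS; ring.
exists (fun=> 1), c; split; first exact: smooth_cst.
by apply/funext => x; rewrite mul1r.
Qed.

Lemma CcinftyP f : Ccinfty f <->
  smooth f /\ exists M, 0 < M /\ forall x, M < `|x| -> f x = 0.
Proof.
split=> [[sf cf]|[sf [M [M0 fM]]]]; split => //.
  have /compact_bounded [M [Mr hM]] := cf.
  exists (`|M| + 1); split; first by rewrite ltr_wpDl.
  move=> x xM; apply/eqP; apply: contraTT xM => fx; rewrite -leNgt.
  apply: hM; first by rewrite (le_lt_trans (ler_norm M))// ltrDl.
  exact: subset_closure.
apply: (subclosed_compact _ (@segment_compact _ (- M) M)); first exact: closed_closure.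
have -> : `[- M, M]%classic = closure `[- M, M]%classic.
  by apply/closure_id; exact: interval_closed.
apply: closureS => x /=; rewrite in_itv/= -ler_norml => /eqP fx.
by rewrite leNgt; apply/negP => /fM.
Qed.

Lemma Ccinfty_supp f : Ccinfty f -> exists M, 0 < M /\
  forall x, M < `|x| -> [/\ f x = 0, f^`()%classic x = 0 & f^`(2)%classic x = 0].
Proof.
move=> /CcinftyP[sf [M [M0 fM]]]; exists M; split => //.
have op (x : R) : M < `|x| -> \forall y \near x, M < `|y|.
  move=> hx; apply: (@open_nbhs_nbhs _ x [set y | M < `|y|]); split => //.
  rewrite (_ : [set y | _] = (fun y : R => `|y|) @^-1` [set y | M < y])//.
  by apply: open_comp => [y _|]; [exact: norm_continuous|exact: open_gt].
have f'M x : M < `|x| -> f^`()%classic x = 0.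
  move=> /op hx; rewrite derive1E (@near_eq_derive _ _ _ _ (cst 0)) ?derive_cst//.
  by apply: filterS hx => y /fM ->.
move=> x hx; split; [exact: fM|exact: f'M|].
rewrite derive1nS derive1n1 derive1E (@near_eq_derive _ _ _ _ (cst 0)) ?derive_cst//.
by apply: filterS (op _ hx) => y /f'M ->.
Qed.

Lemma Ccinfty_L beta f : Ccinfty f -> Ccinfty (L beta f).
Proof.
move=> cf; have /CcinftyP[sf _] := cf; have [M [M0 fM]] := Ccinfty_supp cf.
apply/CcinftyP; split.
  rewrite (_ : L beta f = fun x => omega x * f^`(2)%classic x - 2 * (beta - 1) * (x * f^`()%classic x)); last first.
    by apply/funext => x; rewrite /L !mulrA.
  apply: smoothB; first apply: smoothM; first exact: smooth_omega.
    by rewrite derive1nS derive1n1; exact/smooth_derive1/smooth_derive1.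
  by apply: smoothZ; apply: smoothM; [exact: smooth_id|exact: smooth_derive1].
by exists M; split => // x /fM[_ f1 f2]; rewrite /L f1 f2 !mulr0 subr0.
Qed.

Lemma CcinftyB f g : Ccinfty f -> Ccinfty g -> Ccinfty (fun x => f x - g x).
Proof.
move=> /CcinftyP[sf [M [M0 fM]]] /CcinftyP[sg [N [N0 gN]]]; apply/CcinftyP; split.
  exact: smoothB.
exists (Num.max M N); split; first by rewrite lt_max M0.
by move=> x; rewrite gt_max => /andP[/fM -> /gN ->]; rewrite subrr.
Qed.

Lemma LB beta f g x : smooth f -> smooth g ->
  L beta (fun x => f x - g x) x = L beta f x - L beta g x.
Proof.
move=> sf sg; rewrite /L.
have E1 : (fun x => f x - g x)^`()%classic = (fun x => f^`()%classic x - g^`()%classic x).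
  by apply/funext => y; exact: (isd_derive1 (isdB (smooth_isd y sf) (smooth_isd y sg))).
rewrite derive1nS derive1n1 E1.
by rewrite (isd_derive1 (isdB (smooth_isd2 x sf) (smooth_isd2 x sg))) !mulrBr opprD addrACA -opprD.
Qed.

End smooth_functions.

(** * The measure mu *)

Section weighted_measure.
Context {R : realType}.
Local Notation leb := (@lebesgue_measure R).

Lemma powR_cvgy0 (q : R) : 0 < q -> (1 + x) `^ (- q) @[x --> +oo] --> (0 : R).
Proof.
move=> q0; apply/cvgrPdist_le => /= e e0.
exists (e^-1 `^ q^-1); split; first by rewrite num_real.
move=> x hx; have x0 : 0 < 1 + x.
  by rewrite ltr_wpDl//; apply: le_lt_trans hx; exact: powR_ge0.
rewrite sub0r normrN ger0_norm ?powR_ge0// powRN -[leRHS]invrK lef_pV2 ?posrE ?invr_gt0 ?powR_gt0//.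
rewrite -[leLHS]powRr1 ?invr_ge0 ?(ltW e0)// -[X in _ `^ X](@mulVf _ q) ?gt_eqF// powRrM.
rewrite ge0_ler_powR ?nnegrE ?powR_ge0 ?(ltW x0)// ?(ltW q0)//.
by apply: ltW; apply: lt_trans hx _; rewrite ltrDr.
Qed.

Lemma integral_powR_tail (p : R) : 1 < p ->
  (\int[leb]_(x in `[0%R, +oo[) ((1 + x) `^ (- p))%:E = ((p - 1)^-1)%:E)%E.
Proof.
move=> p1; have q0 : 0 < p - 1 by rewrite subr_gt0.
pose F x : R := - (p - 1)^-1 * (1 + x) `^ (- (p - 1)).
have dF (x : R) : 0 <= x -> is_derive x 1 F ((1 + x) `^ (- p)).
  move=> x0; have x1 : 0 < 1 + x by rewrite ltr_pwDl.
  have h := is_derive1_powR (- (p - 1)) x1.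
  apply: isdE (isdZ (- (p - 1)^-1) (isd_comp h (isdD (isd_cst 1 x) (isd_id x)))) _.
  have -> : - (p - 1) - 1 = - p by ring.
  by field; rewrite gt_eqF.
rewrite (@ge0_continuous_FTC2y _ _ F 0 0).
- by rewrite /F addr0 powR1 mulr1 sub0e -EFinN opprK.
- by move=> x _; exact: powR_ge0.
- apply: derivable_within_continuous => x; rewrite in_itv/= andbT => x0.
  have x1 : 0 < 1 + x by rewrite ltr_pwDl.
  have h := is_derive1_powR (- p) x1.
  exact: (@ex_derive _ _ _ _ _ _ _ (isd_comp h (isdD (isd_cst 1 x) (isd_id x)))).
- by rewrite -[X in _ --> X](mulr0 (- (p - 1)^-1)); apply: cvgMl_tmp; exact: powR_cvgy0.
- by move=> x x0; exact: (@ex_derive _ _ _ _ _ _ _ (dF x (ltW x0))).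
- by apply: cvg_at_right_filter; exact: (isd_cont (dF 0 (lexx 0))).
- by move=> x; rewrite in_itv/= andbT => /ltW x0; exact: (isd_derive1 (dF x x0)).
Qed.

Lemma measurable_omega c : measurable_fun setT (fun x : R => omega x `^ c).
Proof.
by apply: continuous_measurable_fun => x; exact: isd_cont (isd_powR_omega c x).
Qed.

Lemma measurable_powR1D c : measurable_fun setT (fun x : R => (1 + x) `^ c).
Proof. by apply: (measurableT_comp (measurable_powR c)); exact: measurable_funD. Qed.

Lemma integral_powR_omega c :
  (\int[leb]_x (omega x `^ c)%:E = 2%:E * \int[leb]_(x in `[0%R, +oo[) (omega x `^ c)%:E)%E.
Proof.
rewrite ge0_symfun_integralT.
- by rewrite -set_itvcy.
- by move=> x; exact: powR_ge0.
- by move=> x; exact: isd_cont (isd_powR_omega c x).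
- by move=> x /=; rewrite /omega sqrrN.
Qed.

(** Comparison with [(1 + x) ^ (- 2 c)] on the half-line, through [omega x >= (1 + x)^2 / 2]; the
    two sides differ by [(x - 1)^2 / 2]. *)
Lemma integral_powR_omega_lty (c : R) : 1 / 2 < c ->
  (\int[leb]_x (omega x `^ (- c))%:E < +oo)%E.
Proof.
move=> c2; rewrite integral_powR_omega lte_mul_pinfty//.
apply: (@le_lt_trans _ _ (\int[leb]_(x in `[0%R, +oo[) ((2 `^ c)%:E * ((1 + x) `^ (- (2 * c)))%:E))%E).
  apply: ge0_le_integral => //.
  - by move=> x _; rewrite lee_fin powR_ge0.
  - by apply/measurable_EFinP/measurable_funTS; exact: measurable_omega.
  - apply/measurable_EFinP/measurable_funTS; apply: measurable_funM => //.
    exact: measurable_powR1D.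
  - move=> x /=; rewrite in_itv/= andbT => x0; rewrite -EFinM lee_fin.
    have x1 : 0 < 1 + x by rewrite ltr_pwDl.
    have -> : - (2 * c) = 2 * (- c) by ring.
    rewrite powRrM powR_mulrn ?(ltW x1)//.
    have h : omega x >= (1 + x) ^+ 2 / 2.
      rewrite /omega; have := sqr_ge0 (x - 1).
      by rewrite !expr2 => h; lra.
    rewrite !powRN ler_pdivlMr ?powR_gt0 ?exprn_gt0// mulrC ler_pdivrMr ?powR_gt0 ?omega_gt0//.
    rewrite -powRM ?(ltW (omega_gt0 x))//.
    rewrite ge0_ler_powR ?nnegrE ?mulr_ge0 ?sqr_ge0 ?(ltW (omega_gt0 x))//; lra.
rewrite ge0_integralZl//; last 2 first.
- apply/measurable_EFinP/measurable_funTS.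
  exact: measurable_powR1D.
- by move=> x _; rewrite lee_fin powR_ge0.
by rewrite lte_mul_pinfty ?lee_fin ?powR_ge0// integral_powR_tail ?ltry//; lra.
Qed.

(** On the half-line [omega x <= (1 + x)^2], which gives [1 / (2 e)] on each side. The blow-up as
    [e] tends to 0 is the source of the optimality of the spectral gap. *)
Lemma integral_powR_omega_ge (e : R) : 0 < e ->
  ((e^-1)%:E <= \int[leb]_x (omega x `^ (- (1 / 2 + e)))%:E)%E.
Proof.
move=> e0; rewrite integral_powR_omega.
have h : ((e^-1 / 2)%:E <= \int[leb]_(x in `[0%R, +oo[) (omega x `^ (- (1 / 2 + e)))%:E)%E.
  have := @integral_powR_tail (1 + 2 * e).
  have -> : (1 + 2 * e - 1)^-1 = e^-1 / 2 by field; rewrite gt_eqF//=; lra.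
  move=> <-; last by lra.
  apply: ge0_le_integral => //.
  - by move=> x _; rewrite lee_fin powR_ge0.
  - apply/measurable_EFinP/measurable_funTS.
    exact: measurable_powR1D.
  - by apply/measurable_EFinP/measurable_funTS; exact: measurable_omega.
  - move=> x /=; rewrite in_itv/= andbT => x0; rewrite lee_fin.
    have x1 : 0 < 1 + x by rewrite ltr_pwDl.
    have -> : - (1 + 2 * e) = 2 * (- (1 / 2 + e)) by field.
    rewrite powRrM powR_mulrn ?(ltW x1)// !powRN lef_pV2 ?posrE ?powR_gt0 ?exprn_gt0 ?omega_gt0//.
    rewrite ge0_ler_powR ?nnegrE ?sqr_ge0 ?(ltW (omega_gt0 x))//; first by lra.
    by rewrite /omega !expr2; nra.
apply: (@le_trans _ _ (2%:E * (e^-1 / 2)%:E)%E); first by rewrite -EFinM lee_fin; lra.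
by rewrite lee_wpmul2l// lee_fin.
Qed.

End weighted_measure.

(* [mu_ beta] and Lebesgue measure live on copies of [R] whose displays differ;
   the identity, seen as a random variable, transports the former. *)
Definition to_lebesgue {R : realType} (x : R) : measurableTypeR R := x.

Lemma measurable_to_lebesgue {R : realType} : measurable_fun [set: R] (@to_lebesgue R).
Proof. by move=> _ A mA; rewrite setTI; exact: mA. Qed.

HB.instance Definition _ {R : realType} :=
  isMeasurableFun.Build _ _ _ _ (@to_lebesgue R) measurable_to_lebesgue.

(** * The density of the probability measure *)

Section mu_density.
Context {R : realType} (beta : R).
Hypothesis hb1 : 1 / 2 < beta.
Local Notation leb := (@lebesgue_measure R).
Local Notation mu := (mu_ beta).

Definition weight (x : R) : R := omega x `^ (- beta).

Lemma weight_le (x y : R) : `|x| <= `|y| -> weight y <= weight x.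
Proof.
move=> xy; rewrite /weight !powRN lef_pV2 ?posrE ?powR_gt0 ?omega_gt0//.
have b0 : 0 <= beta by move: hb1; lra.
rewrite ge0_ler_powR ?nnegrE ?(ltW (omega_gt0 _))//.
rewrite /omega lerD2l -(real_normK (num_real x)) -(real_normK (num_real y)).
by rewrite lerXn2r ?nnegrE.
Qed.

Definition total_mass : R := fine (weight_measure beta setT).
Local Notation Z := total_mass.

Lemma weight_gt0 x : 0 < weight x. Proof. exact: powR_omega_gt0. Qed.

Lemma measurable_weight_fun : measurable_fun setT weight.
Proof. exact: measurable_omega. Qed.

Lemma continuous_weight : continuous weight.
Proof. by move=> x; exact: isd_cont (isd_powR_omega (- beta) x). Qed.

Lemma integral_weight : (\int[leb]_x (weight x)%:E)%E = Z%:E.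
Proof.
rewrite /Z fineK//= /weight_measure ge0_fin_numE; first exact: integral_powR_omega_lty.
by apply: integral_ge0 => x _; rewrite lee_fin powR_ge0.
Qed.

Lemma total_mass_gt0 : 0 < Z.
Proof.
rewrite -lte_fin -integral_weight.
apply: (@lt_le_trans _ _ (\int[leb]_(x in `[0%R, 1%R]) (weight 1)%:E)%E).
  rewrite integral_cst//= lebesgue_measure_itv/= lte_fin ltr01 oppr0 adde0 mule1.
  by rewrite lte_fin weight_gt0.
apply: (@le_trans _ _ (\int[leb]_(x in `[0%R, 1%R]) (weight x)%:E)%E).
  apply: ge0_le_integral => //.
  - by move=> x _; rewrite lee_fin powR_ge0.
  - by apply/measurable_EFinP/measurable_funTS; exact: measurable_weight_fun.
  - move=> x /=; rewrite in_itv/= => /andP[x0 x1].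
    by rewrite lee_fin weight_le// normr1 ger0_norm.
apply: ge0_subset_integral => //.
- by apply/measurable_EFinP; exact: measurable_weight_fun.
- by move=> x _; rewrite lee_fin ltW// weight_gt0.
Qed.

Definition density (x : R) : R := weight x / Z.

Lemma density_gt0 x : 0 < density x.
Proof. by rewrite divr_gt0 ?weight_gt0 ?total_mass_gt0. Qed.

Lemma measurable_density : measurable_fun setT density.
Proof. by apply: measurable_funM => //; exact: measurable_weight_fun. Qed.

Lemma mu_E A : measurable A -> mu A = (\int[leb]_(x in A) (density x)%:E)%E.
Proof.
move=> mA; rewrite /mu_ /= /mnormalize /=.
have hZ : weight_measure beta setT = Z%:E by rewrite -integral_weight.
(* The total mass is finite and nonzero, which excludes the Dirac default of [mnormalize]. *)
rewrite hZ eqe (gt_eqF total_mass_gt0)/=.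
rewrite /weight_measure muleC -ge0_integralZl//; last 3 first.
- by apply/measurable_EFinP/measurable_funTS; exact: measurable_weight_fun.
- by move=> x _; rewrite lee_fin powR_ge0.
- by rewrite lee_fin invr_ge0 ltW// total_mass_gt0.
by apply: eq_integral => x _; rewrite -EFinM /density mulrC.
Qed.

Let nu : {finite_measure set (measurableTypeR R) -> \bar R} :=
  distribution (mu_ beta) (@to_lebesgue R).

Lemma nu_dominates : nu `<< lebesgue_measure.
Proof.
apply/null_content_dominatesP => A mA A0.
rewrite -[LHS]/(mu (@to_lebesgue R @^-1` A)) mu_E//.
by apply: null_set_integral => //; apply/measurable_EFinP/measurable_funTS; exact: measurable_density.
Qed.

(** [density] agrees almost everywhere with the Radon-Nikodym derivative of the transported measure,
    since both have the same integral over every measurable set; the change of variables for that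
    derivative then applies. *)
Lemma ge0_integral_mu (f : R -> \bar R) : (forall x, (0 <= f x)%E) ->
  measurable_fun setT f ->
  (\int[mu]_x f x = \int[leb]_x (f x * (density x)%:E))%E.
Proof.
move=> f0 mf.
have -> : (\int[mu]_x f x = \int[nu]_x f x)%E.
  by rewrite [RHS](@ge0_integral_distribution _ _ _ _ _ _ (@to_lebesgue R)).
rewrite -(Radon_Nikodym_SigmaFinite.change_of_variables nu_dominates)//.
have md : measurable_fun setT (EFin \o density) by apply/measurable_EFinP; exact: measurable_density.
apply: ae_eq_integral => //.
- apply: emeasurable_funM => //.
  exact: (measurable_int _ (Radon_Nikodym_SigmaFinite.f_integrable nu_dominates)).
- exact: emeasurable_funM.
- apply: ae_eqe_mul2l; apply: integral_ae_eq => //.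
  + exact: (Radon_Nikodym_SigmaFinite.f_integrable nu_dominates).
  + move=> E _ mE; rewrite -(Radon_Nikodym_SigmaFinite.f_integral nu_dominates mE).
    exact: mu_E.
Qed.

Lemma integral_mu (f : R -> R) : measurable_fun setT f ->
  (\int[mu]_x (f x)%:E = \int[leb]_x (f x * density x)%:E)%E.
Proof.
move=> mf; rewrite integralE [in RHS]integralE.
have mf' : measurable_fun setT (EFin \o f) by apply/measurable_EFinP.
rewrite !ge0_integral_mu//; [|exact: measurable_funeneg|exact: measurable_funepos].
congr (_ - _)%E; apply: eq_integral => x _.
- rewrite !funeposE /= -!EFin_max -EFinM maxr_pMl ?mul0r//; exact/ltW/density_gt0.
- rewrite !funenegE /= -!EFin_max -EFinM maxr_pMl ?mul0r ?mulNr//; exact/ltW/density_gt0.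
Qed.

Lemma integrable_mu (f : R -> R) : measurable_fun setT f ->
  leb.-integrable setT (EFin \o (fun x => f x * density x)) <->
  mu.-integrable setT (EFin \o f).
Proof.
move=> mf.
have key : (\int[mu]_x `|(f x)%:E| = \int[leb]_x `|(f x * density x)%:E|)%E.
  rewrite ge0_integral_mu//; last first.
    by apply: measurableT_comp => //; exact/measurable_EFinP.
  apply: eq_integral => x _; rewrite /= -EFinM normrM (ger0_norm (ltW (density_gt0 x))).
  by [].
split=> /integrableP[m h]; apply/integrableP; split.
- exact/measurable_EFinP.
- by rewrite key.
- by apply/measurable_EFinP; apply: measurable_funM => //; exact: measurable_density.
- by rewrite key in h.
Qed.

Lemma mu_powR_omega c : c < beta - 1 / 2 ->
  mu.-integrable setT (EFin \o (fun x => omega x `^ c)).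
Proof.
move=> hc; apply/integrable_mu; first exact: measurable_omega.
have E : (fun x => omega x `^ c * density x) = fun x => Z^-1 * omega x `^ (- (beta - c)).
  apply/funext => x; rewrite /density /weight mulrA -powR_omegaD mulrC.
  by congr (_ * (_ `^ _)); ring.
rewrite E; apply/integrableP; split.
  by apply/measurable_EFinP; apply: measurable_funM => //; exact: measurable_omega.
under eq_integral => x _ do rewrite /= ger0_norm ?mulr_ge0 ?powR_ge0 ?invr_ge0 ?(ltW total_mass_gt0)// EFinM.
rewrite ge0_integralZl//.
- rewrite lte_mul_pinfty ?lee_fin ?invr_ge0 ?(ltW total_mass_gt0)//.
  by apply: integral_powR_omega_lty; move: hc; lra.
- by apply/measurable_EFinP; exact: measurable_omega.
- by move=> x _; rewrite lee_fin powR_ge0.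
- by rewrite lee_fin invr_ge0 ltW// total_mass_gt0.
Qed.

Lemma mu_itvoo_gt0 (x e : R) : 0 < e -> (0%E < mu `]x - e, x + e[%classic)%O.
Proof.
move=> e0; rewrite mu_E//.
apply: (@lt_le_trans _ _ (\int[leb]_(y in `]x - e, x + e[%classic%R) (weight (`|x| + e) / Z)%:E)%E).
  rewrite integral_cst//= lebesgue_measure_itv/= lte_fin ifT; last by lra.
  rewrite -EFinB -EFinM lte_fin mulr_gt0//; last by lra.
  by rewrite divr_gt0 ?total_mass_gt0 ?weight_gt0.
apply: ge0_le_integral => //.
- by move=> y _; rewrite lee_fin divr_ge0 ?powR_ge0 ?(ltW total_mass_gt0).
- by apply/measurable_EFinP/measurable_funTS; exact: measurable_density.
- move=> y /=; rewrite in_itv/= => /andP[y1 y2].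
  rewrite lee_fin /density ler_pM2r ?invr_gt0 ?total_mass_gt0// weight_le//.
  rewrite [leRHS]ger0_norm ?addr_ge0 ?(ltW e0)// -lerBlDl.
  apply: le_trans (lerB_dist _ _) _; apply: ltW.
  by rewrite ltr_distl y1.
Qed.

(** Continuous functions that differ at a point differ on an interval around it, and intervals have
    positive mass. *)
Lemma continuous_ae_eq (f g : R -> R) : continuous f -> continuous g ->
  f = g %[ae mu] -> f = g.
Proof.
move=> cf cg fg; apply/funext => x; apply/eqP; rewrite -subr_eq0.
apply: contrapT => /negP fgx.
have cfg : continuous (fun y => f y - g y) by move=> y; apply: cvgB; [exact: cf|exact: cg].
have h : \forall y \near x, f y - g y != 0.
  exact: (cvgr_neq0 _ (cfg x) fgx).
move: h => [e /= e0 he].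
have mA : measurable (`]x - e, x + e[%classic : set R) by [].
have : mu `]x - e, x + e[%classic = 0%E.
  move: fg => [N [mN N0 hN]].
  apply/eqP; rewrite eq_le measure_ge0 andbT -N0; apply: le_measure; rewrite ?inE//.
  move=> y /= ; rewrite in_itv/= => /andP[y1 y2]; apply: hN => /= /(_ I) /eqP.
  rewrite -subr_eq0; apply/negP; apply: he; rewrite /ball/= ltr_distlC.
  by rewrite y1.
apply/eqP; rewrite gt_eqF//; exact: mu_itvoo_gt0.
Qed.

End mu_density.

(** * The operator on compactly supported functions *)

Section core_identities.
Context {R : realType} (beta : R).
Hypothesis hb1 : 1 / 2 < beta.
Hypothesis hb2 : beta <= 3 / 2.
Local Notation leb := (@lebesgue_measure R).
Local Notation mu := (mu_ beta).
Local Notation Z := (total_mass beta).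
Local Notation a := (beta - 1 / 2).

Implicit Types (f g v k F : R -> R) (x y M C c : R).

Definition primitive (v : R -> R) (y : R) : R := \int[mu]_(x in `]-oo, y]) v x.

Definition compact_supported (f : R -> R) : Prop :=
  continuous f /\ exists M, 0 < M /\ forall x, M < `|x| -> f x = 0.

Lemma compact_supported_bounded f : compact_supported f ->
  exists C, forall x, `|f x| <= C.
Proof.
move=> [cf [M [M0 fM]]].
have MM : - M <= M by lra.
have cn : {within `[- M, M], continuous (fun x => `|f x|)}.
  by apply: continuous_subspaceT => x; apply: cvg_norm; exact: cf.
have [c _ hc] := EVT_max MM cn.
exists `|f c| => x; have [xM|xM] := leP `|x| M.
  by apply: hc; rewrite in_itv/= -ler_norml.
by rewrite fM// normr0.
Qed.

Lemma bounded_Lfun2 f C : measurable_fun setT f -> (forall x, `|f x| <= C) ->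
  f \in Lfun mu 2%:E.
Proof.
move=> mf fC; apply: (le_Lfun2 mf (Lfun2_cst mu C)) => x.
by apply: le_trans (fC x) (ler_norm _).
Qed.

Lemma compact_supported_Lfun2 f : compact_supported f -> f \in Lfun mu 2%:E.
Proof.
move=> hf; have [C fC] := compact_supported_bounded hf; apply: (bounded_Lfun2 _ fC).
by apply: continuous_measurable_fun; case: hf.
Qed.

Lemma primitiveE v y : measurable_fun setT v ->
  primitive v y = \int[leb]_(x in `]-oo, y]) (v x * density beta x).
Proof.
move=> mv; rewrite /primitive Rintegral_mkcond /Rintegral.
rewrite (@integral_mu _ _ hb1 (v \_ `]-oo, y])); last first.
  by apply/(measurable_restrictT _ _).1 => //; exact: measurable_funTS.
rewrite [in RHS]integral_mkcond; congr fine; apply: eq_integral => x _.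
by rewrite !patchE; case: ifPn => //; rewrite mul0r.
Qed.

Lemma integrable_density v : measurable_fun setT v -> mu.-integrable setT (EFin \o v) ->
  leb.-integrable setT (EFin \o (fun x => v x * density beta x)).
Proof. by move=> mv iv; apply/integrable_mu. Qed.

Lemma continuous_density : continuous (@density R beta).
Proof. by move=> x; apply: cvgMr_tmp; exact: continuous_weight. Qed.

Lemma is_derive_primitive v x : continuous v -> mu.-integrable setT (EFin \o v) ->
  is_derive x 1 (primitive v) (v x * density beta x).
Proof.
move=> cv iv; have mv : measurable_fun setT v by exact: continuous_measurable_fun.
have il := integrable_density mv iv.
have xu : x < x + 1 by rewrite ltrDl.
have ilu : leb.-integrable [set` Interval -oo%O (BRight (x + 1))] (EFin \o (fun x => v x * density beta x)).
  exact: integrableS il.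
have c : {for x, continuous (fun x => v x * density beta x)}.
  by apply: cvgM; [exact: cv|exact: continuous_density].
have [] := @continuous_FTC1 _ _ -oo%O x (x + 1) xu ilu _ c; first by rewrite /= ltNyr.
rewrite (_ : (fun x => _) = primitive v); last first.
  by apply/funext => y; rewrite primitiveE.
by move=> d1 d2; rewrite -d2; exact: isd_of.
Qed.

Lemma primitive_compact (F k : R -> R) M y : (forall x, is_derive x 1 F (k x * weight beta x)) ->
  continuous k -> 0 < M -> (forall x, M < `|x| -> F x = 0 /\ k x = 0) ->
  primitive k y = Z^-1 * F y.
Proof.
move=> dF ck M0 Mk.
have mk : measurable_fun setT k by exact: continuous_measurable_fun.
pose N := M + `|y| + 1.
have yN : - N < y by rewrite /N; have := ler_norm (- y); rewrite normrN; lra.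
have NM x : x <= - N -> F x = 0 /\ k x = 0.
  move=> xN; apply: Mk; apply: (@lt_le_trans _ _ (- x)); last by rewrite -normrN ler_norm.
  by move: xN; rewrite /N; have := normr_ge0 y; lra.
rewrite primitiveE// /Rintegral integral_mkcond.
transitivity (fine (\int[leb]_(x in `[- N, y]) (k x * density beta x)%:E)).
  congr fine; rewrite [RHS]integral_mkcond; apply: eq_integral => x _.
  rewrite !patchE !mem_setE !in_itv/=; case: (leP x y) => //= xy; last by rewrite andbF.
  by rewrite andbT; case: leP => // /ltW/NM[_ ->]; rewrite mul0r.
have hF (x : R) : is_derive x 1 (fun x => Z^-1 * F x) (k x * density beta x).
  by apply: isdE (isdZ _ (dF x)) _; rewrite /density mulrC mulrA.
rewrite (@continuous_FTC2 _ _ (fun x => Z^-1 * F x))//.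
- by rewrite -EFinB/= (NM (- N) _).1// mulr0 subr0.
- apply: continuous_subspaceT => x; apply: cvgM; [exact: ck|exact: continuous_density].
- split.
  + by move=> x _; exact: (@ex_derive _ _ _ _ _ _ _ (hF x)).
  + by apply: cvg_at_right_filter; exact: (isd_cont (hF (- N))).
  + by apply: cvg_at_left_filter; exact: (isd_cont (hF y)).
- by move=> x _; exact: (isd_derive1 (hF x)).
Qed.

(** The form taken by integration by parts below: each identity on test functions comes from a
    compactly supported antiderivative [F] of [k * weight]. *)
Lemma integral_compact (F k : R -> R) M : (forall x, is_derive x 1 F (k x * weight beta x)) ->
  continuous k -> 0 < M -> (forall x, M < `|x| -> F x = 0 /\ k x = 0) ->
  \int[mu]_x k x = 0.
Proof.
move=> dF ck M0 Mk.
have M1 : M < `|M + 1| by rewrite ger0_norm//; lra.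
have := primitive_compact (M + 1) dF ck M0 Mk; rewrite (Mk _ M1).1 mulr0 => <-.
rewrite /primitive [RHS]Rintegral_mkcond; apply: eq_Rintegral => x _.
rewrite patchE mem_setE in_itv/=; case: leP => // xM.
by apply: (Mk _ _).2; apply: lt_le_trans (ler_norm x); lra.
Qed.

Lemma core_d1 f x : Ccinfty f -> is_derive x 1 f (f^`()%classic x).
Proof. by move=> /CcinftyP[sf _]; exact: smooth_isd. Qed.

Lemma core_d2 f x : Ccinfty f -> is_derive x 1 f^`()%classic (f^`(2)%classic x).
Proof. by move=> /CcinftyP[sf _]; exact: smooth_isd2. Qed.

Lemma core_cont f : Ccinfty f -> continuous f.
Proof. by move=> cf x; exact: isd_cont (core_d1 x cf). Qed.

Lemma core_cont1 f : Ccinfty f -> continuous f^`()%classic.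
Proof. by move=> cf x; exact: isd_cont (core_d2 x cf). Qed.

Lemma core_contL f : Ccinfty f -> continuous (L beta f).
Proof. by move=> cf; apply: core_cont; exact: Ccinfty_L. Qed.

Lemma continuous_omega : continuous (@omega R).
Proof. by move=> x; exact: isd_cont (isd_omega x). Qed.

(** The divergence form [L f = omega^beta (omega^(1 - beta) f')']. *)
Lemma core_flux f x : Ccinfty f ->
  is_derive x 1 (fun y => omega y `^ (1 - beta) * f^`()%classic y) (L beta f x * weight beta x).
Proof.
move=> cf; apply: isdE (isdM (isd_powR_omega (1 - beta) x) (core_d2 x cf)) _.
rewrite [omega x `^ (1 - beta)]powR_omegaS.
have -> : 1 - beta - 1 = - beta by ring.
by rewrite /L /weight; ring.
Qed.

Lemma core_supp f : Ccinfty f -> exists M, 0 < M /\ forall x, M < `|x| ->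
  [/\ f x = 0, f^`()%classic x = 0 & L beta f x = 0].
Proof.
move=> cf; have [M [M0 fM]] := Ccinfty_supp cf; exists M; split=> // x /fM[h0 h1 h2].
by split => //; rewrite /L h1 h2 !mulr0 subr0.
Qed.

Lemma core_primitive f y : Ccinfty f ->
  f^`()%classic y = Z * omega y `^ (beta - 1) * primitive (L beta f) y.
Proof.
move=> cf; have [M [M0 fM]] := core_supp cf.
have -> : primitive (L beta f) y = Z^-1 * (omega y `^ (1 - beta) * f^`()%classic y).
  apply: (@primitive_compact (fun y => omega y `^ (1 - beta) * f^`()%classic y) _ M) => //.
  - by move=> x; exact: core_flux.
  - exact: core_contL.
  - by move=> x /fM[_ -> ->]; rewrite mulr0.
have Z0 := total_mass_gt0 hb1.
have -> : omega y `^ (beta - 1) = (omega y `^ (1 - beta))^-1 by rewrite -powRN opprB.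
by field; rewrite !gt_eqF ?powR_omega_gt0.
Qed.

Lemma core_mean_L f : Ccinfty f -> \int[mu]_x L beta f x = 0.
Proof.
move=> cf; have [M [M0 fM]] := core_supp cf.
apply: (@integral_compact (fun y => omega y `^ (1 - beta) * f^`()%classic y) _ M) => //.
- by move=> x; exact: core_flux.
- exact: core_contL.
- by move=> x /fM[_ -> ->]; rewrite mulr0.
Qed.

Lemma core_ibp f g : Ccinfty f -> Ccinfty g ->
  \int[mu]_x (f x * L beta g x + omega x * f^`()%classic x * g^`()%classic x) = 0.
Proof.
move=> cf cg; have [M [M0 fM]] := core_supp cf.
apply: (@integral_compact (fun y => f y * (omega y `^ (1 - beta) * g^`()%classic y)) _ M) => //.
- move=> x; apply: isdE (isdM (core_d1 x cf) (core_flux x cg)) _.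
  rewrite [omega x `^ (1 - beta)]powR_omegaS.
  have -> : 1 - beta - 1 = - beta by ring.
  by rewrite /weight; ring.
- move=> x; apply: cvgD; first by apply: cvgM; [exact: core_cont|exact: core_contL].
  apply: cvgM; last exact: core_cont1.
  by apply: cvgM; [exact: continuous_omega|exact: core_cont1].
- by move=> x /fM[-> -> _]; rewrite mulr0 !mul0r addr0.
Qed.

(** Pairing [L f] with [x f'] amounts to integrating the derivative of [a x omega^(1 - beta) f'^2].
    After the substitution [omega f'' = L f + 2 (beta - 1) x f'], the coefficient of [x^2 f'^2] is
    [a + 2 a (beta - 1) = 2 a^2]. *)
Lemma core_Gamma2 f : Ccinfty f ->
  \int[mu]_x (2 * a * x * f^`()%classic x * L beta f x +
     f^`()%classic x ^+ 2 * (a + 2 * a ^+ 2 * x ^+ 2)) = 0.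
Proof.
move=> cf; have [M [M0 fM]] := core_supp cf.
apply: (@integral_compact (fun y => a * y * (omega y `^ (1 - beta) * f^`()%classic y ^+ 2)) _ M _ _ M0).
- move=> x.
  have h := isdM (isd_powR_omega (1 - beta) x) (isd_sqr (core_d2 x cf)).
  apply: isdE (isdM (isdZ a (isd_id x)) h) _.
  rewrite [omega x `^ (1 - beta)]powR_omegaS.
  have -> : 1 - beta - 1 = - beta by ring.
  by rewrite /weight /L /omega; field.
- move=> x; apply: cvgD.
    apply: cvgM; last exact: core_contL.
    by apply: cvgM; [apply: cvgMl_tmp; exact: cvg_id|exact: core_cont1].
  apply: cvgM; first by apply: cvgM; exact: core_cont1.
  apply: cvgD; first exact: cvg_cst.
  by apply: cvgMl_tmp; apply: cvgM; exact: cvg_id.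
- by move=> x /fM[_ -> _]; rewrite expr2 !(mulr0, mul0r) addr0.
Qed.

End core_identities.

(** * The Hardy inequality for test functions *)

Section core_poincare.
Context {R : realType} (beta : R).
Hypothesis hb1 : 1 / 2 < beta.
Hypothesis hb2 : beta <= 3 / 2.
Local Notation mu := (mu_ beta).
Local Notation Z := (total_mass beta).
Local Notation a := (beta - 1 / 2).
Implicit Types (f g v k F : R -> R) (x y M C c : R).

Lemma isdV f x c : f x != 0 -> is_derive x 1 f c ->
  is_derive x 1 (fun y => (f y)^-1) (- (f x) ^- 2 * c).
Proof.
move=> fx [df dfE]; apply: DeriveDef; first exact: derivableV.
by rewrite deriveV// dfE.
Qed.

(** Dominated convergence along []- n, n]]. It reduces the Hardy inequality to finite intervals,
    where the boundary terms are discarded by their sign. *)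
Lemma Rintegral_ge0_itv k : mu.-integrable setT (EFin \o k) ->
  (forall n : nat, 0 <= \int[mu]_(x in `]- n%:R, n%:R]) k x) ->
  0 <= \int[mu]_x k x.
Proof.
move=> ik hk.
pose I (n : nat) : set R := [set` `]- n%:R, n%:R]].
pose kn n := ((EFin \o k) \_ (I n))%E.
have mk : measurable_fun setT (EFin \o k) by case/integrableP : ik.
have mkn n : measurable_fun setT (kn n).
  by apply/(measurable_restrictT _ _).1; [exact: measurable_itv|exact: measurable_funTS].
have h : (\int[mu]_x kn n x @[n --> \oo] --> \int[mu]_x (k x)%:E)%E.
  apply: (@dominated_cvg _ _ _ mu setT measurableT kn (EFin \o k) (fun x => `|k x|%:E)) => //.
  - move=> x _; apply: cvg_near_cst.
    exists (Num.bound `|x|).+1 => // n /= hn; rewrite /kn patchE /I mem_setE in_itv/=.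
    have : `|x| < n%:R.
      apply: lt_trans (archi_boundP _) _ => //; rewrite ltr_nat.
      exact: leq_trans hn.
    by rewrite ltr_norml => /andP[-> /ltW ->].
  - exact: (integrable_norm ik).
  - move=> n x _; rewrite /kn patchE; case: ifPn => _ //.
    by rewrite abse0 lee_fin.
have key : (0 <= \int[mu]_x (k x)%:E)%E.
  apply: cvge_to_ge h _; apply: nearW => n.
  rewrite /kn -integral_mkcond.
  have ikn : mu.-integrable (I n) (EFin \o k).
    by apply: (integrableS measurableT) => //; exact: measurable_itv.
  by have := hk n; rewrite -lee_fin /Rintegral fineK//; exact: integrable_fin_num.
by rewrite /Rintegral fine_ge0.
Qed.

Lemma primitiveB k x y : mu.-integrable setT (EFin \o k) -> x <= y ->
  primitive beta k y - primitive beta k x = \int[mu]_(t in `]x, y]) k t.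
Proof.
move=> ik xy; rewrite /primitive.
rewrite (@itv_bndbnd_setU _ _ -oo%O (BRight x) (BRight y)) ?bnd_simp// Rintegral_setU//.
- by rewrite addrC addKr.
- by apply: (integrableS measurableT) ik => //; rewrite -itv_bndbnd_setU ?bnd_simp//; exact: measurable_itv.
- apply/disj_setPS => z [/=]; rewrite !in_itv/= => zx /andP[xz _].
  by move: (lt_le_trans xz zx); rewrite ltxx.
Qed.

Lemma bounded_integrable k C : measurable_fun setT k -> (forall x, `|k x| <= C) ->
  mu.-integrable setT (EFin \o k).
Proof. by move=> mk kC; apply/integrable_Lfun2/(bounded_Lfun2 beta mk kC). Qed.

Section hardy.
Variable f : R -> R.
Hypothesis cf : Ccinfty f.
Let psi x := f x - f 0.
Let k x := omega x * f^`()%classic x ^+ 2 - a ^+ 2 * psi x ^+ 2.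
(* [x^-1 + a * x] is [omega] times the logarithmic derivative of the positive
   supersolution [x * omega x `^ ((a - 1) / 2)] of [L u + a ^+ 2 * u <= 0] on
   the half-line; its junk value at [x = 0] is harmless since [psi 0 = 0]. *)
Let r x := x^-1 + a * x.
Let H x := psi x ^+ 2 * r x * weight beta x.

Let cpsi : continuous psi.
Proof. by move=> x; apply: cvgB; [exact: core_cont|exact: cvg_cst]. Qed.

Let ck : continuous k.
Proof.
move=> x; apply: cvgB.
  by apply: cvgM; [exact: continuous_omega|apply: cvgM; exact: core_cont1].
by apply: cvgMl_tmp; apply: cvgM; exact: cpsi.
Qed.

Let ik : mu.-integrable setT (EFin \o k).
Proof.
have [C hC] : exists C, forall x, `|omega x * f^`()%classic x ^+ 2| <= C.
  apply: compact_supported_bounded; split.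
    by move=> x; apply: cvgM; [exact: continuous_omega|apply: cvgM; exact: core_cont1].
  by have [M [M0 fM]] := core_supp beta cf; exists M; split => // x /fM[_ -> _]; rewrite expr0n mulr0.
have [C' hC'] : exists C, forall x, `|f x| <= C.
  apply: compact_supported_bounded; split; first exact: core_cont.
  by have [M [M0 fM]] := core_supp beta cf; exists M; split => // x /fM[].
apply: (@bounded_integrable _ (C + a ^+ 2 * (C' + C') ^+ 2)).
  exact: continuous_measurable_fun.
move=> x; apply: le_trans (ler_normB _ _) _; apply: lerD; first exact: hC.
rewrite normrM (ger0_norm (sqr_ge0 a)) ler_wpM2l ?sqr_ge0//.
rewrite normrX lerXn2r ?nnegrE//; last by apply: le_trans (ler_normB _ _) (lerD (hC' _) (hC' _)).
by apply: addr_ge0; exact: le_trans (normr_ge0 _) (hC' 0).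
Qed.

Let dH x : x != 0 -> is_derive x 1 H
  (weight beta x * (2 * psi x * f^`()%classic x * r x + psi x ^+ 2 * (- x ^- 2 + a)
    - 2 * beta * x * psi x ^+ 2 * r x / omega x)).
Proof.
move=> x0.
have dpsi : is_derive x 1 psi (f^`()%classic x).
  by apply: isdE (isdB (core_d1 x cf) (isd_cst (f 0) x)) _; rewrite subr0.
have dr : is_derive x 1 r (- x ^- 2 + a).
  by apply: isdE (isdD (isdV x0 (isd_id x)) (isdZ a (isd_id x))) _; rewrite !mulr1.
apply: isdE (isdM (isdM (isd_sqr dpsi) dr) (isd_powR_omega (- beta) x)) _.
rewrite /weight [omega x `^ (- beta)]powR_omegaS.
by field; rewrite gt_eqF ?omega_gt0.
Qed.

(** At 0 the singular part of [H] is [psi h / h * psi h * weight], where [psi h / h] tends to the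
    derivative of [f] and [psi h] to 0. *)
Let cH : continuous H.
Proof.
move=> x; have [->|x0] := eqVneq x 0; last exact: isd_cont (dH x0).
apply/continuous_withinNx.
have -> : H 0 = f^`()%classic 0 * psi 0 * weight beta 0 + psi 0 ^+ 2 * (a * 0) * weight beta 0.
  by rewrite /H /psi subrr expr0n !(mul0r, mulr0) addr0.
have hq : psi h / h @[h --> (0 : R)^'] --> f^`()%classic 0.
  have [d d0] := core_d1 0 cf; move/cvg_ex : d => [l hl].
  have -> : f^`()%classic 0 = l by rewrite -d0; exact: cvg_lim hl.
  apply: cvg_trans hl; apply: near_eq_cvg; near=> h.
  by rewrite /GRing.scale/= mulr1 addr0 mulrC.
rewrite (_ : H = fun h => psi h / h * psi h * weight beta h + psi h ^+ 2 * (a * h) * weight beta h); last first.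
  by apply/funext => h; rewrite /H /r; ring.
have cw : weight beta h @[h --> (0 : R)^'] --> weight beta 0.
  by apply: cvg_within_filter; exact: continuous_weight.
have cp : psi h @[h --> (0 : R)^'] --> psi 0.
  by apply: cvg_within_filter; exact: cpsi.
apply: cvgD; apply: cvgM => //; apply: cvgM => //.
  by apply: cvgM.
by apply: cvgMl_tmp; apply: cvg_within_filter; exact: cvg_id.
Unshelve. all: by end_near. Qed.

(** The primitive of the integrand, corrected by the boundary term of Picone's identity. *)
Let T x := primitive beta k x - Z^-1 * H x.

(** Completing the square in [f'] leaves [psi^2] times a potential. With [2 beta = 2 a + 1], its
    terms in [x^-2] and [x^2] cancel once multiplied by [omega], and the constant
    [2 - a - a^2 = (1 - a) (2 + a)] remains. *)
Let dT x : x != 0 -> is_derive x 1 T (density beta x *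
  (omega x * (f^`()%classic x - psi x * r x / omega x) ^+ 2 +
   psi x ^+ 2 * ((1 - a) * (2 + a) / omega x))).
Proof.
move=> x0.
apply: isdE (isdB (is_derive_primitive hb1 x ck ik) (isdZ Z^-1 (dH x0))) _.
rewrite /k /density /r /omega; field.
rewrite x0 !gt_eqF ?(total_mass_gt0 hb1)//; exact: (omega_gt0 x).
Qed.

Let dT_ge0 x : x != 0 -> 0 <= T^`()%classic x.
Proof.
move=> x0; rewrite (isd_derive1 (dT x0)) mulr_ge0 ?(ltW (density_gt0 hb1 x))//.
rewrite addr_ge0// mulr_ge0 ?sqr_ge0 ?(ltW (omega_gt0 x))//.
rewrite divr_ge0 ?(ltW (omega_gt0 x))// mulr_ge0//; move: hb1 hb2; lra.
Qed.

Let cT : continuous T.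
Proof.
move=> x; apply: cvgB; first exact: isd_cont (is_derive_primitive hb1 x ck ik).
by apply: cvgMl_tmp; exact: cH.
Qed.

Let T_le x y : x <= y -> (0 <= x) || (y <= 0) -> T x <= T y.
Proof.
move=> xy h.
have n0 z : z \in `]x, y[ -> z != 0.
  rewrite in_itv/= => /andP[xz zy]; case/orP : h => h.
    by rewrite gt_eqF// (le_lt_trans h).
  by rewrite lt_eqF// (lt_le_trans zy).
apply: (@ger0_derive1_le_cc _ T x y) => //; rewrite ?in_itv/= ?lexx ?xy//.
- by move=> z /n0 z0; exact: (@ex_derive _ _ _ _ _ _ _ (dT z0)).
- by move=> z /n0; exact: dT_ge0.
- exact: (continuous_subspaceT cT).
Qed.

Lemma core_hardy :
  a ^+ 2 * \int[mu]_x (f x - f 0) ^+ 2 <= \int[mu]_x (omega x * f^`()%classic x ^+ 2).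
Proof.
have hpos : 0 <= \int[mu]_x k x.
  apply: Rintegral_ge0_itv ik _ => n.
  have n0 : 0 <= n%:R :> R by [].
  rewrite -primitiveB//; last by lra.
  have h : T (- n%:R) <= T n%:R.
    by apply: (@le_trans _ _ (T 0)); apply: T_le; rewrite ?oppr_le0 ?lexx ?orbT.
  have a0 : 0 <= a by move: hb1; lra.
  have rn : 0 <= r n%:R by apply: addr_ge0; [rewrite invr_ge0|apply: mulr_ge0].
  have Hn : 0 <= H n%:R.
    by apply: mulr_ge0; [apply: mulr_ge0 => //; exact: sqr_ge0|exact/ltW/weight_gt0].
  have HNn : H (- n%:R) <= 0.
    have rN : r (- n%:R) = - r n%:R by rewrite /r invrN mulrN opprD.
    rewrite /H rN mulrN mulNr oppr_le0.
    by apply: mulr_ge0; [apply: mulr_ge0 => //; exact: sqr_ge0|exact/ltW/weight_gt0].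
  have Z0 : 0 <= Z^-1 by rewrite invr_ge0 ltW// (total_mass_gt0 hb1).
  have := mulr_ge0 Z0 Hn; have := mulr_ge0_le0 Z0 HNn; move: h; rewrite /T.
  by move: (primitive _ _ _) (primitive _ _ _) (Z^-1 * _) (Z^-1 * _) => *; lra.
have [C hC] : exists C, forall x, `|f x| <= C.
  apply: compact_supported_bounded; split; first exact: core_cont.
  by have [M [M0 fM]] := core_supp beta cf; exists M; split => // x /fM[].
have ipsi : mu.-integrable setT (EFin \o (fun x => psi x ^+ 2)).
  apply: (@bounded_integrable _ ((C + C) ^+ 2)).
    by apply: measurable_funX; exact: continuous_measurable_fun.
  move=> x; rewrite normrX lerXn2r ?nnegrE//; last by apply: le_trans (ler_normB _ _) (lerD (hC _) (hC _)).
  by apply: addr_ge0; exact: le_trans (normr_ge0 _) (hC 0).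
have iE : mu.-integrable setT (EFin \o (fun x => omega x * f^`()%classic x ^+ 2)).
  have h := integrableD measurableT ik (integrableZl measurableT (a ^+ 2) ipsi).
  apply: eq_integrable h => //= x _ /=.
  by rewrite -EFinM -EFinD /k subrK.
move: hpos; rewrite RintegralB//; last exact: (integrableZl measurableT (a ^+ 2) ipsi).
by rewrite RintegralZl// subr_ge0.
Qed.

End hardy.

End core_poincare.

(** * The domain of the generator *)

Section generator_graph.
Context {R : realType} (beta : R).
Hypothesis hb1 : 1 / 2 < beta.
Hypothesis hb2 : beta <= 3 / 2.
Local Notation mu := (mu_ beta).
Local Notation Z := (total_mass beta).
Local Notation a := (beta - 1 / 2).
Local Notation V := (LfunType mu (lee1n 2)).
Local Notation ip := (@L2ip _ _ _ mu).
Local Notation nrm := (ip_norm (@L2ip _ _ _ mu)).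
Let Hip := @L2_semi_inner_product _ _ _ mu.
Implicit Types (f g k : R -> R) (x y M C c : R) (u v w p q : V).

Definition core u v : Prop := exists f,
  [/\ Ccinfty f, (u : R -> R) = f & (v : R -> R) = L beta f].

(** [Lbar] read on the elements of [V], where the semi-inner product lives. *)
Definition graph u v : Prop := exists p q : nat -> V,
  [/\ forall n, core (p n) (q n), nrm (p n - u) @[n --> \oo] --> 0 &
      nrm (q n - v) @[n --> \oo] --> 0].

Lemma core_Lfun2 f : Ccinfty f -> f \in Lfun mu 2%:E.
Proof.
move=> cf; apply: compact_supported_Lfun2; split; first exact: core_cont.
by have [M [M0 fM]] := core_supp beta cf; exists M; split => // x /fM[].
Qed.

Definition core_elt f (cf : Ccinfty f) : V := Lfun_Sub (lee1n 2) (core_Lfun2 cf).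

Lemma core_core_elt f (cf : Ccinfty f) : core (core_elt cf) (core_elt (Ccinfty_L beta cf)).
Proof. by exists f. Qed.

Lemma L2cvg_nrm {T : Type} (F : set_system T) {FF : Filter F} (h : T -> R -> R) (k : R -> R)
    (ht : T -> V) u : (\forall t \near F, h t = ht t :> (R -> R)) -> k = u ->
  L2cvg beta F h k <-> nrm (ht t - u) @[t --> F] --> 0.
Proof.
move=> hht ->.
have E : \forall t \near F, L2norm beta (h t \- u) = (nrm (ht t - u))%:E.
  by apply: filterS hht => t ->; rewrite -Lnorm_nrm.
split => [H|H].
  have : fine (L2norm beta (h t \- u)) @[t --> F] --> (0 : R) by exact: fine_cvg H.
  apply: cvg_trans; apply: near_eq_cvg.
  by apply: filterS E => t ->.
have : (nrm (ht t - u))%:E @[t --> F] --> 0%:E by apply: cvg_EFin; [exact: nearW|exact: H].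
apply: cvg_trans; apply: near_eq_cvg.
by apply: filterS E => t ->.
Qed.

Lemma LbarP u v : Lbar beta u v <-> graph u v.
Proof.
split=> [[_ _ [phi [cphi hu hv]]]|[p [q [hpq hp hq]]]].
  exists (fun n => core_elt (cphi n)), (fun n => core_elt (Ccinfty_L beta (cphi n))); split.
  - by move=> n; exact: core_core_elt.
  - by apply/(L2cvg_nrm _ _).1: hu => //; exact: nearW.
  - by apply/(L2cvg_nrm _ _).1: hv => //; exact: nearW.
split; [exact: LfunP|exact: LfunP|].
have /choice[phi hphi] n : exists f, [/\ Ccinfty f, (p n : R -> R) = f & (q n : R -> R) = L beta f].
  exact: hpq.
exists phi; split.
- by move=> n; have [] := hphi n.
- by apply/(L2cvg_nrm _ _).2: hp => //; apply: nearW => n; have [_ -> _] := hphi n.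
- by apply/(L2cvg_nrm _ _).2: hq => //; apply: nearW => n; have [_ _ ->] := hphi n.
Qed.

Lemma coreB u v u' v' : core u v -> core u' v' -> core (u - u') (v - v').
Proof.
move=> [f [cf uf vf]] [g [cg ug vg]]; exists (fun x => f x - g x); split.
- exact: CcinftyB.
- by rewrite -uf -ug.
- have /CcinftyP[sf _] := cf; have /CcinftyP[sg _] := cg.
  by apply/funext => x; rewrite LB// -vf -vg.
Qed.

Lemma ipE u v f g : (u : R -> R) = f -> (v : R -> R) = g -> ip u v = \int[mu]_x (f x * g x).
Proof. by move=> <- <-. Qed.

Lemma L2_integrableM u v : mu.-integrable setT (EFin \o (fun x => u x * v x)).
Proof. exact: integrable_L2M (LfunP u) (LfunP v). Qed.

Lemma core_energy_compact f g : Ccinfty f -> Ccinfty g ->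
  compact_supported (fun x => omega x * f^`()%classic x * g^`()%classic x).
Proof.
move=> cf cg; split.
  move=> x; apply: cvgM; last exact: core_cont1.
  by apply: cvgM; [exact: continuous_omega|exact: core_cont1].
have [M [M0 fM]] := core_supp beta cf; exists M; split => // x /fM[_ -> _].
by rewrite mulr0 mul0r.
Qed.

Lemma core_energy u v' f g : Ccinfty f -> Ccinfty g ->
  (u : R -> R) = f -> (v' : R -> R) = L beta g ->
  ip u v' = - \int[mu]_x (omega x * f^`()%classic x * g^`()%classic x).
Proof.
move=> cf cg uf vg; apply/eqP; rewrite -addr_eq0; apply/eqP.
rewrite -(core_ibp hb1 cf cg) (ipE uf vg) RintegralD//.
- by rewrite -uf -vg; exact: L2_integrableM.
- exact/integrable_Lfun2/compact_supported_Lfun2/core_energy_compact.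
Qed.

Lemma core_symmetric u v u' v' : core u v -> core u' v' -> ip u v' = ip v u'.
Proof.
move=> [f [cf uf vf]] [g [cg ug vg]]; rewrite (ipC Hip v).
rewrite (core_energy cf cg uf vg) (core_energy cg cf ug vf).
by congr (- _); apply: eq_Rintegral => x _; exact: mulrAC.
Qed.

Lemma graph_symmetric u v u' v' : graph u v -> graph u' v' -> ip u v' = ip v u'.
Proof.
move=> [p [q [hpq hp hq]]] [p' [q' [hpq' hp' hq']]].
have h1 : ip (p n) (q' n) @[n --> \oo] --> ip u v' by exact: (cvg_ip Hip hp hq').
have h2 : ip (q n) (p' n) @[n --> \oo] --> ip v u' by exact: (cvg_ip Hip hq hp').
rewrite (_ : (fun n => ip (p n) (q' n)) = fun n => ip (q n) (p' n)) in h1.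
  exact: (norm_cvg_unique h1 h2).
by apply/funext => n; exact: core_symmetric.
Qed.

Lemma cvg_nrm_cst {T : Type} (F : set_system T) {FF : Filter F} v :
  nrm (v - v) @[t --> F] --> 0.
Proof. by rewrite subrr (nrm0 Hip); exact: cvg_cst. Qed.

(** The invariance of [mu]: the mean has zero derivative along the semigroup. *)
Lemma graph_mean u v : graph u v -> ip (L2one mu) v = 0.
Proof.
move=> [p [q [hpq hp hq]]].
have h1 : ip (L2one mu) (q n) @[n --> \oo] --> ip (L2one mu) v.
  by apply: (cvg_ip Hip _ hq); exact: cvg_nrm_cst.
apply: (norm_cvg_unique h1); apply: cvg_near_cst; apply: nearW => n.
by have [f [cf _ qf]] := hpq n; rewrite ip1E qf core_mean_L.
Qed.

(** The second moment about any constant, here [f 0], is at least the variance, so the Hardy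
    inequality applies. *)
Lemma core_variance_le u v : core u v ->
  a ^+ 2 * (ip u u - ip (L2one mu) u ^+ 2) <= - ip u v.
Proof.
move=> [f [cf uf vf]]; rewrite (core_energy cf cf uf vf) opprK.
have := core_hardy hb1 hb2 cf.
rewrite (_ : \int[mu]_x (omega x * f^`()%classic x ^+ 2) =
   \int[mu]_x (omega x * f^`()%classic x * f^`()%classic x)); last first.
  by apply: eq_Rintegral => x _; rewrite expr2 mulrA.
apply: le_trans; rewrite ler_wpM2l ?sqr_ge0//.
have -> : \int[mu]_x (f x - f 0) ^+ 2 = ip (u - f 0 *: L2one mu) (u - f 0 *: L2one mu).
  rewrite -uf; apply: eq_Rintegral => x _.
  by rewrite -[RHS]/((u x - u 0 * 1) * (u x - u 0 * 1)) mulr1 expr2.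
rewrite !(ipBl Hip) !(ipBr Hip) !(ipZl Hip) !(ipZr Hip) (ipC Hip u (L2one mu)).
rewrite -(sqr_nrm Hip (L2one mu)) nrm1.
move: (ip _ u) (ip u u) (f 0) => m s c; rewrite !expr2.
have := sqr_ge0 (m - c); rewrite expr2; nra.
Qed.

Lemma graph_poincare u v : graph u v ->
  a ^+ 2 * (ip u u - ip (L2one mu) u ^+ 2) <= - ip u v.
Proof.
move=> [p [q [hpq hp hq]]].
have h1 : a ^+ 2 * (ip (p n) (p n) - ip (L2one mu) (p n) ^+ 2) @[n --> \oo] -->
    a ^+ 2 * (ip u u - ip (L2one mu) u ^+ 2).
  apply: cvgMl_tmp; apply: cvgB; first exact: (cvg_ip Hip hp hp).
  have h : ip (L2one mu) (p n) @[n --> \oo] --> ip (L2one mu) u.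
    by apply: (cvg_ip Hip _ hp); exact: cvg_nrm_cst.
  by rewrite expr2; under eq_fun do rewrite expr2; exact: cvgM.
have h2 : - ip (p n) (q n) @[n --> \oo] --> - ip u v.
  by apply: cvgN; exact: (cvg_ip Hip hp hq).
apply: (ler_cvg_to h1 h2); apply: nearW => n; exact: core_variance_le.
Qed.

End generator_graph.

(** * First-order regularity on the domain *)

Section graph_regularity.
Context {R : realType} (beta : R).
Hypothesis hb1 : 1 / 2 < beta.
Hypothesis hb2 : beta <= 3 / 2.
Local Notation mu := (mu_ beta).
Local Notation Z := (total_mass beta).
Local Notation a := (beta - 1 / 2).
Local Notation V := (LfunType mu (lee1n 2)).
Local Notation ip := (@L2ip _ _ _ mu).
Local Notation nrm := (ip_norm (@L2ip _ _ _ mu)).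
Let Hip := @L2_semi_inner_product _ _ _ mu.
Implicit Types (f g k : R -> R) (x y M C c K : R) (u v w p q : V).

Lemma integral_itv_abs_le u (A : set R) : measurable A ->
  \int[mu]_(x in A) `|u x| <= nrm u.
Proof.
move=> mA; have iu : mu.-integrable setT (EFin \o u) by exact/integrable_Lfun2/LfunP.
have ia := integrable_norm iu.
rewrite -lee_fin /Rintegral fineK; last first.
  by apply: integrable_fin_num => //; exact: integrableS ia.
apply: le_trans (integral_abs_le_nrm u).
by apply: ge0_subset_integral => //; case/integrableP : ia.
Qed.

Lemma primitive_le v x : `|primitive beta v x| <= nrm v.
Proof.
apply: le_trans (integral_itv_abs_le v (measurable_itv `]-oo, x])).
apply: le_normr_Rintegral => //.
by apply: (integrableS measurableT) => //; exact/integrable_Lfun2/LfunP.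
Qed.

Lemma primitive_sub v w x :
  primitive beta (v - w) x = primitive beta v x - primitive beta w x.
Proof.
rewrite /primitive -RintegralB//.
- by apply: (integrableS measurableT) => //; exact/integrable_Lfun2/LfunP.
- by apply: (integrableS measurableT) => //; exact/integrable_Lfun2/LfunP.
Qed.

(* The derivative of [u] when [L u = v]. *)
Definition flux (v : R -> R) (x : R) : R :=
  Z * omega x `^ (beta - 1) * primitive beta v x.

Lemma flux_sub v w x : flux (v - w) x = flux v x - flux w x.
Proof. by rewrite /flux primitive_sub mulrBr. Qed.

Lemma omega_le x y : `|x| <= `|y| -> omega x <= omega y.
Proof.
move=> xy; rewrite /omega lerD2l -(real_normK (num_real x)) -(real_normK (num_real y)).
by rewrite lerXn2r ?nnegrE.
Qed.

(** The primitive is bounded by an L^1 norm, hence by [nrm v]; since [beta - 1 <= 1] and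
    [omega >= 1], the power of [omega] is at most [omega K]. Pointwise values of derivatives are
    thus controlled in L^2. *)
Lemma flux_le v x K : `|x| <= K -> `|flux v x| <= Z * omega K * nrm v.
Proof.
move=> xK; have K0 : 0 <= K by exact: le_trans xK.
have Z0 := ltW (total_mass_gt0 hb1).
rewrite /flux normrM ler_pM//; last exact: primitive_le.
rewrite normrM (ger0_norm Z0) ler_wpM2l// ger0_norm ?powR_ge0//.
apply: (@le_trans _ _ (omega x)); last by rewrite omega_le// (ger0_norm K0).
rewrite -[leRHS]powRr1 ?(ltW (omega_gt0 x))// ler_powR ?omega_ge1//.
by move: hb2; lra.
Qed.

Lemma core_derive u v f x : Ccinfty f -> (v : R -> R) = L beta f ->
  f^`()%classic x = flux v x.
Proof. by move=> cf vf; rewrite (core_primitive hb1 x cf) /flux vf. Qed.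

Lemma core_lipschitz v f x y K : Ccinfty f -> (v : R -> R) = L beta f ->
  `|x| <= K -> `|y| <= K -> `|f x - f y| <= Z * omega K * nrm v * `|x - y|.
Proof.
move=> cf vf; wlog xy : x y / x <= y.
  move=> h; have [/h//|/ltW/h {}h xK yK] := leP x y.
  by rewrite distrC (distrC x); exact: h.
move=> xK yK; rewrite distrC (distrC x).
have [||c cxy ->] := @MVT_segment _ f f^`()%classic x y xy.
- by move=> z _; exact: core_d1.
- by apply: continuous_subspaceT; exact: core_cont.
rewrite normrM ler_wpM2r// (core_derive v c cf vf) flux_le//.
move: cxy xK yK; rewrite in_itv/= => /andP[xc cy].
by rewrite !ler_norml => /andP[h1 h2] /andP[h3 h4]; apply/andP; split; lra.
Qed.

(** L^2 controls averages only. For [y] in []- K, K[], [|f x|] is at most [|f y|] plus the Lipschitz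
    bound over a distance [2 K]; integrating over [y] and dividing by the mass [m] of the interval
    gives the estimate. *)
Lemma core_pointwise K : 0 < K -> exists C, 0 <= C /\ forall u v f x,
  Ccinfty f -> (u : R -> R) = f -> (v : R -> R) = L beta f -> `|x| <= K ->
  `|f x| <= C * (nrm u + nrm v).
Proof.
move=> K0; have hm := mu_itvoo_gt0 hb1 0 K0; rewrite sub0r add0r in hm.
pose I : set R := [set` `]- K, K[].
pose m := fine (mu I).
have mI : measurable I by exact: measurable_itv.
have m0 : 0 < m.
  by rewrite /m fine_gt0// hm/=; apply: le_lt_trans (ltry 1); exact: probability_le1.
have Z0 := total_mass_gt0 hb1.
pose D := Z * omega K * (2 * K).
have D0 : 0 <= D by rewrite !mulr_ge0 ?(ltW Z0) ?(ltW (omega_gt0 _)) ?(ltW K0).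
exists (m^-1 + D); split; first by rewrite addr_ge0 ?invr_ge0 ?(ltW m0).
move=> u v f x cf uf vf xK.
have icst c : mu.-integrable I (EFin \o (fun=> c)).
  by apply: (integrableS measurableT) => //; exact: (integrable_Lfun2 (Lfun2_cst mu c)).
have iu : mu.-integrable I (EFin \o (fun y => `|u y|)).
  apply: (integrableS measurableT) => //; apply: (@integrable_norm _ _ _ mu setT u).
  exact/integrable_Lfun2/LfunP.
have h : `|f x| * m <= nrm u + D * nrm v * m.
  rewrite -!Rintegral_cst//.
  apply: (@le_trans _ _ (\int[mu]_(y in I) (`|u y| + D * nrm v))).
    apply: le_Rintegral => //.
      by have := integrableD mI iu (icst (D * nrm v)).
    move=> y; rewrite /I /= in_itv/= -ltr_norml => /ltW yK.
    rewrite uf -lerBlDl; apply: le_trans (lerB_dist _ _) _.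
    apply: le_trans (core_lipschitz cf vf xK yK) _.
    rewrite /D mulrAC ler_wpM2r ?nrm_ge0//.
    rewrite ler_wpM2l ?mulr_ge0 ?(ltW Z0) ?(ltW (omega_gt0 _))//.
    by apply: le_trans (ler_normB _ _) _; move: xK yK; lra.
  rewrite RintegralD// lerD2r.
  exact: integral_itv_abs_le.
rewrite -(ler_pM2r m0); apply: le_trans h _.
have -> : (m^-1 + D) * (nrm u + nrm v) * m =
   nrm u + D * nrm v * m + (nrm v + D * nrm u * m) by field; rewrite gt_eqF.
rewrite lerDl; apply: addr_ge0; first exact: nrm_ge0.
by apply: mulr_ge0; [apply: mulr_ge0 => //; exact: nrm_ge0|exact: ltW].
Qed.

Lemma nrm_small (g : V) : (forall e, 0 < e -> nrm g <= e) -> nrm g = 0.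
Proof.
move=> h; apply/eqP; rewrite eq_le nrm_ge0 andbT leNgt; apply/negP => g0.
by have := h (nrm g / 2); rewrite divr_gt0// => /(_ isT); move: g0; move: (nrm g) => *; lra.
Qed.

(** Fatou's lemma on the tails of [p n - u] puts [f - u] within every [e > 0] of zero. *)
Lemma L2_cvg_pointwise (p : nat -> V) u f : measurable_fun setT f ->
  (forall x, p n x @[n --> \oo] --> f x) -> nrm (p n - u) @[n --> \oo] --> 0 ->
  (u : R -> R) = f %[ae mu].
Proof.
move=> mf pf pu.
have key e : 0 < e -> exists g : V, g = (fun x => f x - u x) :> (R -> R) /\ nrm g <= e.
  move=> e0; have /cvgrPdist_le/(_ _ e0) [N _ hN] := pu.
  apply: (@L2_fatou _ _ _ mu (fun n => p (n + N)%N - u)).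
  - by apply: measurable_funB => //; exact/measurable_Lfun2/LfunP.
  - apply: aeW => x; apply: (@cvgB _ _ _ _ _ (fun n => p (n + N)%N x)).
      by rewrite (cvg_shiftn N (p ^~ x)).
    exact: cvg_cst.
  - move=> n; have := hN (n + N)%N; rewrite /= leq_addl => /(_ isT).
    by rewrite sub0r normrN ger0_norm// nrm_ge0.
have [g [gE _]] := key 1 ltr01.
have g0 : nrm (g - 0) = 0.
  rewrite subr0; apply: nrm_small => e /key [g' [g'E]].
  have -> // : g = g'; apply/LfuneqP => x.
  by rewrite [LHS](congr1 (fun h : R -> R => h x) gE) [RHS](congr1 (fun h : R -> R => h x) g'E).
have := nrm0_ae g0; apply: filterS => x /= + _ => /(_ I).
rewrite [LHS](congr1 (fun h : R -> R => h x) gE) => /eqP.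
by rewrite subr_eq0 => /eqP.
Qed.

(** The approximants [phi n] are pointwise Cauchy, and [phi n - f] is locally Lipschitz with a
    constant proportional to [nrm (q n - v)]. The difference quotients of [f] are therefore
    uniformly close to those of [phi n], while [flux (q n)] is close to [flux v]. *)
Lemma graph_regular u v : graph u v -> exists f,
  (forall x, is_derive x 1 f (flux v x)) /\ (u : R -> R) = f %[ae mu].
Proof.
move=> [p [q [hpq hp hq]]].
have /choice[phi hphi] n : exists f, [/\ Ccinfty f, (p n : R -> R) = f & (q n : R -> R) = L beta f].
  exact: hpq.
have cphi n : Ccinfty (phi n) by have [] := hphi n.
have pE n : (p n : R -> R) = phi n by have [] := hphi n.
have qE n : (q n : R -> R) = L beta (phi n) by have [] := hphi n.
have hB n m : [/\ Ccinfty (fun x => phi n x - phi m x), (p n - p m : R -> R) = (fun x => phi n x - phi m x)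
   & ((q n - q m : V) : R -> R) = L beta (fun x => phi n x - phi m x)].
  split; first exact: CcinftyB.
    by rewrite -(pE n) -(pE m).
  have /CcinftyP[s1 _] := cphi n; have /CcinftyP[s2 _] := cphi m.
  by apply/funext => x; rewrite LB// -(qE n) -(qE m).
pose E n := nrm (p n - u) + nrm (q n - v).
have hE : E n @[n --> \oo] --> (0 : R) by rewrite -[X in _ --> X]addr0; exact: cvgD.
have E0 n : 0 <= E n by rewrite addr_ge0 ?nrm_ge0.
have hpE n m : nrm (p n - p m) + nrm (q n - q m) <= E n + E m.
  have h1 := ler_nrm_distD Hip u (p n) (p m); have h2 := ler_nrm_distD Hip v (q n) (q m).
  rewrite (nrm_distC Hip u) in h1; rewrite (nrm_distC Hip v) in h2.
  by move: h1 h2; rewrite /E; move: (nrm _) (nrm _) (nrm _) (nrm _) (nrm _) (nrm _) => *; lra.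
have cv x : cvgn (phi ^~ x).
  have K0 : 0 < `|x| + 1 by rewrite ltr_wpDl.
  have [C [C0 hC]] := core_pointwise K0.
  apply/cauchy_cvgP/cauchy_exP => e e0.
  have C1 : 0 < C + 1 by rewrite ltr_wpDl.
  have /cvgrPdist_lt/(_ (e / 2 / (C + 1))) : E n @[n --> \oo] --> (0 : R) by [].
  rewrite !divr_gt0// => /(_ isT)[N _ hN].
  exists (phi N x); exists N => // n /= Nn.
  have [c1 c2 c3] := hB N n.
  rewrite /ball/=; apply: le_lt_trans (hC _ _ _ x c1 c2 c3 _) _; first by rewrite lerDl.
  have hE' (k : nat) : (N <= k)%N -> E k * (C + 1) < e / 2.
    by move=> Nk; have := hN k Nk; rewrite /= sub0r normrN (ger0_norm (E0 k)) ltr_pdivlMr.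
  have e1 := hE' _ Nn; have e2 := hE' _ (leqnn N).
  apply: (@le_lt_trans _ _ ((C + 1) * (E N + E n))).
    apply: ler_pM; [exact: C0|by rewrite addr_ge0 ?nrm_ge0|by rewrite lerDl|exact: hpE].
  by move: e1 e2; move: (E N) (E n) => x1 x2; lra.
pose f x := limn (phi ^~ x).
have cvf x : phi n x @[n --> \oo] --> f x by exact: cv.
(* Obtained from the Lipschitz bound for [phi n - phi m] by letting [m] tend to infinity. *)
have lip n x y K : `|x| <= K -> `|y| <= K ->
  `|(phi n y - f y) - (phi n x - f x)| <= Z * omega K * nrm (q n - v) * `|y - x|.
  move=> xK yK.
  have h1 : `|(phi n y - phi m y) - (phi n x - phi m x)| @[m --> \oo] -->
      `|(phi n y - f y) - (phi n x - f x)|.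
    apply: cvg_norm; apply: cvgB; apply: cvgB; first [exact: cvg_cst|exact: cvf].
  have h2 : Z * omega K * (nrm (q n - v) + nrm (q m - v)) * `|y - x| @[m --> \oo] -->
      Z * omega K * (nrm (q n - v) + 0) * `|y - x|.
    by apply: cvgMr_tmp; apply: cvgMl_tmp; apply: cvgD; [exact: cvg_cst|exact: hq].
  rewrite addr0 in h2.
  apply: (ler_cvg_to h1 h2); apply: nearW => m.
  have [c1 _ c3] := hB n m.
  apply: le_trans (core_lipschitz c1 c3 yK xK) _.
  rewrite ler_wpM2r// ler_wpM2l ?mulr_ge0 ?(ltW (total_mass_gt0 hb1)) ?(ltW (omega_gt0 _))//.
  by rewrite (nrm_distC Hip (q m)); exact: ler_nrm_distD.
have df x : is_derive x 1 f (flux v x).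
  suff h : h^-1 *: (f (h *: 1 + x) - f x) @[h --> (0 : R)^'] --> flux v x.
    by apply: DeriveDef; [apply/cvg_ex; eexists; exact: h|exact: cvg_lim h].
  apply/cvgrPdist_le => e e0.
  pose K := `|x| + 1; pose B := Z * omega K.
  have B0 : 0 < B by rewrite mulr_gt0 ?(total_mass_gt0 hb1) ?omega_gt0.
  (* The error [e] splits into [e / 2] for the quotient of the fixed [phi n], [e / 4] for that of
     [phi n - f] and [e / 4] for the flux. *)
  have /cvgrPdist_lt/(_ (e / 4 / B)) : nrm (q n - v) @[n --> \oo] --> (0 : R) by [].
  rewrite !divr_gt0// => /(_ isT)[n _ /(_ n (leqnn n))].
  rewrite sub0r normrN ger0_norm ?nrm_ge0// ltr_pdivlMr// => hn.
  have [dphi dphiE] := core_d1 x (cphi n).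
  have hq' : h^-1 *: (phi n (h *: 1 + x) - phi n x) @[h --> (0 : R)^'] --> (phi n)^`()%classic x.
    move/cvg_ex : dphi => [l hl].
    by have -> : (phi n)^`()%classic x = l by rewrite -dphiE; exact: cvg_lim hl.
  have e2 : 0 < e / 2 by rewrite divr_gt0.
  move/cvgrPdist_le : hq' => /(_ _ e2) hq'.
  near=> h.
  have h0 : h != 0 by near: h; exact: nbhs_dnbhs_neq.
  have h1 : `|h| < 1 by near: h; exact: dnbhs0_lt.
  have H1 : `|(phi n)^`()%classic x - h^-1 *: (phi n (h *: 1 + x) - phi n x)| <= e / 2.
    by near: h.
  move: H1; rewrite /GRing.scale/= mulr1 => H1.
  have xK : `|x| <= K by rewrite /K lerDl.
  have hxK : `|h + x| <= K.
    by apply: le_trans (ler_normD _ _) _; rewrite /K addrC lerD2l ltW.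
  have H2 := lip n x (h + x) K xK hxK.
  rewrite addrK in H2.
  have H3 : `|flux (q n) x - flux v x| <= B * nrm (q n - v).
    by rewrite -flux_sub; exact: flux_le.
  have H4 : `|h^-1 * ((phi n (h + x) - f (h + x)) - (phi n x - f x))| <= B * nrm (q n - v).
    rewrite normrM normfV mulrC ler_pdivrMr ?normr_gt0//; exact: H2.
  rewrite -(core_derive (q n) x (cphi n) (qE n)) in H3.
  have -> : flux v x - h^-1 * (f (h + x) - f x) =
     ((phi n)^`()%classic x - h^-1 * (phi n (h + x) - phi n x))
     + h^-1 * ((phi n (h + x) - f (h + x)) - (phi n x - f x))
     - ((phi n)^`()%classic x - flux v x) by ring.
  apply: le_trans (ler_normB _ _) _; apply: le_trans (lerD (ler_normD _ _) (lexx _)) _.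
  have : B * nrm (q n - v) <= e / 4 by rewrite mulrC ltW.
  by move: H1 H3 H4; move: (`|_|) (`|_|) (`|_|) (B * _) => *; lra.
exists f; split => //.
apply: (@L2_cvg_pointwise p) => //.
  by apply: continuous_measurable_fun => x; exact: isd_cont (df x).
move=> x; rewrite (_ : (fun n => p n x) = phi ^~ x); first exact: cvf.
by apply/funext => n; rewrite -pE.
Unshelve. all: by end_near. Qed.

End graph_regularity.

(** * Second-order regularity and the integrated identity *)

Section graph_second_order.
Context {R : realType} (beta : R).
Hypothesis hb1 : 1 / 2 < beta.
Hypothesis hb2 : beta <= 3 / 2.
Local Notation mu := (mu_ beta).
Local Notation Z := (total_mass beta).
Local Notation a := (beta - 1 / 2).
Local Notation V := (LfunType mu (lee1n 2)).
Local Notation ip := (@L2ip _ _ _ mu).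
Local Notation nrm := (ip_norm (@L2ip _ _ _ mu)).
Let Hip := @L2_semi_inner_product _ _ _ mu.
Implicit Types (f g k : R -> R) (x y M C c K : R) (u v w p q s : V).

Lemma primitive_ae f g x : measurable_fun setT f -> measurable_fun setT g ->
  f = g %[ae mu] -> primitive beta f x = primitive beta g x.
Proof.
move=> mf mg fg; rewrite /primitive /Rintegral; congr fine.
apply: ae_eq_integral => //.
- by apply/measurable_EFinP/measurable_funTS.
- by apply/measurable_EFinP/measurable_funTS.
- by apply: filterS fg => y /= h _; rewrite h.
Qed.

Lemma ae_Lfun2 u f : measurable_fun setT f -> (u : R -> R) = f %[ae mu] -> f \in Lfun mu 2%:E.
Proof.
move=> mf uf; apply: Lfun2P => //.
rewrite (_ : (\int[mu]_x (f x ^+ 2)%:E)%E = (\int[mu]_x (u x ^+ 2)%:E)%E).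
  by rewrite integral_L2sqr ltry.
apply: ae_eq_integral => //.
- by apply/measurable_EFinP; exact: measurable_funX.
- by apply/measurable_EFinP; apply: measurable_funX; exact/measurable_Lfun2/LfunP.
- by apply: filterS uf => y /= h _; rewrite h.
Qed.

Lemma is_derive_flux g x : continuous g -> g \in Lfun mu 2%:E ->
  is_derive x 1 (flux beta g) ((2 * (beta - 1) * x * flux beta g x + g x) / omega x).
Proof.
move=> cg lg; have h := is_derive_primitive hb1 x cg (integrable_Lfun2 lg).
apply: isdE (isdM (isdZ Z (isd_powR_omega (beta - 1) x)) h) _.
have Z0 := total_mass_gt0 hb1; have w0 := omega_gt0 x.
rewrite /flux /density /weight [omega x `^ (beta - 1)]powR_omegaS.
have -> : omega x `^ (- beta) = (omega x ^+ 2 * omega x `^ (beta - 1 - 1))^-1.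
  rewrite -[omega x ^+ 2]powR_mulrn ?(ltW w0)// -powR_omegaD -powRN; congr (_ `^ _); ring.
by field; rewrite !gt_eqF ?powR_omega_gt0.
Qed.

(** Bootstrapping: since [v] is also in the domain it has a continuous version [g]. The flux ignores
    null sets, so the derivative of [f] is the flux of [g], which is differentiable. *)
Lemma graph_C2 u v w : graph u v -> graph v w -> exists f g,
  [/\ C2 f, (u : R -> R) = f %[ae mu], (v : R -> R) = g %[ae mu] &
      forall x, f^`()%classic x = flux beta v x /\
        omega x * f^`(2)%classic x = 2 * (beta - 1) * x * f^`()%classic x + g x].
Proof.
move=> uv vw.
have [f [df uf]] := graph_regular hb1 hb2 uv.
have [g [dg vg]] := graph_regular hb1 hb2 vw.
have cg : continuous g by move=> x; exact: isd_cont (dg x).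
have mg : measurable_fun setT g by exact: continuous_measurable_fun.
have lg : g \in Lfun mu 2%:E by exact: ae_Lfun2 mg vg.
have fluxE x : flux beta v x = flux beta g x.
  rewrite /flux (primitive_ae _ _ mg)//; exact/measurable_Lfun2/LfunP.
have f'E : f^`()%classic = flux beta g.
  by apply/funext => x; rewrite (isd_derive1 (df x)).
have f''E x : f^`(2)%classic x = (2 * (beta - 1) * x * flux beta g x + g x) / omega x.
  by rewrite derive1nS derive1n1 f'E; exact: (isd_derive1 (is_derive_flux x cg lg)).
exists f, g; split => //.
  split.
  - by move=> x; exact: (@ex_derive _ _ _ _ _ _ _ (df x)).
  - by move=> x; rewrite f'E; exact: (@ex_derive _ _ _ _ _ _ _ (is_derive_flux x cg lg)).
  - rewrite (funext f''E) => x; apply: cvgM.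
      apply: cvgD; last exact: cg.
      apply: cvgM; first by apply: cvgMl_tmp; exact: cvg_id.
      exact: isd_cont (is_derive_flux x cg lg).
    by apply: cvgV; [rewrite gt_eqF ?omega_gt0|exact: continuous_omega].
move=> x; rewrite f''E f'E fluxE; split => //.
by rewrite mulrC divfK// gt_eqF// omega_gt0.
Qed.

Lemma nrm_le u v : (forall x, `|u x| <= `|v x|) -> nrm u <= nrm v.
Proof.
move=> uv; apply: ler_wsqrtr; apply: le_Rintegral => //; [exact: L2_integrableM|exact: L2_integrableM|].
by move=> x _; rewrite -!expr2 -(real_normK (num_real (u x))) -(real_normK (num_real (v x))) lerXn2r ?nnegrE.
Qed.

(** When [L u = v], its square is [omega u'^2], the carre du champ of [u]. *)
Definition energy_density (v : R -> R) x : R := omega x `^ (1 / 2) * flux beta v x.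

Lemma energy_densityB v w x :
  energy_density (v - w) x = energy_density v x - energy_density w x.
Proof. by rewrite /energy_density flux_sub mulrBr. Qed.

Lemma sqrt_omega x : omega x `^ (1 / 2) ^+ 2 = omega x.
Proof.
rewrite expr2 -powR_omegaD (_ : 1 / 2 + 1 / 2 = 1); last by field.
by rewrite powRr1// ltW// omega_gt0.
Qed.

Lemma norm_energy_density v x :
  `|x * flux beta v x| <= `|energy_density v x| /\ `|flux beta v x| <= `|energy_density v x|.
Proof.
have E : energy_density v x ^+ 2 = omega x * flux beta v x ^+ 2.
  by rewrite exprMn sqrt_omega.
split; rewrite -ler_sqr ?nnegrE// !real_normK ?num_real// E.
  by rewrite exprMn ler_wpM2r ?sqr_ge0// lerDr.
by rewrite ler_peMl ?sqr_ge0// omega_ge1.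
Qed.

Lemma core_compact f k : Ccinfty f -> continuous k ->
  compact_supported (fun x => k x * f^`()%classic x).
Proof.
move=> cf ck; split; first by move=> x; apply: cvgM; [exact: ck|exact: core_cont1].
by have [M [M0 fM]] := core_supp beta cf; exists M; split => // x /fM[_ -> _]; rewrite mulr0.
Qed.

Lemma core_energy_density u v : core u v -> exists s : V,
  s = energy_density v :> (R -> R) /\ nrm s ^+ 2 = - ip u v.
Proof.
move=> [f [cf uf vf]].
have sE : energy_density v = fun x => omega x `^ (1 / 2) * f^`()%classic x.
  by apply/funext => x; rewrite (core_derive hb1 v x cf vf).
have ls : energy_density v \in Lfun mu 2%:E.
  rewrite sE; apply: compact_supported_Lfun2; apply: core_compact => // x.
  exact: isd_cont (isd_powR_omega _ x).
exists (Lfun_Sub (lee1n 2) ls); split => //.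
rewrite (core_energy hb1 cf cf uf vf) opprK (sqr_nrm Hip).
apply: eq_Rintegral => x _ /=; rewrite sE.
by rewrite -[in RHS](sqrt_omega x); ring.
Qed.

Lemma LfunE u v : (forall x, u x = v x) -> u = v.
Proof. by move=> uv; exact/LfuneqP. Qed.

(** The squared distance of two terms is [- ip (p n - p m) (q n - q m)], at most a product of two
    Cauchy distances. The pointwise limit is known because the flux at a point is continuous in [v];
    Fatou's lemma makes it the L^2 limit. *)
Lemma graph_energy_density (p q : nat -> V) u v : (forall n, core (p n) (q n)) ->
  nrm (p n - u) @[n --> \oo] --> 0 -> nrm (q n - v) @[n --> \oo] --> 0 ->
  exists (s : nat -> V) (s0 : V),
    [/\ forall n, s n = energy_density (q n) :> (R -> R),
        s0 = energy_density v :> (R -> R) & nrm (s n - s0) @[n --> \oo] --> 0].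
Proof.
move=> hpq hp hq.
have /choice[s hs] n : exists s : V, s = energy_density (q n) :> (R -> R).
  by have [s [sE _]] := core_energy_density (hpq n); exists s.
have ss n m : nrm (s n - s m) ^+ 2 <= nrm (p n - p m) * nrm (q n - q m).
  have [g [gE]] := core_energy_density (coreB (hpq n) (hpq m)).
  have -> : s n - s m = g.
    apply: LfunE => x; rewrite [RHS](congr1 (fun h : R -> R => h x) gE) energy_densityB.
    by rewrite -!hs.
  move=> ->; apply: le_trans (ler_norm _) _; rewrite normrN; exact: ler_ip.
have flux_cvg x : energy_density (q n) x @[n --> \oo] --> energy_density v x.
  apply/cvgrPdist_le => e e0.
  pose B := omega x `^ (1 / 2) * (Z * omega x).
  have B0 : 0 < B by rewrite !mulr_gt0 ?powR_omega_gt0 ?(total_mass_gt0 hb1) ?omega_gt0.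
  move/cvgrPdist_le : hq => /(_ (e / B)); rewrite divr_gt0// => /(_ isT).
  apply: filterS => n; rewrite sub0r normrN ger0_norm ?nrm_ge0// => hn.
  rewrite distrC -energy_densityB /energy_density normrM ger0_norm ?powR_ge0//.
  apply: (@le_trans _ _ (B * nrm (q n - v))).
    rewrite /B -mulrA ler_wpM2l ?powR_ge0//.
    have := flux_le hb1 hb2 (q n - v) (lexx `|x|).
    by have -> : omega `|x| = omega x by rewrite /omega real_normK ?num_real.
  by rewrite -ler_pdivlMl// mulrC.
have ms n : measurable_fun setT (energy_density (q n)).
  by rewrite -hs; exact/measurable_Lfun2/LfunP.
have mv : measurable_fun setT (energy_density v).
  by apply: (@measurable_fun_cvg _ _ _ setT (fun n => energy_density (q n))) => // x _; exact: flux_cvg.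
have key e : 0 < e -> exists N, forall n, (N <= n)%N ->
    exists g : V, g = (fun x => energy_density (q n) x - energy_density v x) :> (R -> R) /\ nrm g <= e.
  move=> e0; have e2 : 0 < e / 2 by rewrite divr_gt0.
  have /cvgrPdist_le/(_ _ e2) [N1 _ hN1] := hp.
  have /cvgrPdist_le/(_ _ e2) [N2 _ hN2] := hq.
  have hN1' (n : nat) : (maxn N1 N2 <= n)%N -> nrm (p n - u) <= e / 2.
    rewrite geq_max => /andP[h _].
    by have := hN1 n h; rewrite /= sub0r normrN (ger0_norm (nrm_ge0 _ _)).
  have hN2' (n : nat) : (maxn N1 N2 <= n)%N -> nrm (q n - v) <= e / 2.
    rewrite geq_max => /andP[_ h].
    by have := hN2 n h; rewrite /= sub0r normrN (ger0_norm (nrm_ge0 _ _)).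
  exists (maxn N1 N2) => n hn; rewrite -(hs n).
  have sv x : s m x @[m --> \oo] --> energy_density v x.
    rewrite (_ : (fun m => s m x) = fun m => energy_density (q m) x); first exact: flux_cvg.
    by apply/funext => m; rewrite -hs.
  apply: (@L2_fatou _ _ _ mu (fun m => s n - s (m + maxn N1 N2)%N)).
  - by apply: measurable_funB => //; exact/measurable_Lfun2/LfunP.
  - apply: aeW => x; apply: (@cvgB _ _ _ _ _ (fun=> s n x) (fun m => s (m + maxn N1 N2)%N x)).
      exact: cvg_cst.
    by rewrite (cvg_shiftn (maxn N1 N2) (fun m => s m x)).
  - move=> m; rewrite -ler_sqr ?nnegrE ?nrm_ge0 ?(ltW e0)//.
    apply: le_trans (ss _ _) _; rewrite expr2.
    have hm : (maxn N1 N2 <= m + maxn N1 N2)%N by rewrite leq_addl.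
    apply: ler_pM; rewrite ?nrm_ge0//.
      apply: le_trans (ler_nrm_distD Hip u _ _) _; rewrite (nrm_distC Hip u) [leRHS]splitr.
      by apply: lerD; exact: hN1'.
    apply: le_trans (ler_nrm_distD Hip v _ _) _; rewrite (nrm_distC Hip v) [leRHS]splitr.
    by apply: lerD; exact: hN2'.
have [N0 hN0] := key 1 ltr01; have [g [gE _]] := hN0 _ (leqnn N0).
(* This element has [energy_density v] as its function, whose square integrability is known only
   through the difference [g]. *)
exists s, (s N0 - g).
have s0E x : (s N0 - g) x = energy_density v x.
  rewrite -[LHS]/(s N0 x - g x) [X in _ - X](congr1 (fun h : R -> R => h x) gE) -(hs N0).
  by rewrite subKr.
split => //; first exact/funext.
apply/cvgrPdist_le => e /key [N hN]; exists N => // n /= /hN [g' [g'E hg']].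
rewrite sub0r normrN (ger0_norm (nrm_ge0 _ _)).
suff -> : s n - (s N0 - g) = g' by [].
apply: LfunE => x; rewrite [RHS](congr1 (fun h : R -> R => h x) g'E) -s0E -(hs n).
by [].
Qed.

Lemma weaker_energy_density s v k : measurable_fun setT k ->
  s = energy_density v :> (R -> R) -> (forall x, `|k x| <= `|energy_density v x|) ->
  exists t : V, t = k :> (R -> R).
Proof.
move=> mk sE kv; have lk : k \in Lfun mu 2%:E.
  by apply: (le_Lfun2 mk (LfunP s)) => x; rewrite sE.
by exists (Lfun_Sub (lee1n 2) lk).
Qed.

Lemma measurable_flux s v : s = energy_density v :> (R -> R) -> measurable_fun setT (flux beta v).
Proof.
move=> sE; rewrite (_ : flux beta v = fun x => omega x `^ (- (1 / 2)) * s x).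
  by apply: measurable_funM; [exact: measurable_omega|exact/measurable_Lfun2/LfunP].
apply/funext => x; rewrite sE /energy_density mulrA -powR_omegaD addNr.
by rewrite powRr0 mul1r.
Qed.

(* [2 a t v + a d^2 + 2 a^2 t^2] and [u v + d^2 + t^2], where [d] is the
   derivative of [u] and [t = x d], have mean [0]; the claim is the first
   identity minus [a ^+ 2] times the second. *)
Lemma core_Gamma2_identity u v (d t : V) : core u v ->
  d = flux beta v :> (R -> R) -> t = (fun x => x * flux beta v x) :> (R -> R) ->
  ip (v + a *: t) (v + a *: t) + a * (1 - a) * ip d d = ip v v + a ^+ 2 * ip u v.
Proof.
move=> [f [cf uf vf]] dE tE.
have dE' x : f^`()%classic x = d x by rewrite dE (core_derive hb1 v x cf vf).
have tE' x : x * f^`()%classic x = t x by rewrite tE (core_derive hb1 v x cf vf).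
have I1 : 2 * a * ip t v + (a * ip d d + 2 * a ^+ 2 * ip t t) = 0.
  rewrite -(core_Gamma2 hb1 cf) /L2ip -!RintegralZl//; try exact: L2_integrableM.
  have iz c p q : mu.-integrable setT (EFin \o (fun x => c * (p x * q x))).
    exact: (integrableZl measurableT c (L2_integrableM p q)).
  rewrite -!RintegralD//; last first.
    exact: (integrableD measurableT (iz a d d) (iz (2 * a ^+ 2) t t)).
  apply: eq_Rintegral => x _ /=; rewrite -tE' -dE' vf; ring.
have I2 : ip u v + (ip d d + ip t t) = 0.
  rewrite (core_energy hb1 cf cf uf vf) /L2ip -RintegralD; try exact: L2_integrableM; last by [].
  rewrite addrC; apply/eqP; rewrite subr_eq0; apply/eqP.
  by apply: eq_Rintegral => x _ /=; rewrite -tE' -dE' /omega; ring.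
rewrite !(ipDl Hip) !(ipDr Hip) !(ipZl Hip) !(ipZr Hip) (ipC Hip v t).
move: I1 I2; move: (ip t v) (ip d d) (ip t t) (ip u v) (ip v v) => A B D E G I1 I2.
have -> : E = - (B + D) by apply/eqP; rewrite -addr_eq0 I2.
have h : 2 * a * A = - (a * B + 2 * a ^+ 2 * D) by apply/eqP; rewrite -addr_eq0 I1.
transitivity (G + 2 * a * A + a ^+ 2 * D + a * (1 - a) * B); first by ring.
by rewrite h; ring.
Qed.

Lemma cvg_nrm_le (s t : nat -> V) (s0 t0 : V) :
  (forall n x, `|t n x - t0 x| <= `|s n x - s0 x|) ->
  nrm (s n - s0) @[n --> \oo] --> 0 -> nrm (t n - t0) @[n --> \oo] --> 0.
Proof.
move=> ts hs; apply: (squeeze_cvgr _ (cvg_cst 0) hs); apply: nearW => n.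
by rewrite nrm_ge0; apply: nrm_le => x; exact: ts.
Qed.

(** [u'] and [x u'] are linear in [v] and dominated by the energy density, so they inherit its L^2
    convergence, and every term of the identity on test functions passes to the limit. *)
Lemma graph_Gamma2 u v : graph u v -> exists (d t : V),
  [/\ d = flux beta v :> (R -> R), t = (fun x => x * flux beta v x) :> (R -> R) &
  ip (v + a *: t) (v + a *: t) + a * (1 - a) * ip d d = ip v v + a ^+ 2 * ip u v].
Proof.
move=> [p [q [hpq hp hq]]].
have [s [s0 [sE s0E hs]]] := graph_energy_density hpq hp hq.
have elts w (r : V) : r = energy_density w :> (R -> R) -> exists dt : V * V,
    dt.1 = flux beta w :> (R -> R) /\ dt.2 = (fun x => x * flux beta w x) :> (R -> R).
  move=> rE; have mf := measurable_flux rE.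
  have [d dE] := weaker_energy_density mf rE (fun x => (norm_energy_density w x).2).
  have mt : measurable_fun setT (fun x => x * flux beta w x) by exact: measurable_funM.
  have [t tE] := weaker_energy_density mt rE (fun x => (norm_energy_density w x).1).
  by exists (d, t).
have [[d t] /= [dE tE]] := elts _ _ s0E.
have /choice[dt hdt] n := elts _ _ (sE n).
have hd : nrm ((dt n).1 - d) @[n --> \oo] --> 0.
  apply: cvg_nrm_le hs => n x; rewrite (hdt n).1 dE sE s0E -flux_sub -energy_densityB.
  exact: (norm_energy_density _ _).2.
have ht : nrm ((dt n).2 - t) @[n --> \oo] --> 0.
  apply: cvg_nrm_le hs => n x; rewrite (hdt n).2 tE sE s0E -mulrBr -flux_sub -energy_densityB.
  exact: (norm_energy_density _ _).1.
exists d, t; split => //.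
have hvt : nrm ((q n + a *: (dt n).2) - (v + a *: t)) @[n --> \oo] --> 0.
  have h : nrm (q n - v) + `|a| * nrm ((dt n).2 - t) @[n --> \oo] --> (0 + `|a| * 0 : R).
    by apply: cvgD => //; exact: cvgMl_tmp.
  rewrite mulr0 addr0 in h.
  apply: (squeeze_cvgr _ (cvg_cst 0) h); apply: nearW => n; rewrite nrm_ge0/=.
  by rewrite opprD addrACA -scalerBr -(nrmZ Hip); exact: ler_nrmD.
have h1 : ip (q n + a *: (dt n).2) (q n + a *: (dt n).2) + a * (1 - a) * ip (dt n).1 (dt n).1
    @[n --> \oo] --> ip (v + a *: t) (v + a *: t) + a * (1 - a) * ip d d.
  by apply: cvgD; [exact: (cvg_ip Hip)|apply: cvgMl_tmp; exact: (cvg_ip Hip)].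
have h2 : ip (q n) (q n) + a ^+ 2 * ip (p n) (q n) @[n --> \oo] --> ip v v + a ^+ 2 * ip u v.
  by apply: cvgD; [exact: (cvg_ip Hip hq hq)|apply: cvgMl_tmp; exact: (cvg_ip Hip hp hq)].
rewrite (_ : (fun n => _ + _ * ip _.1 _.1) = (fun n => ip (q n) (q n) + a ^+ 2 * ip (p n) (q n))) in h1.
  exact: (norm_cvg_unique h1 h2).
apply/funext => n; exact: (core_Gamma2_identity (hpq n) (hdt n).1 (hdt n).2).
Qed.

End graph_second_order.

(** * The spectral gap *)

Section flat_function.
Context {R : realType}.
Implicit Types (x y : R) (p : {poly R}).

Lemma horner_bound p : exists C n, 0 <= C /\
  forall y, 0 <= y -> `|p.[y]| <= C * (1 + y) ^+ n.
Proof.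
exists (\sum_(i < size p) `|p`_i|), (size p); split; first by apply: sumr_ge0.
move=> y y0; rewrite horner_coef mulr_suml; apply: le_trans (ler_norm_sum _ _ _) _.
apply: ler_sum => i _; rewrite normrM ler_wpM2l// normrX ger0_norm//.
apply: (@le_trans _ _ ((1 + y) ^+ i)).
  by rewrite lerXn2r ?nnegrE ?addr_ge0// lerDr.
by apply: ler_weXn2l; [rewrite lerDl|exact: ltnW].
Qed.

(** The inequality [exp z >= 1 + z] at [z = y / k.+1], raised to the power [k.+1]. *)
Lemma expR_ge_pow k y : 0 <= y -> ((1 + y) / k.+1%:R) ^+ k.+1 <= expR y.
Proof.
move=> y0; have -> : expR y = expR (y / k.+1%:R) ^+ k.+1 by rewrite -expRM_natr divfK.
rewrite lerXn2r ?nnegrE ?expR_ge0 ?divr_ge0 ?addr_ge0//.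
apply: le_trans (expR_ge1Dx _).
by rewrite mulrDl lerD2r mul1r invf_le1// ler1n.
Qed.

(** A class closed under differentiation: the derivative of [p(1/x) exp(-1/x)] corresponds to the
    polynomial [X^2 (p - p')]. *)
Definition flat_poly p x : R := if 0 < x then p.[x^-1] * expR (- x^-1) else 0.

(** The exponential is bounded below by a power two above the growth of [p], and the two extra
    factors pair with [x^2] through [x (1 + x^-1) >= 1]. The quadratic bound yields derivative 0 at
    the origin. *)
Lemma flat_poly_bound p : exists C, 0 <= C /\ forall x, `|flat_poly p x| <= C * x ^+ 2.
Proof.
have [C [n [C0 hC]]] := horner_bound p.
have [N [NE N0]] : exists N : R, n.+2%:R ^+ n.+2 = N /\ 0 < N.
  by eexists; split; [reflexivity|rewrite exprn_gt0].
exists (C * N); split; first by rewrite mulr_ge0// ltW.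
move=> x; rewrite /flat_poly; case: ifPn => x0; last first.
  by rewrite normr0; apply: mulr_ge0; [apply: mulr_ge0 => //; exact: ltW|exact: sqr_ge0].
have y0 : 0 < x^-1 by rewrite invr_gt0.
set y := x^-1 in y0 *.
have h := hC y (ltW y0); have h2 := expR_ge_pow n.+1 (ltW y0).
rewrite normrM [X in _ * X]ger0_norm ?expR_ge0// expRN ler_pdivrMr ?expR_gt0//.
apply: le_trans h _.
have -> : C * N * x ^+ 2 * expR y = C * (N * (x ^+ 2 * expR y)) by ring.
rewrite ler_wpM2l//.
apply: (@le_trans _ _ (N * (x ^+ 2 * ((1 + y) / n.+2%:R) ^+ n.+2))); last first.
  by rewrite ler_wpM2l ?(ltW N0)// ler_wpM2l ?sqr_ge0.
have -> : N * (x ^+ 2 * ((1 + y) / n.+2%:R) ^+ n.+2) = (x * (1 + y)) ^+ 2 * (1 + y) ^+ n.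
  rewrite expr_div_n NE.
  have -> : (1 + y) ^+ n.+2 = (1 + y) ^+ 2 * (1 + y) ^+ n by rewrite -exprD.
  by move: ((1 + y) ^+ n) => Q; field; rewrite gt_eqF.
rewrite ler_peMl ?exprn_ge0 ?addr_ge0 ?(ltW y0)// exprn_ege1//.
by rewrite mulrDr mulr1 /y divff ?gt_eqF// lerDr ltW.
Qed.

Lemma is_derive_flat_poly p x :
  is_derive x 1 (flat_poly p) (flat_poly ('X^2 * (p - p^`())) x).
Proof.
have [x0|x0|->] := ltgtP x 0.
- rewrite {2}/flat_poly ltNge (ltW x0)/=.
  apply: (@near_eq_is_derive R R^o R^o (fun=> 0)).
  near=> y; rewrite /flat_poly ifF//; apply/negbTE; rewrite -leNgt ltW//.
  by near: y; exact: lt_nbhsl.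
- have xn0 : x != 0 by rewrite gt_eqF.
  have hi := isdV xn0 (isd_id x).
  have hp := is_derive_poly p x^-1.
  have he := is_derive_expR (- x^-1).
  have D : is_derive x 1 (fun x : R => p.[x^-1] * expR (- x^-1)) (flat_poly ('X^2 * (p - p^`())) x).
    have h1 := @isd_comp R expR (fun y => - y^-1) x _ _ he (isdN hi).
    have h2 := @isd_comp R (horner p) (fun y => y^-1) x _ _ hp hi.
    apply: isdE (isdM h2 h1) _.
    by rewrite /flat_poly x0 hornerM hornerXn hornerD hornerN exprVn; field.
  apply: near_eq_is_derive D; near=> y; rewrite /flat_poly ifT//.
  by near: y; exact: lt_nbhsr.
- have -> : flat_poly ('X^2 * (p - p^`())) 0 = 0 by rewrite /flat_poly ltxx.
  have h : h^-1 *: (flat_poly p (h *: 1 + 0) - flat_poly p 0) @[h --> (0 : R)^'] --> (0 : R).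
    have [C [C0 hC]] := flat_poly_bound p.
    apply/cvgrPdist_le => e e0; near=> h.
    have h0 : h != 0 by near: h; exact: nbhs_dnbhs_neq.
    rewrite sub0r normrN /GRing.scale/= mulr1 addr0 {2}/flat_poly ltxx subr0.
    rewrite normrM normfV mulrC ler_pdivrMr ?normr_gt0//.
    apply: le_trans (hC h) _; rewrite -(real_normK (num_real h)) expr2 mulrA ler_wpM2r//.
    apply: (@le_trans _ _ ((C + 1) * `|h|)); first by rewrite ler_wpM2r// lerDl.
    rewrite -ler_pdivlMl ?ltr_wpDl// mulrC ltW//.
    near: h; apply: dnbhs0_lt; by rewrite divr_gt0// ltr_wpDl.
  by apply: DeriveDef; [apply/cvg_ex; eexists; exact: h|exact: cvg_lim h].
Unshelve. all: by end_near. Qed.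

Definition flat : R -> R := flat_poly 1.

Lemma flatE x : flat x = if 0 < x then expR (- x^-1) else 0.
Proof. by rewrite /flat /flat_poly; case: ifPn => // _; rewrite hornerC mul1r. Qed.

Lemma smooth_flat : smooth flat.
Proof.
apply: (@smooth_stable R [set f | exists p, f = flat_poly p]); last by exists 1.
move=> _ [p ->]; split=> [x|].
  exact: (@ex_derive _ _ _ _ _ _ _ (is_derive_flat_poly p x)).
exists ('X^2 * (p - p^`())); apply/funext => x; exact: (isd_derive1 (is_derive_flat_poly p x)).
Qed.

Lemma flat_ge0 x : 0 <= flat x.
Proof. by rewrite flatE; case: ifPn => // _; exact: expR_ge0. Qed.

Lemma flat_eq0 x : x <= 0 -> flat x = 0.
Proof. by move=> x0; rewrite flatE ltNge x0. Qed.

Lemma flat_le x : x <= 1 -> flat x <= expR (-1).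
Proof.
move=> x1; rewrite flatE; case: ifPn => x0; last exact: expR_ge0.
by rewrite ler_expR lerN2 -[leLHS]invr1 lef_pV2 ?posrE.
Qed.

Lemma flat_derive_bound : exists C, 0 <= C /\ forall x, `|x| <= 1 -> `|flat^`()%classic x| <= C.
Proof.
have [C [C0 hC]] := flat_poly_bound ('X^2 * (1 - 1^`())).
exists C; split => // x x1; rewrite (isd_derive1 (is_derive_flat_poly 1 x)).
apply: le_trans (hC x) _; rewrite ler_piMr// -(real_normK (num_real x)).
by rewrite exprn_ile1.
Qed.

Lemma flat_derive_eq0 x : x <= 0 -> flat^`()%classic x = 0.
Proof. by move=> x0; rewrite (isd_derive1 (is_derive_flat_poly 1 x)) /flat_poly ltNge x0. Qed.

End flat_function.

(** * The value of the spectral gap *)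

Section spectral_gap.
Context {R : realType} (beta : R).
Hypothesis hb1 : 1 / 2 < beta.
Hypothesis hb2 : beta <= 3 / 2.
Local Notation mu := (mu_ beta).
Local Notation Z := (total_mass beta).
Local Notation a := (beta - 1 / 2).
Local Notation V := (LfunType mu (lee1n 2)).
Local Notation ip := (@L2ip _ _ _ mu).
Local Notation nrm := (ip_norm (@L2ip _ _ _ mu)).
Let Hip := @L2_semi_inner_product _ _ _ mu.
Implicit Types (f k : R -> R) (x y M C c : R) (u v w p q : V).

Lemma variance_ge0_L2 u : 0 <= ip u u - ip (L2one mu) u ^+ 2.
Proof.
rewrite subr_ge0; have := ip_cauchy_schwarz Hip (L2one mu) u.
by rewrite -(sqr_nrm Hip (L2one mu)) nrm1 expr1n mul1r.
Qed.

Lemma lambda1_quotient u v : (- \int[mu]_x (u x * v x)) = \int[mu]_x (- u x * v x).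
Proof.
rewrite -mulN1r -RintegralZl//; last exact: L2_integrableM.
by apply: eq_Rintegral => x _; ring.
Qed.

Lemma lambda1_ge : ((a ^+ 2)%:E <= lambda1 beta)%E.
Proof.
apply: le_ereal_inf_tmp => _ [f [g [fg Vf ->]]].
have [lf lg _] := fg.
pose u : V := Lfun_Sub (lee1n 2) lf; pose v : V := Lfun_Sub (lee1n 2) lg.
have uv : graph u v by apply/LbarP.
have VE : ('V_mu[f] = (ip u u - ip (L2one mu) u ^+ 2)%:E)%E by exact: (variance_L2 u).
rewrite VE lee_fin ler_pdivlMr/=; last first.
  rewrite lt_neqAle variance_ge0_L2 andbT eq_sym.
  by move: Vf; rewrite VE eqe.
by rewrite -(lambda1_quotient u v); exact: graph_poincare.
Qed.

(** With the quotient multiplied out, the inequality survives limits of test functions. *)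
Lemma lambda1_le_core c f : (c%:E <= lambda1 beta)%E -> Ccinfty f ->
  c * (\int[mu]_x (f x ^+ 2) - (\int[mu]_x f x) ^+ 2) <=
  \int[mu]_x (omega x * f^`()%classic x ^+ 2).
Proof.
move=> cl cf.
pose u := core_elt beta cf; pose v := core_elt beta (Ccinfty_L beta cf).
have -> : \int[mu]_x (omega x * f^`()%classic x ^+ 2) = - ip u v.
  rewrite (core_energy hb1 cf cf) // opprK.
  by apply: eq_Rintegral => x _; rewrite expr2 mulrA.
have -> : \int[mu]_x (f x ^+ 2) = ip u u by apply: eq_Rintegral => x _; rewrite expr2.
have -> : \int[mu]_x f x = ip (L2one mu) u by rewrite ip1E.
have uv : graph u v.
  exists (fun=> u), (fun=> v); split.
  - by move=> n; exact: core_core_elt.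
  - exact: cvg_nrm_cst.
  - exact: cvg_nrm_cst.
have E0 : 0 <= - ip u v.
  apply: le_trans (graph_poincare hb1 hb2 uv).
  by apply: mulr_ge0; [exact: sqr_ge0|exact: variance_ge0_L2].
(* Functions of zero variance are excluded from the infimum; for them the claim is that the energy
   is nonnegative. *)
have [s0|s0] := eqVneq (ip u u - ip (L2one mu) u ^+ 2) 0; first by rewrite s0 mulr0.
rewrite -ler_pdivlMr; last by rewrite lt_neqAle eq_sym s0 variance_ge0_L2.
rewrite -lee_fin; apply: le_trans cl _; apply: ereal_inf_lbound.
exists f, (L beta f); split.
- exact/(LbarP u v).
- by rewrite (variance_L2 u) eqe.
- by rewrite (variance_L2 u)/= -(lambda1_quotient u v).
Qed.

Lemma cvg_Rintegral_dominated (h : nat -> R -> R) k (g : R -> R) :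
  (forall n, measurable_fun setT (h n)) ->
  (forall x, h n x @[n --> \oo] --> k x) ->
  mu.-integrable setT (EFin \o g) -> (forall n x, `|h n x| <= g x) ->
  \int[mu]_x h n x @[n --> \oo] --> \int[mu]_x k x.
Proof.
move=> mh hk ig hg; apply: fine_cvg.
have mk : measurable_fun setT k.
  by apply: (@measurable_fun_cvg _ _ _ setT h) => // x _; exact: hk.
have ik : mu.-integrable setT (EFin \o k).
  have mg : measurable_fun setT (EFin \o g) by case/integrableP : ig.
  apply: (@le_integrable _ _ _ mu setT measurableT _ (EFin \o g)) => //; first exact/measurable_EFinP.
  move=> x _ /=; rewrite lee_fin.
  have h1 : `|h n x| @[n --> \oo] --> `|k x| by apply: cvg_norm; exact: hk.
  apply: (cvgr_to_le h1); apply: nearW => n; exact: le_trans (hg n x) (ler_norm _).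
rewrite /Rintegral fineK; last exact: integrable_fin_num.
apply: (@dominated_cvg _ _ _ mu setT measurableT (fun n x => (h n x)%:E) (EFin \o k) (EFin \o g)) => //.
- by move=> n; apply/measurable_EFinP.
- by move=> x _; apply: cvg_EFin; [exact: nearW|exact: hk].
- by move=> n x _; rewrite lee_fin.
Qed.

(** * Truncated powers of [omega] *)

Section test_functions.
Variable g : R.
Hypothesis g0 : 0 < g.
Hypothesis ga : g < a / 2.
Implicit Types n : nat.

Let arg n x : R := 1 - omega x / n.+1%:R.
(** A smooth cutoff, zero once [omega x >= n.+1]; the factor [expR 1] compensates
    [flat 1 = expR (-1)], so that it tends to 1. *)
Let cut n x : R := expR 1 * flat (arg n x).
Let phi n x : R := omega x `^ g * cut n x.
(** The contribution of the cutoff to the derivative: [phi' = 2 x omega^(g - 1) (g cut - rem)]. It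
    is bounded uniformly in [n], since the derivative of [flat] vanishes at nonpositive arguments,
    that is unless [omega x < n.+1]. *)
Let rem n x : R := omega x / n.+1%:R * (expR 1 * flat^`()%classic (arg n x)).

Let smooth_arg n : smooth (arg n).
Proof.
rewrite (_ : arg n = fun x => 1 - n.+1%:R^-1 * omega x).
  apply: smoothB; first exact: smooth_cst.
  by apply: smoothZ; exact: smooth_omega.
by apply/funext => x; rewrite /arg mulrC.
Qed.

Let arg_le1 n x : arg n x <= 1.
Proof. by rewrite /arg gerBl divr_ge0// ltW// omega_gt0. Qed.

Let arg_le0 n x : n.+1%:R <= omega x -> arg n x <= 0.
Proof. by move=> h; rewrite /arg subr_le0 ler_pdivlMr// mul1r. Qed.

Let Ccinfty_phi n : Ccinfty (phi n).
Proof.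
apply/CcinftyP; split.
  apply: smoothM; first exact: smooth_powR_omega.
  by apply: smoothZ; apply: smooth_comp; [exact: smooth_flat|exact: smooth_arg].
exists n.+1%:R; split => // x hx; rewrite /phi /cut flat_eq0 ?mulr0//.
apply: arg_le0; rewrite /omega -(real_normK (num_real x)).
have n1 : 1 <= n.+1%:R :> R by rewrite ler1n.
by move: hx n1; rewrite expr2; move: (`|x|) (n.+1%:R : R) => y m *; nra.
Qed.

Let cut01 n x : 0 <= cut n x <= 1.
Proof.
rewrite /cut mulr_ge0 ?expR_ge0 ?flat_ge0//=.
by rewrite -[leRHS](expRxMexpNx_1 1) ler_wpM2l ?expR_ge0// flat_le ?arg_le1.
Qed.

Let cvg_inv0 x : omega x / n.+1%:R @[n --> \oo] --> (0 : R).
Proof.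
rewrite -[X in _ --> X](mulr0 (omega x)); apply: cvgMl_tmp; exact: cvg_harmonic.
Qed.

Let cvg_arg x : arg n x @[n --> \oo] --> (1 : R).
Proof. by rewrite -[X in _ --> X]subr0; apply: cvgB; [exact: cvg_cst|exact: cvg_inv0]. Qed.

Let cvg_cut x : cut n x @[n --> \oo] --> (1 : R).
Proof.
rewrite -[X in _ --> X](expRxMexpNx_1 1); apply: cvgMl_tmp.
have -> : expR (-1) = flat (1 : R) by rewrite flatE ltr01 invr1.
apply: (@cvg_comp _ _ _ (fun n => arg n x) flat _ (nbhs (1 : R))); first exact: cvg_arg.
by apply: smooth_continuous; exact: smooth_flat.
Qed.

Let rem_bound : exists C, 0 <= C /\ forall n x, `|rem n x| <= C.
Proof.
have [C [C0 hC]] := @flat_derive_bound R.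
exists (expR 1 * C); split; first by rewrite mulr_ge0 ?expR_ge0.
move=> n x; have w0 := omega_gt0 x.
have [h|h] := leP n.+1%:R (omega x).
  by rewrite /rem flat_derive_eq0 ?arg_le0// !mulr0 normr0 mulr_ge0 ?expR_ge0.
have y1 : omega x / n.+1%:R <= 1 by rewrite ler_pdivrMr// mul1r ltW.
have y0 : 0 <= omega x / n.+1%:R by rewrite divr_ge0// ltW.
rewrite /rem normrM (ger0_norm y0) normrM [`|expR 1|]ger0_norm ?expR_ge0//.
rewrite -[leRHS]mul1r; apply: ler_pM => //.
rewrite ler_wpM2l ?expR_ge0// hC//.
by rewrite ler_norml /arg; move: y0 y1; move: (omega x / _) => z *; apply/andP; split; lra.
Qed.

Let cvg_rem x : rem n x @[n --> \oo] --> (0 : R).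
Proof.
have [C [C0 hC]] := @flat_derive_bound R.
have h : omega x / n.+1%:R * (expR 1 * C) @[n --> \oo] --> (0 * (expR 1 * C) : R).
  by apply: cvgMr_tmp; exact: cvg_inv0.
rewrite mul0r in h.
apply/cvgr0Pnorm_le => e e0; move/cvgr0Pnorm_le : h => /(_ e e0).
apply: filterS => n; apply: le_trans.
have w0 := omega_gt0 x.
have y0 : 0 <= omega x / n.+1%:R by rewrite divr_ge0// ltW.
rewrite /rem !normrM ler_wpM2l// ler_wpM2l//.
have [h|h] := leP n.+1%:R (omega x); first by rewrite flat_derive_eq0 ?arg_le0// normr0.
apply: le_trans (ler_norm _); apply: hC.
have y1 : omega x / n.+1%:R <= 1 by rewrite ler_pdivrMr// mul1r ltW.
by rewrite ler_norml /arg; move: y0 y1; move: (omega x / _) => z *; apply/andP; split; lra.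
Qed.

Let phi_energy n x : omega x * (phi n)^`()%classic x ^+ 2 =
  4 * (x ^+ 2 / omega x) * omega x `^ (2 * g) * (g * cut n x - rem n x) ^+ 2.
Proof.
have w0 := omega_gt0 x.
have darg : is_derive x 1 (arg n) (- (2 * x / n.+1%:R)).
  apply: isdE (isdB (isd_cst 1 x) (isdM (isd_omega x) (isd_cst n.+1%:R^-1 x))) _.
  by rewrite mulr0 addr0 sub0r.
have dflat := @smooth_isd R flat (arg n x) (@smooth_flat R).
have dcut := isdZ (expR 1) (@isd_comp R flat (arg n) x _ _ dflat darg).
rewrite (isd_derive1 (isdM (isd_powR_omega g x) dcut)) /rem /cut.
have -> : omega x `^ (2 * g) = omega x `^ g ^+ 2.
  by rewrite mulrC powRrM powR_mulrn// powR_ge0.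
rewrite [omega x `^ g]powR_omegaS.
by field; rewrite gt_eqF//= gt_eqF.
Qed.

(** The bound for [phi n] passes to the limit by dominated convergence; multiples of [omega ^ (2 g)]
    dominate the squares and energies, and are integrable because [2 g < a]. The limiting energy is
    [4 g^2] times the integral of [x^2 omega^(2 g - 1)], where [x^2 <= omega]. *)
Lemma test_function_bound c : (c%:E <= lambda1 beta)%E ->
  c * (\int[mu]_x (omega x `^ (2 * g)) - (\int[mu]_x (omega x `^ g)) ^+ 2) <=
  4 * g ^+ 2 * \int[mu]_x (omega x `^ (2 * g)).
Proof.
move=> cl.
have i2 : mu.-integrable setT (EFin \o (fun x => omega x `^ (2 * g))).
  by apply: mu_powR_omega => //; move: ga; lra.
have i1 : mu.-integrable setT (EFin \o (fun x => omega x `^ g)).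
  by apply: mu_powR_omega => //; move: ga g0; lra.
have E2 x : omega x `^ (2 * g) = omega x `^ g ^+ 2.
  by rewrite mulrC powRrM powR_mulrn// powR_ge0.
have cphi x : phi n x @[n --> \oo] --> omega x `^ g.
  by rewrite -[X in _ --> X]mulr1; apply: cvgMl_tmp; exact: cvg_cut.
have mphi n : measurable_fun setT (phi n).
  by apply: continuous_measurable_fun; exact: core_cont (Ccinfty_phi n).
have phi_le n x : `|phi n x| <= omega x `^ g.
  have /andP[c0 c1] := cut01 n x.
  rewrite /phi ger0_norm; last by apply: mulr_ge0 => //; exact: powR_ge0.
  by apply: ler_piMr => //; exact: powR_ge0.
have L2 : \int[mu]_x (phi n x ^+ 2) @[n --> \oo] --> \int[mu]_x (omega x `^ (2 * g)).
  apply: (cvg_Rintegral_dominated _ _ i2).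
  - by move=> n; exact: measurable_funX.
  - move=> x; rewrite E2 expr2; under eq_fun do rewrite expr2.
    by apply: cvgM; exact: cphi.
  - by move=> n x; rewrite E2 normrX lerXn2r ?nnegrE ?powR_ge0.
have L1 : \int[mu]_x (phi n x) @[n --> \oo] --> \int[mu]_x (omega x `^ g).
  exact: (cvg_Rintegral_dominated _ _ i1).
have [C [C0 hC]] := rem_bound.
pose k x := 4 * (x ^+ 2 / omega x) * omega x `^ (2 * g) * g ^+ 2.
have xw1 x : 0 <= x ^+ 2 / omega x <= 1.
  have w0 := omega_gt0 x.
  by rewrite divr_ge0 ?sqr_ge0 ?(ltW w0)//= ler_pdivrMr// mul1r lerDr.
have LE : \int[mu]_x (omega x * (phi n)^`()%classic x ^+ 2) @[n --> \oo] --> \int[mu]_x k x.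
  have iC : mu.-integrable setT (EFin \o (fun x => (4 * (g + C) ^+ 2) * omega x `^ (2 * g))).
    exact: (integrableZl measurableT (4 * (g + C) ^+ 2) i2).
  apply: (cvg_Rintegral_dominated _ _ iC).
  - move=> n; apply: continuous_measurable_fun => x.
    by apply: cvgM; [exact: continuous_omega|apply: cvgM; exact: core_cont1 (Ccinfty_phi n) _].
  - move=> x; under eq_fun do rewrite phi_energy.
    apply: cvgMl_tmp; rewrite -[X in X ^+ 2]subr0 -{2}(mulr1 g).
    have h : g * cut n x - rem n x @[n --> \oo] --> g * 1 - 0.
      by apply: cvgB; [apply: cvgMl_tmp; exact: cvg_cut|exact: cvg_rem].
    by rewrite expr2; under eq_fun do rewrite expr2; exact: cvgM.
  - move=> n x; rewrite phi_energy; have /andP[x0 x1] := xw1 x.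
    have p0 := powR_ge0 (omega x) (2 * g).
    rewrite ger0_norm; last by apply: mulr_ge0; [apply: mulr_ge0 => //; apply: mulr_ge0|exact: sqr_ge0].
    have h : (g * cut n x - rem n x) ^+ 2 <= (g + C) ^+ 2.
      rewrite -(real_normK (num_real (_ - _))) lerXn2r ?nnegrE ?addr_ge0 ?(ltW g0)//.
      apply: le_trans (ler_normB _ _) _; apply: lerD => //.
      have /andP[c0 c1] := cut01 n x.
      rewrite ger0_norm; last by apply: mulr_ge0 => //; exact: ltW.
      by apply: ler_piMr => //; exact: ltW.
    rewrite mulrAC ler_wpM2r//; apply: ler_pM => //.
    + by apply: mulr_ge0 => //; exact: mulr_ge0.
    + exact: sqr_ge0.
    + by apply: ler_piMr.
have hk : \int[mu]_x k x <= 4 * g ^+ 2 * \int[mu]_x (omega x `^ (2 * g)).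
  have ik' := integrableZl measurableT (4 * g ^+ 2) i2.
  have kE x : k x = x ^+ 2 / omega x * (4 * g ^+ 2 * omega x `^ (2 * g)) by rewrite /k; ring.
  rewrite -RintegralZl//; apply: le_Rintegral => //.
    apply: (le_integrable _ _ _ ik') => //.
      apply/measurable_EFinP; apply: (@measurable_fun_cvg _ _ _ setT (fun n x => omega x * (phi n)^`()%classic x ^+ 2)).
        move=> n; apply: continuous_measurable_fun => x.
        by apply: cvgM; [exact: continuous_omega|apply: cvgM; exact: core_cont1 (Ccinfty_phi n) _].
      move=> x _; under eq_fun do rewrite phi_energy.
      apply: cvgMl_tmp; rewrite -[X in X ^+ 2]subr0 -{2}(mulr1 g).
      have h : g * cut n x - rem n x @[n --> \oo] --> g * 1 - 0.
        by apply: cvgB; [apply: cvgMl_tmp; exact: cvg_cut|exact: cvg_rem].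
      by rewrite expr2; under eq_fun do rewrite expr2; exact: cvgM.
    move=> x _ /=; rewrite kE lee_fin normrM; have /andP[x0 x1] := xw1 x.
    by rewrite (ger0_norm x0) ler_piMl.
  move=> x _; rewrite kE; have /andP[x0 x1] := xw1 x.
  by rewrite ler_piMl// mulr_ge0 ?powR_ge0// mulr_ge0 ?sqr_ge0.
apply: le_trans hk.
have h1 : c * (\int[mu]_x (phi n x ^+ 2) - (\int[mu]_x phi n x) ^+ 2) @[n --> \oo] -->
   c * (\int[mu]_x (omega x `^ (2 * g)) - (\int[mu]_x (omega x `^ g)) ^+ 2).
  apply: cvgMl_tmp; apply: cvgB; first exact: L2.
  by rewrite expr2; under eq_fun do rewrite expr2; exact: (cvgM L1 L1).
by apply: (ler_cvg_to h1 LE); apply: nearW => n; exact: lambda1_le_core.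
Qed.

End test_functions.

Lemma Rintegral_powR_omega_ge e : 0 < e ->
  (Z * e)^-1 <= \int[mu]_x (omega x `^ (a - e)).
Proof.
move=> e0; have i1 : mu.-integrable setT (EFin \o (fun x => omega x `^ (a - e))).
  by apply: mu_powR_omega => //; move: e0; lra.
rewrite -lee_fin /Rintegral fineK; last exact: integrable_fin_num.
rewrite integral_mu//; last exact: measurable_omega.
have E x : (omega x `^ (a - e) * density beta x)%:E =
    ((Z^-1)%:E * (omega x `^ (- (1 / 2 + e)))%:E)%E.
  rewrite -EFinM; congr (_%:E); rewrite /density /weight mulrA -powRD; last first.
    by apply/implyP => _; rewrite gt_eqF ?omega_gt0.
  by rewrite mulrC; congr (_ * _ `^ _); lra.
under eq_integral do rewrite E.
have Z0 := total_mass_gt0 hb1.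
rewrite ge0_integralZl_EFin//; last 3 first.
- by move=> x _; rewrite lee_fin powR_ge0.
- by apply/measurable_EFinP; exact: measurable_omega.
- by rewrite invr_ge0 ltW.
rewrite invfM EFinM lee_pmul2l//; last by rewrite lte_fin invr_gt0.
exact: integral_powR_omega_ge.
Qed.

(* The test functions [omega ^ ((a - d) / 2)] have bounded mean, while their
   second moment blows up as [d] tends to [0]. *)
Lemma lambda1E : lambda1 beta = (a ^+ 2)%:E.
Proof.
apply/eqP; rewrite eq_le lambda1_ge andbT.
apply/lee_addgt0Pr => e e0; rewrite leNgt; apply/negP => /ltW; rewrite -EFinD => cl.
pose c := a ^+ 2 + e; pose M := \int[mu]_x (omega x `^ (a / 2)).
have a0 : 0 < a by move: hb1; lra.
have Z0 := total_mass_gt0 hb1.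
have c0 : 0 < c by rewrite /c ltr_wpDl ?sqr_ge0.
have D0 : 0 < Z * (c * M ^+ 2 + 1).
  by apply: mulr_gt0 => //; rewrite ltr_wpDl// mulr_ge0 ?sqr_ge0// ltW.
(* The first bound keeps the exponent positive. By the second, [e * S >= c * M^2 + 1], whereas the
   test function gives [c * (S - m^2) <= a^2 * S], hence [e * S <= c * m^2 <= c * M^2]. *)
pose d := Num.min (a / 2) (e / (Z * (c * M ^+ 2 + 1))).
have d0 : 0 < d by rewrite /d lt_min divr_gt0//= divr_gt0.
have da : d <= a / 2 by rewrite /d ge_min lexx.
have de : d * (Z * (c * M ^+ 2 + 1)) <= e by rewrite -ler_pdivlMr// /d ge_min lexx orbT.
have g0 : 0 < (a - d) / 2 by move: da a0; lra.
have ga : (a - d) / 2 < a / 2 by move: d0; lra.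
have i1 c' : c' < a -> mu.-integrable setT (EFin \o (fun x => omega x `^ c')).
  exact: mu_powR_omega.
have := test_function_bound g0 ga cl.
have -> : 2 * ((a - d) / 2) = a - d by lra.
have := Rintegral_powR_omega_ge d0.
set S := \int[mu]_x omega x `^ (a - d); set m := \int[mu]_x _ => Sge.
have mM : m <= M.
  apply: le_Rintegral => //; [by apply: i1; move: d0 a0; lra|by apply: i1; move: a0; lra|].
  move=> x _; apply: ler_powR; last exact: ltW.
  by rewrite /omega lerDl sqr_ge0.
have m0 : 0 <= m by apply: Rintegral_ge0 => // x _; exact: powR_ge0.
have m2 : m ^+ 2 <= M ^+ 2 by apply: lerXn2r; rewrite ?nnegrE; [exact: m0|exact: le_trans mM|exact: mM].
have S0 : 0 <= S by apply: le_trans Sge; rewrite invr_ge0; apply: mulr_ge0; exact: ltW.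
have h1 : c * m ^+ 2 <= c * M ^+ 2 by rewrite ler_wpM2l// ltW.
have h2 : 4 * ((a - d) / 2) ^+ 2 * S <= a ^+ 2 * S.
  rewrite ler_wpM2r// (_ : 4 * _ = (a - d) ^+ 2); last by field.
  by rewrite lerXn2r ?nnegrE//; move: d0 a0 da; lra.
have h3 : c * M ^+ 2 + 1 <= e * S.
  apply: (@le_trans _ _ (e * (Z * d)^-1)); last by rewrite ler_wpM2l// ltW.
  by rewrite ler_pdivlMr ?mulr_gt0// mulrC [Z * d]mulrC -mulrA.
rewrite -/c mulrBr {1}/c mulrDl; move: h1 h2 h3.
move: (a ^+ 2 * S) (e * S) (4 * _ * S) (c * m ^+ 2) (c * M ^+ 2) => *; lra.
Qed.

End spectral_gap.

(** * Decay along the semigroup *)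

Section semigroup_decay.
Context {R : realType} (beta : R).
Hypothesis hb1 : 1 / 2 < beta.
Hypothesis hb2 : beta <= 3 / 2.
Local Notation mu := (mu_ beta).
Local Notation a := (beta - 1 / 2).
Local Notation V := (LfunType mu (lee1n 2)).
Local Notation ip := (@L2ip _ _ _ mu).
Local Notation nrm := (ip_norm (@L2ip _ _ _ mu)).
Local Notation one := (L2one mu).
Let Hip := @L2_semi_inner_product _ _ _ mu.
Implicit Types (f g k : R -> R) (x y s t : R) (u v w : V).

(** Both terms of the integrated identity are nonnegative, as [0 < a <= 1]. This sign is what the
    improper fundamental theorem in time requires. *)
Lemma graph_dissipation_ge0 u v : graph u v -> 0 <= ip v v + a ^+ 2 * ip u v.
Proof.
move=> /(graph_Gamma2 hb1 hb2) [d [t [_ _ <-]]].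
apply: addr_ge0; first exact: (ip_ge0 Hip).
apply: mulr_ge0; last exact: (ip_ge0 Hip).
by apply: mulr_ge0; move: hb1 hb2; lra.
Qed.

(** Substituting [omega f'' = 2 (beta - 1) x f' + v], the first square becomes [(v + a x f')^2],
    because [2 (beta - 1) + (3 / 2 - beta) = a]. *)
Lemma C2_version_integral u v w : graph u v -> graph v w ->
  (\int[mu]_x
    (let p := C2_version beta u in
     (omega x * p^`(2)%classic x + (3 / 2 - beta) * x * p^`()%classic x) ^+ 2
     + (3 / 2 - beta) * (beta - 1 / 2) * p^`()%classic x ^+ 2)%R%:E)%E
  = (ip v v + a ^+ 2 * ip u v)%:E.
Proof.
move=> uv vw; have [f [g [C2f uf vg fE]]] := graph_C2 hb1 hb2 uv vw.
have C2cont p : C2 p -> continuous p.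
  by move=> [dp _ _] x; apply/differentiable_continuous/derivable1_diffP.
(* [graph_C2] exhibits a C^2 version, so [xget] does not return its default. *)
have [C2p pu] : [set p | C2 p /\ p = u %[ae mu]] (C2_version beta u).
  by apply: xgetPex; exists f; split => //; apply: filterS uf => x h /h.
have -> : C2_version beta u = f.
  apply: (continuous_ae_eq hb1); [exact: C2cont|exact: C2cont|].
  by apply: filterS2 pu uf => x /= h1 h2 xT; rewrite h1// h2.
have [d [t [dE tE <-]]] := graph_Gamma2 hb1 hb2 uv.
have [_ df1 cf2] := C2f.
have cf1 : continuous f^`()%classic.
  by move=> x; apply/differentiable_continuous/derivable1_diffP.
pose q : V := v + a *: t.
have mL2 (r : V) : measurable_fun setT (fun x => (r x ^+ 2)%:E).
  by apply/measurable_EFinP/measurable_funX; exact/measurable_Lfun2/LfunP.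
have c0 : 0 <= a * (1 - a) by apply: mulr_ge0; move: hb1 hb2; lra.
transitivity (\int[mu]_x ((q x ^+ 2)%:E + (a * (1 - a))%:E * (d x ^+ 2)%:E))%E.
  apply: ae_eq_integral => //.
  - apply/measurable_EFinP; apply: measurable_funD.
      apply: measurable_funX; apply: continuous_measurable_fun => x; apply: cvgD.
        by apply: cvgM; [exact: continuous_omega|exact: cf2].
      by apply: cvgM; [apply: cvgM; [exact: cvg_cst|exact: cvg_id]|exact: cf1].
    apply: measurable_funM; first exact: measurable_cst.
    by apply: measurable_funX; exact: continuous_measurable_fun.
  - apply: emeasurable_funD; first exact: (mL2 q).
    exact: (measurable_funeM _ (mL2 d)).
  - apply: filterS vg => x /= vgx xT.
    have [f1 f2] := fE x; rewrite -EFinM -EFinD f2 f1; congr (_%:E).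
    rewrite -[RHS]/((v x + a * t x) ^+ 2 + a * (1 - a) * d x ^+ 2).
    rewrite vgx//.
    have -> : d x = flux beta v x by exact: (congr1 (fun h : R -> R => h x) dE).
    have -> : t x = x * flux beta v x by exact: (congr1 (fun h : R -> R => h x) tE).
    by field.
rewrite ge0_integralD//; first last.
- exact: (measurable_funeM _ (mL2 d)).
- by move=> x _; rewrite -EFinM lee_fin; apply: mulr_ge0 => //; exact: sqr_ge0.
- by move=> x _; rewrite lee_fin sqr_ge0.
rewrite ge0_integralZl_EFin//; last by move=> x _; rewrite lee_fin sqr_ge0.
by rewrite !integral_L2sqr !(sqr_nrm Hip) -EFinM -EFinD.
Qed.

Variable Q : R -> V -> V.
Hypothesis HQ : C0_semigroup ip Q.
Hypothesis Qgen : forall u v, generates ip Q u v <-> graph u v.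

Let complete := @L2_complete _ _ _ mu.

Lemma graph_orbit u v t : 0 <= t -> graph u v -> graph (Q t u) (Q t v).
Proof. by move=> t0 /Qgen h; apply/Qgen; exact: (generates_orbit Hip HQ). Qed.

Lemma cvg_ip_orbit u v t : 0 < t -> ip (Q s u) (Q s v) @[s --> t] --> ip (Q t u) (Q t v).
Proof. by move=> t0; apply: (cvg_ip Hip); exact: (cvg_C0 Hip HQ complete). Qed.

Lemma cvg_ip_orbit0 u v : ip (Q s u) (Q s v) @[s --> 0^'+] --> ip (Q 0 u) (Q 0 v).
Proof. by apply: (cvg_ip Hip); exact: (cvg_C0_right0 Hip HQ). Qed.

Lemma cvg_ipl_orbit0 w u : ip w (Q s u) @[s --> 0^'+] --> ip w (Q 0 u).
Proof.
by apply: (cvg_ip Hip); [exact: cvg_nrm_cst|exact: (cvg_C0_right0 Hip HQ)].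
Qed.

Variables u0 u1 u2 : V.
Hypothesis u01 : graph u0 u1.
Hypothesis u12 : graph u1 u2.

Let var t := ip (Q t u0) (Q t u0) - ip one (Q t u0) ^+ 2.
Let energy t := - ip (Q t u0) (Q t u1).
Let diss t := ip (Q t u1) (Q t u1) + a ^+ 2 * ip (Q t u0) (Q t u1).

Let is_derive_var t : 0 < t -> is_derive t 1 var (- (2 * energy t)).
Proof.
move=> t0; have g01 := (Qgen u0 u1).2 u01.
apply: isdE (isdB (is_derive_ip_C0 Hip HQ complete t0 g01 g01)
  (isd_sqr (is_derive_ipl_C0 Hip HQ complete one t0 g01))) _.
rewrite (graph_mean hb1 (graph_orbit (ltW t0) u01)) (ipC Hip (Q t u1)) /energy; ring.
Qed.

Let is_derive_energy t : 0 < t -> is_derive t 1 energy (- (2 * ip (Q t u1) (Q t u1))).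
Proof.
move=> t0; have g01 := (Qgen u0 u1).2 u01; have g12 := (Qgen u1 u2).2 u12.
apply: isdE (isdN (is_derive_ip_C0 Hip HQ complete t0 g01 g12)) _.
rewrite (graph_symmetric hb1 (graph_orbit (ltW t0) u01) (graph_orbit (ltW t0) u12)); ring.
Qed.

Let energy_var t : 0 <= t -> a ^+ 2 * var t <= energy t.
Proof. by move=> t0; exact: (graph_poincare hb1 hb2 (graph_orbit t0 u01)). Qed.

Let cvg_var0 : var t @[t --> 0^'+] --> var 0.
Proof.
apply: cvgB; first exact: cvg_ip_orbit0.
by rewrite expr2; under eq_fun do rewrite expr2; apply: cvgM; exact: cvg_ipl_orbit0.
Qed.

Let cvg_energy0 : energy t @[t --> 0^'+] --> energy 0.
Proof. by apply: cvgN; exact: cvg_ip_orbit0. Qed.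

(* The energy decreases along the flow and its integral over [0, t] is
   (var 0 - var t) / 2, hence the rate 1 / t. *)
Let energy_decay t : 0 < t -> 2 * t * energy t <= var 0.
Proof.
move=> t0; pose h s := var s + 2 * s * energy s.
have dh s : 0 < s -> is_derive s 1 h (- (4 * s * ip (Q s u1) (Q s u1))).
  move=> s0; apply: isdE (isdD (is_derive_var s0)
    (isdM (isdZ 2 (isd_id s)) (is_derive_energy s0))) _; ring.
have : h t <= h 0.
  apply: (@ler0_derive1_nincr _ h 0 t); rewrite ?lexx ?(ltW t0)//.
  - by move=> s; rewrite in_itv/= => /andP[s0 _]; have [] := dh s s0.
  - move=> s; rewrite in_itv/= => /andP[s0 _]; rewrite (isd_derive1 (dh s s0)) oppr_le0.
    by apply: mulr_ge0; [apply: mulr_ge0 => //; exact: ltW|exact: (ip_ge0 Hip)].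
  - apply/continuous_within_itvP => //; split.
    + by move=> s; rewrite in_itv/= => /andP[s0 _]; exact: isd_cont (dh s s0).
    + apply: cvgD; first exact: cvg_var0.
      apply: cvgM; last exact: cvg_energy0.
      by apply: cvgMl_tmp; exact/cvg_at_right_filter/cvg_id.
    + exact/cvg_at_left_filter/(isd_cont (dh t t0)).
rewrite /h mulr0 mul0r addr0; apply: le_trans; rewrite lerDr.
exact: variance_ge0_L2.
Qed.

Lemma integral_dissipation :
  (\int[lebesgue_measure]_(t in `[0%R, +oo[) (diss t)%:E =
   (- (2^-1 * (a ^+ 2 * var 0 - energy 0)))%:E)%E.
Proof.
pose F t := 2^-1 * (a ^+ 2 * var t - energy t).
have dF t : 0 < t -> is_derive t 1 F (diss t).
  move=> t0; apply: isdE (isdZ 2^-1 (isdB (isdZ (a ^+ 2) (is_derive_var t0)) (is_derive_energy t0))) _.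
  by rewrite /diss /energy; field.
rewrite (@ge0_continuous_FTC2y _ diss F 0 0).
- by rewrite sub0e EFinN.
- by move=> t t0; exact/graph_dissipation_ge0/graph_orbit.
- apply/continuous_within_itvcyP; split.
    move=> t; rewrite in_itv/= andbT => t0.
    by apply: cvgD; [exact: cvg_ip_orbit|apply: cvgMl_tmp; exact: cvg_ip_orbit].
  by apply: cvgD; [exact: cvg_ip_orbit0|apply: cvgMl_tmp; exact: cvg_ip_orbit0].
(* From [0 <= a^2 * var t <= energy t <= var 0 / (2 t)], any [t > var 0 / e] suffices. *)
- apply/cvgr0Pnorm_le => e e0; near=> t.
  have t0 : 0 < t by near: t; exact: nbhs_pinfty_gt.
  have tv : var 0 / e < t by near: t; apply: nbhs_pinfty_gt; rewrite num_real.
  have := energy_var (ltW t0); have := energy_decay t0.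
  have v0 : 0 <= a ^+ 2 * var t by apply: mulr_ge0; [exact: sqr_ge0|exact: variance_ge0_L2].
  move: tv; rewrite ltr_pdivrMr// => tv ed ev.
  have en : energy t <= e.
    rewrite -(ler_pM2l t0); move: tv ed v0 ev; move: (a ^+ 2 * var t) (var 0) (energy t) => *; nra.
  rewrite /F ler_norml; move: en v0 ev; move: (a ^+ 2 * var t) (energy t) => *; apply/andP; split; lra.
- by move=> t t0; have [] := dF t t0.
- by apply: cvgMl_tmp; apply: cvgB; [apply: cvgMl_tmp; exact: cvg_var0|exact: cvg_energy0].
- by move=> t; rewrite in_itv/= andbT => t0; exact: isd_derive1 (dF t t0).
Unshelve. all: by end_near. Qed.

End semigroup_decay.

(** * The given semigroup as a semigroup on L^2 *)

Section L2_semigroup.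
Context {R : realType} (beta : R).
Local Notation mu := (mu_ beta).
Local Notation V := (LfunType mu (lee1n 2)).
Local Notation ip := (@L2ip _ _ _ mu).
Local Notation nrm := (ip_norm (@L2ip _ _ _ mu)).
Let Hip := @L2_semi_inner_product _ _ _ mu.
Variable P : R -> (R -> R) -> (R -> R).
Hypothesis HP : generated_semigroup beta P.
Implicit Types (u v : V) (s t : R).

(** [P t u] is known to be in L^2 for [t >= 0] only; negative times receive the default 0. *)
Definition L2_semigroup t u : V :=
  if pselect (0 <= t) is left t0
  then Lfun_Sub (lee1n 2) (semigroup_L2 HP t0 (LfunP u)) else 0.

Lemma L2_semigroupE t u : 0 <= t -> L2_semigroup t u = P t u :> (R -> R).
Proof. by rewrite /L2_semigroup; case: pselect. Qed.

Lemma L2_semigroup_C0 : C0_semigroup ip L2_semigroup.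
Proof.
have aeE (f g : R -> R) u v : u = f :> (R -> R) -> v = g :> (R -> R) ->
  f = g %[ae mu] -> nrm (u - v) = 0 by move=> <- <-; exact: ae_nrm0.
split.
- move=> t c u v t0; apply: aeE (semigroup_linear HP c t0 (LfunP u) (LfunP v)).
    exact: L2_semigroupE.
  by rewrite -!L2_semigroupE.
- move=> t t0; have [C hC] := semigroup_bounded HP t0; exists C => u.
  have := hC _ (LfunP u); rewrite /L2norm -L2_semigroupE//.
  by rewrite (Lnorm_nrm u) (Lnorm_nrm (L2_semigroup t u)) -EFinM lee_fin.
- move=> u; apply: aeE (semigroup0 HP (LfunP u)) => //.
  exact: L2_semigroupE.
- move=> s t u s0 t0; apply: aeE (semigroupD HP s0 t0 (LfunP u)).
    by apply: L2_semigroupE; exact: addr_ge0.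
  by rewrite -L2_semigroupE// -L2_semigroupE.
- move=> u; have E : \forall t \near 0^'+, P t u = L2_semigroup t u :> (R -> R).
    near=> t; rewrite L2_semigroupE//; apply: ltW; near: t; exact: nbhs_right_gt.
  exact: ((L2cvg_nrm (u := u) E erefl).1 (semigroup_continuous HP (LfunP u))).
Unshelve. all: by end_near. Qed.

Lemma L2_semigroup_generates u v : generates ip L2_semigroup u v <-> graph u v.
Proof.
rewrite -LbarP (semigroup_generator HP (LfunP u) (LfunP v)); apply: iff_sym.
apply: L2cvg_nrm => //; near=> t.
have t0 : 0 <= t by apply: ltW; near: t; exact: nbhs_right_gt.
by rewrite -L2_semigroupE.
Unshelve. all: by end_near. Qed.

End L2_semigroup.

Theorem corollary5p2 (R : realType) (beta : R)
    (hbeta1 : 1 / 2 < beta) (hbeta2 : beta <= 3 / 2) :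
  lambda1 beta = ((beta - 1 / 2) ^+ 2)%:E /\
  forall P : R -> (R -> R) -> (R -> R), generated_semigroup beta P ->
  forall f : R -> R, Ccinfty f ->
    (((beta - 1 / 2) ^+ 2)%:E * 'V_(mu_ beta)[f]
      - \int[mu_ beta]_x (omega x * f^`()%classic x ^+ 2)%:E
     = (- 2)%:E * \int[lebesgue_measure]_(t in `[0%R, +oo[)
         \int[mu_ beta]_x
           (let u := C2_version beta (P t f) in
            (omega x * u^`(2)%classic x + (3 / 2 - beta) * x * u^`()%classic x) ^+ 2
            + (3 / 2 - beta) * (beta - 1 / 2) * u^`()%classic x ^+ 2)%R%:E)%E.
Proof.
split; first exact: lambda1E.
move=> P HP f cf.
pose Q := L2_semigroup HP.
pose HQ : C0_semigroup _ Q := L2_semigroup_C0 HP.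
have Hip := @L2_semi_inner_product _ _ _ (mu_ beta).
pose a := beta - 1 / 2; pose mean := L2ip (L2one (mu_ beta)).
pose cLf := Ccinfty_L beta cf.
pose u0 := core_elt beta cf; pose u1 := core_elt beta cLf.
pose u2 := core_elt beta (Ccinfty_L beta cLf).
have graph_core g (cg : Ccinfty g) : graph (core_elt beta cg) (core_elt beta (Ccinfty_L beta cg)).
  exists (fun=> core_elt beta cg), (fun=> core_elt beta (Ccinfty_L beta cg)); split.
  - by move=> n; exact: core_core_elt.
  - exact: cvg_nrm_cst.
  - exact: cvg_nrm_cst.
have u01 : graph u0 u1 by exact: graph_core.
have u12 : graph u1 u2 by exact: graph_core.
have Qgen u v : generates _ Q u v <-> graph u v := L2_semigroup_generates HP u v.
(* The orbit starts at [Q 0 u0], which equals [u0] only almost everywhere; the middle term keeps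
   [Q 0], which is then removed inside inner products. *)
transitivity ((- 2)%:E * (- (2^-1 * (a ^+ 2 * (L2ip (Q 0 u0) (Q 0 u0) - mean (Q 0 u0) ^+ 2)
    - - L2ip (Q 0 u0) (Q 0 u1))))%:E)%E; last first.
  congr (_ * _)%E; rewrite -(integral_dissipation hbeta1 hbeta2 HQ Qgen u01 u12).
  apply: eq_integral => t; rewrite inE/= in_itv/= andbT => t0.
  rewrite -(C2_version_integral hbeta1 hbeta2 (graph_orbit HQ Qgen t0 u01) (graph_orbit HQ Qgen t0 u12)).
  by rewrite /Q L2_semigroupE.
have Q0l u v : L2ip u (Q 0 v) = L2ip u v.
  apply/eqP; rewrite -subr_eq0 -(ipBr Hip) -normr_le0.
  by apply: le_trans (ler_ip Hip _ _) _; rewrite (C0_id HQ) mulr0.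
have Q0 u v : L2ip (Q 0 u) (Q 0 v) = L2ip u v by rewrite Q0l (ipC Hip) Q0l (ipC Hip).
rewrite !Q0 /mean Q0l -EFinM opprK.
have -> : ('V_(mu_ beta)[f] = (L2ip u0 u0 - L2ip (L2one (mu_ beta)) u0 ^+ 2)%:E)%E by exact: (variance_L2 u0).
have -> : (\int[mu_ beta]_x (omega x * f^`()%classic x ^+ 2)%:E = (- L2ip u0 u1)%:E)%E.
  rewrite (core_energy hbeta1 cf cf)// opprK /Rintegral fineK.
    by apply: eq_integral => x _; rewrite expr2 mulrA.
  apply: integrable_fin_num => //.
  exact/integrable_Lfun2/compact_supported_Lfun2/core_energy_compact.
rewrite -EFinM -EFinB; congr (_%:E).
by rewrite /a; field.
Qed.
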